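(* Let $g$ be a radial measurable function on $\mathbb{C}^n$ such that $g\zeta_\alpha\in L^2(\mathbb{C}^n,d\mu)$ for all $\alpha\in\mathbb{N}^n$. Then the Toeplitz operator $T_g$ is bounded on $\mathcal{F}(\mathbb{C}^n)$ if and only if the sequence $$\frac{k!(n-1)!}{(k+n-1)!}\int_{\mathbb{C}^n} (g*q_{1/4})(w)\,\varphi_k(2w)\,dw,\qquad k\in\mathbb{N},$$ is bounded.
   Context: $\mathbb{N}=\{0,1,2,\dots\}$, $n\ge 1$, and $dz$, $dw$ denote Lebesgue measure on $\mathbb{C}^n\cong\mathbb{R}^{2n}$. Let $d\mu(z)=(2\pi)^{-n}e^{-\frac12|z|^2}dz$. The Fock space $\mathcal{F}(\mathbb{C}^n)$ is the Hilbert space of entire functions $f$ on $\mathbb{C}^n$ with $\int_{\mathbb{C}^n}|f|^2d\mu<\infty$; its reproducing kernel is $e^{z\cdot\bar w/2}$ and an orthonormal basis is $\zeta_\alpha(z)=z^\alpha\,2^{-|\alpha|/2}(\alpha!)^{-1/2}$, $\alpha\in\mathbb{N}^n$. With $P$ the orthogonal projection of $L^2(\mathbb{C}^n,d\mu)$ onto $\mathcal{F}(\mathbb{C}^n)$, the Toeplitz operator with symbol $g$ is $T_gf=P(gf)$, i.e. $T_gf(z)=\int_{\mathbb{C}^n}g(w)f(w)e^{z\cdot\bar w/2}d\mu(w)$, defined on the dense span of the $\zeta_\alpha$; it is called bounded if it extends to a bounded operator on $\mathcal{F}(\mathbb{C}^n)$. A function on $\mathbb{C}^n$ is radial if it depends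 only on $|z|$. The heat kernel on $\mathbb{C}^n$ is $q_t(z)=(4\pi t)^{-n}e^{-\frac{1}{4t}|z|^2}$, $*$ is the usual convolution on $\mathbb{C}^n\cong\mathbb{R}^{2n}$, and $\varphi_k(z)=L_k^{n-1}(\tfrac12|z|^2)e^{-\frac14|z|^2}$, where $L_k^{n-1}$ is the Laguerre polynomial of degree $k$ and type $n-1$. *)

(* Defs.v *)
From HB Require Import structures.
From mathcomp Require Import all_boot all_order all_algebra.
From mathcomp Require Import complex.
From mathcomp Require Import all_classical all_reals all_analysis.

Set Implicit Arguments.
Unset Strict Implicit.
Unset Printing Implicit Defensive.

Import Order.TTheory GRing.Theory Num.Theory.
Import numFieldNormedType.Exports.

Local Open Scope classical_set_scope.
Local Open Scope ring_scope.
Local Open Scope complex_scope.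

Section product_sigma_finite.
Local Open Scope ereal_scope.
Context d1 d2 (T1 : measurableType d1) (T2 : measurableType d2) (R : realType).
Variable m1 : {sigma_finite_measure set T1 -> \bar R}.
Variable m2 : {sigma_finite_measure set T2 -> \bar R}.

Lemma sigma_finite_product : sigma_finite setT (m1 \x m2).
Proof.
have /sigma_finiteP[F [TF ndF Foo]] := sigma_finiteT m1.
have /sigma_finiteP[G [TG ndG Goo]] := sigma_finiteT m2.
exists (fun n => F n `*` G n).
  rewrite -setXTT TF TG predeqE => -[x y]; split.
    move=> [/= [n _ Fnx] [k _ Gky]]; exists (maxn n k) => //; split.
    - by move: x Fnx; exact/subsetPset/ndF/leq_maxl.
    - by move: y Gky; exact/subsetPset/ndG/leq_maxr.
  by move=> [n _ []/= ? ?]; split; exists n.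
move=> k; have [? ?] := Foo k; have [? ?] := Goo k.
split; first exact: measurableX.
by rewrite product_measure1E// lte_mul_pinfty// ge0_fin_numE.
Qed.

(** A copy of [m1 \x m2]: the library's sigma-finite structure on that term
    is shadowed by the one for products of subprobabilities. *)
Definition prod_measure : set (T1 * T2) -> \bar R := m1 \x m2.

HB.instance Definition _ := Measure.copy prod_measure (m1 \x m2).

HB.instance Definition _ := @Measure_isSigmaFinite.Build _ _ _ prod_measure
  sigma_finite_product.

End product_sigma_finite.

Section power_measure.
Local Open Scope ereal_scope.
Context d (T : measurableType d) (R : realType).
Variable mu : {sigma_finite_measure set T -> \bar R}.

Definition tcons n (p : T * n.-tuple T) : n.+1.-tuple T :=
  [tuple of p.1 :: p.2].

Definition tuncons n (t : n.+1.-tuple T) : T * n.-tuple T :=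
  (thead t, [tuple of behead t]).

Lemma tconsK n : cancel (@tcons n) (@tuncons n).
Proof.
by move=> -[x t]; rewrite /tcons /tuncons/= theadE; congr pair; exact: val_inj.
Qed.

Lemma measurable_tcons n : measurable_fun [set: T * n.-tuple T] (@tcons n).
Proof. exact: measurable_cons. Qed.

Lemma measurable_tuncons n : measurable_fun [set: n.+1.-tuple T] (@tuncons n).
Proof.
apply: measurable_fun_pair; last exact: measurable_behead.
exact: measurable_tnth.
Qed.

Section cons_measure.
Variables (n : nat) (nu : {sigma_finite_measure set (n.-tuple T) -> \bar R}).

Definition cons_measure : set (n.+1.-tuple T) -> \bar R :=
  pushforward (mu \x nu) (@tcons n).

Let cons_measure0 : cons_measure set0 = 0.
Proof. by rewrite /cons_measure /pushforward preimage_set0 measure0. Qed.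

Let cons_measure_ge0 A : 0 <= cons_measure A.
Proof. exact: (@measure_ge0 _ _ _ (mu \x nu)). Qed.

Let cons_measure_sigma_additive : semi_sigma_additive cons_measure.
Proof.
move=> F mF tF mUF; rewrite /cons_measure /pushforward preimage_bigcup.
apply: measure_semi_sigma_additive.
- by move=> i; rewrite -[X in measurable X]setTI; exact: measurable_tcons.
- apply/trivIsetP => /= i j _ _ ij; rewrite -preimage_setI.
  by move/trivIsetP : tF => /(_ _ _ _ _ ij) ->//; rewrite preimage_set0.
- by rewrite -preimage_bigcup -[X in measurable X]setTI; exact: measurable_tcons.
Qed.

HB.instance Definition _ := @isMeasure.Build _ _ _ cons_measure
  cons_measure0 cons_measure_ge0 cons_measure_sigma_additive.

Let cons_measure_sigma_finite : sigma_finite setT cons_measure.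
Proof.
have [F FT Foo] := sigma_finite_product mu nu.
exists (fun i => @tuncons n @^-1` F i).
  by rewrite -preimage_bigcup -FT preimage_setT.
move=> i; have [mF Fioo] := Foo i; split.
  by rewrite -[X in measurable X]setTI; exact: measurable_tuncons.
by rewrite /cons_measure /pushforward -comp_preimage (_ : _ \o _ = id)//;
  apply/funext => p; exact: tconsK.
Qed.

HB.instance Definition _ := @Measure_isSigmaFinite.Build _ _ _ cons_measure
  cons_measure_sigma_finite.

End cons_measure.

Fixpoint power_measure n : {sigma_finite_measure set (n.-tuple T) -> \bar R} :=
  match n with
  | 0 => \d_([tuple] : 0.-tuple T)
  | n'.+1 => cons_measure (power_measure n')
  end.

Lemma power_measureE n (A : 'I_n -> set T) : (forall i, measurable (A i)) ->
  power_measure n [set t | forall i, A i (tnth t i)] = \prod_(i < n) mu (A i).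
Proof.
elim: n A => [|n IH] A mA.
  rewrite big_ord0 /= diracE (_ : [set t | _] = setT) ?in_setT//.
  by apply/seteqP; split => // t _ [].
rewrite big_ord_recl /= /cons_measure /pushforward.
set B := [set t : n.-tuple T | forall i, A (lift ord0 i) (tnth t i)].
have -> : @tcons n @^-1` [set t | forall i, A i (tnth t i)] = A ord0 `*` B.
  apply/seteqP; split=> [[x t] /= AP|[x t] /= [Ax At] i].
    split=> [|i]; first by have := AP ord0; rewrite /tcons tnth0.
    by have := AP (lift ord0 i); rewrite /tcons tnthS.
  by case: (unliftP ord0 i) => [j|] ->; rewrite /tcons ?tnthS ?tnth0//; exact: At.
rewrite product_measure1E//; last first.
  rewrite (_ : B = \bigcap_(i in [set: 'I_n])
      ((fun t => tnth t i) @^-1` A (lift ord0 i))); last first.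
    by apply/seteqP; split=> t Bt i => [_|]; [exact: Bt|exact: (Bt i I)].
  apply: fin_bigcap_measurable => // i _.
  by rewrite -[X in measurable X]setTI; exact: measurable_tnth.
by rewrite -(IH (fun i => A (lift ord0 i))).
Qed.

End power_measure.

Section complex_space.
Variable R : realType.

Definition cexp (z : R[i]) : R[i] :=
  (expR (complex.Re z))%:C * (cos (complex.Im z) +i* sin (complex.Im z)).

Variable n : nat.
Implicit Types z w : 'rV[R[i]]_n.

Definition sqnorm z : R := \sum_(j < n) Normc.normc (z 0 j) ^+ 2.

Definition cnorm z : R := Num.sqrt (sqnorm z).

Definition hdot z w : R[i] := \sum_(j < n) z 0 j * (w 0 j)^*.

(** [C^n] carries no measurable structure of its own: everything measure
    theoretic is read on [(R * R)^n] through this bijection. *)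
Definition cvec (p : n.-tuple (measurableTypeR R * measurableTypeR R)) :
  'rV[R[i]]_n := \row_j ((tnth p j).1 +i* (tnth p j).2).

Definition lebesgueC :
    {sigma_finite_measure
      set (n.-tuple (measurableTypeR R * measurableTypeR R)) -> \bar R} :=
  power_measure (prod_measure lebesgue_measure lebesgue_measure) n.

Definition borel_fun (f : 'rV[R[i]]_n -> R[i]) : Prop :=
  measurable_fun setT (fun p => complex.Re (f (cvec p))) /\
  measurable_fun setT (fun p => complex.Im (f (cvec p))).

(** Measurability for the Lebesgue completion of the Borel sigma-algebra. The
    library's integral against [lebesgueC] is the Lebesgue integral also for
    such functions, since a nonnegative function and a Borel function equal to
    it almost everywhere have the same supremum of integrals of simple
    functions below them. *)
Definition lebesgue_measurable_fun (f : 'rV[R[i]]_n -> R[i]) : Prop :=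
  exists2 h, borel_fun h & {ae lebesgueC, forall p, f (cvec p) = h (cvec p)}.

Definition cint (f : 'rV[R[i]]_n -> R[i]) : R[i] :=
  (\int[lebesgueC]_p complex.Re (f (cvec p))) +i*
  (\int[lebesgueC]_p complex.Im (f (cvec p))).

Definition radial (f : 'rV[R[i]]_n -> R[i]) : Prop :=
  forall z w, cnorm z = cnorm w -> f z = f w.

Definition convolution (f h : 'rV[R[i]]_n -> R[i]) z : R[i] :=
  cint (fun w => f w * h (z - w)).

Definition heat_kernel (t : R) z : R :=
  ((4 * pi * t) ^+ n)^-1 * expR (- (sqnorm z / (4 * t))).

End complex_space.

(** Stated for a generic field because the library puts no topology on [R[i]]
    other than the one of its [numFieldType] structure. *)
Definition holomorphic (K : numFieldType) n (f : 'rV[K]_n -> K) : Prop :=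
  forall z, differentiable f z.

Section fock.
Variables (R : realType) (n : nat).
Implicit Types (f g : 'rV[R[i]]_n -> R[i]) (z w : 'rV[R[i]]_n).

Definition gauss_density z : R :=
  ((2 * pi) ^+ n)^-1 * expR (- (sqnorm z / 2)).

Definition sq_L2norm f : \bar R :=
  (\int[lebesgueC R n]_p
    (Normc.normc (f (cvec p)) ^+ 2 * gauss_density (cvec p))%:E)%E.

Definition in_L2 f : Prop :=
  lebesgue_measurable_fun f /\ (sq_L2norm f < +oo)%E.

Definition L2norm f : R := Num.sqrt (fine (sq_L2norm f)).

Definition entire f : Prop := @holomorphic R[i] n f.

Definition fock f : Prop := entire f /\ in_L2 f.

Definition zeta (alpha : {ffun 'I_n -> nat}) z : R[i] :=
  (\prod_(j < n) z 0 j ^+ alpha j) *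
  ((Num.sqrt (2 ^+ (\sum_(j < n) alpha j)))^-1 *
   (Num.sqrt (\prod_(j < n) (alpha j)`!%:R))^-1)%:C.

Definition zeta_span f : Prop :=
  exists s : seq (R[i] * {ffun 'I_n -> nat}),
    forall z, f z = \sum_(t <- s) t.1 * zeta t.2 z.

(** The orthogonal projection of [L^2(mu)] onto the Fock space, as the integral
    operator given by the reproducing kernel [exp (z . conj w / 2)]. *)
Definition fock_proj f z : R[i] :=
  cint (fun w => f w * cexp (hdot z w / 2) * (gauss_density w)%:C).

Definition toeplitz g f : 'rV[R[i]]_n -> R[i] :=
  fock_proj (fun w => g w * f w).

Definition fock_bounded_operator
    (S : ('rV[R[i]]_n -> R[i]) -> ('rV[R[i]]_n -> R[i])) : Prop :=
  [/\ forall f, fock f -> fock (S f),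
      forall (a : R[i]) f h, fock f -> fock h ->
        forall z, S (fun w => a * f w + h w) z = a * S f z + S h z &
      exists M : R, forall f, fock f -> L2norm (S f) <= M * L2norm f].

(** The Toeplitz operator is only defined on the span of the [zeta alpha]. *)
Definition toeplitz_bounded g : Prop :=
  exists S, fock_bounded_operator S /\
    forall f, zeta_span f -> S f = toeplitz g f.

End fock.

Section laguerre.
Variable R : realType.

(** The explicit form of the polynomial [L_k^a] with generating function
    [sum_k L_k^a(x) t^k = (1 - t)^(-a-1) exp (- x t / (1 - t))]. *)
Definition laguerre (k a : nat) : {poly R} :=
  \poly_(i < k.+1) ((-1) ^+ i * 'C(k + a, k - i)%:R / i`!%:R).

Definition laguerre_fun (n k : nat) (z : 'rV[R[i]]_n) : R :=
  (laguerre k (n - 1)).[sqnorm z / 2] * expR (- (sqnorm z / 4)).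

End laguerre.

(* Main.v *)
From HB Require Import structures.
Require Import Defs.
From mathcomp Require Import all_boot all_order all_algebra.
From mathcomp Require Import complex.
From mathcomp Require Import all_classical all_reals all_analysis.
From mathcomp Require Import measurable_realfun.
From mathcomp Require Import ring lra zify.

(** A radial symbol acts diagonally on monomials: T_g zeta_alpha is
    lambda_k zeta_alpha, where k is the degree of alpha and lambda_k is the
    coefficient of g zeta_alpha on zeta_alpha. So T_g is bounded if and only if
    the sequence lambda is, and the averages in the theorem turn out to be
    (- 1) ^ k pi ^ n lambda_k.

    Diagonality. The weight g is invariant under measure-preserving isometries.
    Multiplying one coordinate by a number of modulus 1 shows that g pairs
    distinct monomials to 0 ([pairing_neq]); rotating two coordinates into each
    other shows that its normalised pairing of a monomial with itself depends
    on the degree alone ([pairing_upd], [pairing_diag], [coef_radial]). Since g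
    is only Lebesgue measurable, it is first replaced by a Borel function that
    agrees with it almost everywhere; no integral changes ([cI_ae]).

    Boundedness. Expanding the reproducing kernel coordinate by coordinate, the
    projection of a square integrable function is, at every point, the sum of
    its monomial expansion ([proj_expansion]). A series with bounded
    coefficients in the basis zeta is entire ([fser_entire]), and Fatou's lemma
    with Bessel's inequality bound its norm. Hence a bounded sequence lambda
    defines a bounded operator on the Fock space ([diag_bounded]) which extends
    T_g ([toeplitz_diag]). Conversely an extension bounded by M sends the unit
    vector zeta_alpha to lambda_k zeta_alpha, so that |lambda_k| <= M.

    Averages. By Fubini, the integral of (g * q_{1/4}) (w) phi_k (2 w) is that
    of g (v) against the integral over w of q_{1/4} (w - v) phi_k (2 w). The
    product of exp (- |w - v| ^ 2) and exp (- |w| ^ 2) is a Gaussian centred at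
    v / 2, whose moments are Laguerre polynomials at the negative argument
    - |v| ^ 2 / 2 ([integral_two_gauss], [integral_gap_moment]). The
    alternating sum of these moments which is prescribed by the coefficients
    of L_k^{n-1} leaves a single power of |v| ^ 2 / 2 ([lagm_inversion]). By
    the multinomial theorem this power, divided by k!, is the sum of
    |zeta_alpha (v)| ^ 2 over the exponents of degree k ([sum_zeta_sqr]), so
    that the integral is (- 1) ^ k pi ^ n lambda_k times the number of these
    exponents, which the factorials in the theorem cancel
    ([normc_convolution_laguerre]). *)

Set Implicit Arguments.
Unset Strict Implicit.
Unset Printing Implicit Defensive.

Import Order.TTheory GRing.Theory Num.Theory.
Import numFieldNormedType.Exports.

Local Open Scope classical_set_scope.
Local Open Scope complex_scope.
Local Open Scope ring_scope.

(** * Measure-preserving maps and planar rotations *)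

Section mpres.
Context d (T : measurableType d) (R : realType).
Variable mu : {measure set T -> \bar R}.

Definition mpres (f : T -> T) : Prop :=
  measurable_fun setT f /\ forall A, measurable A -> mu (f @^-1` A) = mu A.

Lemma mpres_comp f f' : mpres f -> mpres f' -> mpres (f \o f').
Proof.
move=> [mf pf] [mf' pf']; split; first exact: measurableT_comp.
move=> A mA; rewrite comp_preimage pf' ?pf//.
by rewrite -[X in measurable X]setTI; exact: mf.
Qed.

Lemma ge0_integral_mpres f (F : T -> \bar R) : mpres f ->
  measurable_fun setT F -> (forall x, 0 <= F x)%E ->
  (\int[mu]_x F (f x) = \int[mu]_x F x)%E.
Proof.
move=> [mf pf] mF F0.
transitivity (\int[pushforward mu f]_x F x)%E.
  by rewrite ge0_integral_pushforward.
pose m1 : {measure set T -> \bar R} := pushforward mu f.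
by apply: (@eq_measure_integral _ _ _ setT mu (m1 mf)) => A mA _; exact: pf.
Qed.

Lemma integral_mpres f (F : T -> \bar R) : mpres f ->
  measurable_fun setT F -> (\int[mu]_x F (f x) = \int[mu]_x F x)%E.
Proof.
move=> pf mF; rewrite integralE [in RHS]integralE.
rewrite -(ge0_integral_mpres pf (measurable_funepos mF))//.
rewrite -(ge0_integral_mpres pf (measurable_funeneg mF))//.
by congr (_ - _)%E; apply: eq_integral => x _; rewrite !unlock.
Qed.

Lemma ae_mpres f (P : T -> Prop) : mpres f ->
  {ae mu, forall x, P x} -> {ae mu, forall x, P (f x)}.
Proof.
move=> [mf pf] [N [mN N0 PN]]; exists (f @^-1` N); split.
- by rewrite -[X in measurable X]setTI; exact: mf.
- by rewrite pf.
- by move=> x /= nP; exact: PN.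
Qed.
End mpres.

Section mpres_prod.
Context d1 d2 (T1 : measurableType d1) (T2 : measurableType d2) (R : realType).
Variable m1 : {sigma_finite_measure set T1 -> \bar R}.
Variable m2 : {sigma_finite_measure set T2 -> \bar R}.

(** The measure of a subset of a product is the integral of the measures of
    its sections, and each section is moved by a measure-preserving map. *)
Lemma mpres_fiber2 (phi : T1 * T2 -> T2) : measurable_fun setT phi ->
  (forall x, mpres m2 (fun y => phi (x, y))) ->
  mpres (m1 \x m2)%E (fun p => (p.1, phi p)).
Proof.
move=> mphi pphi; split; first exact: measurable_fun_pair.
move=> A mA; rewrite /product_measure1; apply: eq_integral => x _ /=.
have [_ pA] := pphi x; rewrite -(pA _ (measurable_xsection x mA)).
by congr (m2 _); apply/seteqP; split => y; rewrite /xsection/= !inE.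
Qed.

(** As above with the sections in the other direction, which compute the same
    product measure. *)
Lemma mpres_fiber1 (phi : T1 * T2 -> T1) : measurable_fun setT phi ->
  (forall y, mpres m1 (fun x => phi (x, y))) ->
  mpres (m1 \x m2)%E (fun p => (phi p, p.2)).
Proof.
move=> mphi pphi.
have mp : measurable_fun setT (fun p : T1 * T2 => (phi p, p.2)).
  exact: measurable_fun_pair.
split => // A mA.
have E (B : set (T1 * T2)) : measurable B ->
    (m1 \x m2)%E B = (m1 \x^ m2)%E B.
  move=> mB; apply: (product_measure_unique (m' := (m1 \x^ m2)%E)) => //.
  by move=> *; exact: product_measure2E.
apply: (etrans (E _ _)); first by rewrite -[X in measurable X]setTI; exact: mp.
apply: etrans (esym (E _ mA)).
rewrite /product_measure2; apply: eq_integral => y _ /=.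
have [_ pA] := pphi y; rewrite -(pA _ (measurable_ysection y mA)).
by congr (m1 _); apply/seteqP; split => x; rewrite /ysection/= !inE.
Qed.
End mpres_prod.

Section plane.
Variable R : realType.
Local Notation mR := (measurableTypeR R).
Local Notation leb := (@lebesgue_measure R).
Local Notation leb2 := (prod_measure leb leb).

(** A translated interval keeps its length, and Lebesgue measure is the only
    measure with these values on intervals. *)
Lemma mpres_translation (a : R) : mpres leb ((fun x => x + a) : mR -> mR).
Proof.
have mf : measurable_fun setT ((fun x => x + a) : mR -> mR).
  exact: measurable_funD.
split => // A mA.
pose m1 : {measure set mR -> \bar R} :=
  pushforward leb ((fun x => x + a) : mR -> mR).
apply/esym; rewrite -[RHS]/(m1 mf A); apply: lebesgue_measure_unique => // _ [[x y] _ <-].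
transitivity (leb `]x - a, y - a]%classic); last first.
  rewrite /m1 /pushforward; congr (leb _).
  by apply/seteqP; split => z /=; rewrite !in_itv/= ltrBlDr lerBrDr.
rewrite !lebesgue_measure_itv/= !lte_fin ltrD2r; case: ifPn => // _.
by rewrite -!EFinB; congr EFin; ring.
Qed.

Lemma mpres_translation2 (a : R * R) :
  mpres leb2 ((fun p => (p.1 + a.1, p.2 + a.2)) : mR * mR -> mR * mR).
Proof.
have -> : ((fun p => (p.1 + a.1, p.2 + a.2)) : mR * mR -> mR * mR) =
  (fun p => (p.1 + a.1, p.2)) \o (fun p => (p.1, p.2 + a.2)) by [].
apply: mpres_comp.
  apply: (@mpres_fiber1 _ _ mR mR R leb leb (fun p => p.1 + a.1)).
    by apply: measurable_funD.
  by move=> y; exact: mpres_translation.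
apply: (@mpres_fiber2 _ _ mR mR R leb leb (fun p => p.2 + a.2)).
  by apply: measurable_funD.
by move=> y; exact: mpres_translation.
Qed.

Definition rot2 (c s : R) (p : R * R) : R * R :=
  (c * p.1 - s * p.2, s * p.1 + c * p.2).

(** A rotation is a product of three shears, each of which translates one
    coordinate by a multiple of the other one. *)
Lemma mpres_rot2 (c s : R) : c ^+ 2 + s ^+ 2 = 1 -> s != 0 ->
  mpres leb2 (rot2 c s : mR * mR -> mR * mR).
Proof.
(* t is the tangent of half the angle of the rotation. *)
move=> cs s0; pose t := (1 - c) / s.
have shear1 a : mpres leb2 ((fun p => (p.1 + a * p.2, p.2)) : mR * mR -> mR * mR).
  apply: (@mpres_fiber1 _ _ mR mR R leb leb (fun p => p.1 + a * p.2)).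
    by apply: measurable_funD => //; apply: measurable_funM.
  by move=> y; exact: (mpres_translation (a * y)).
have shear2 a : mpres leb2 ((fun p => (p.1, p.2 + a * p.1)) : mR * mR -> mR * mR).
  apply: (@mpres_fiber2 _ _ mR mR R leb leb (fun p => p.2 + a * p.1)).
    by apply: measurable_funD => //; apply: measurable_funM.
  by move=> y; exact: (mpres_translation (a * y)).
have -> : (rot2 c s : mR * mR -> mR * mR) =
   (fun p => (p.1 + (- t) * p.2, p.2)) \o
   ((fun p => (p.1, p.2 + s * p.1)) \o (fun p => (p.1 + (- t) * p.2, p.2))).
  have ts : t * s = 1 - c by rewrite /t divfK.
  have tc : t * (1 + c) = s.
    apply: (mulIf s0); rewrite mulrAC ts -expr2.
    by rewrite -[s ^+ 2](addKr (c ^+ 2)) cs; ring.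
  apply/funext => -[x y]; rewrite /rot2 /=; congr pair.
    transitivity ((1 - t * s) * x - t * (2 - t * s) * y); last by ring.
    by rewrite ts -[in LHS]tc; ring.
  transitivity (s * x + (1 - t * s) * y); last by ring.
  by rewrite ts; ring.
by apply: mpres_comp => //; exact: mpres_comp.
Qed.

End plane.

(** * Powers of a measure *)

Section power.
Context d (T : measurableType d) (R : realType).
Variable mu : {sigma_finite_measure set T -> \bar R}.

Definition tset n (t : n.-tuple T) (i : 'I_n) (x : T) : n.-tuple T :=
  [tuple if j == i then x else tnth t j | j < n].

Lemma tnth_tset n (t : n.-tuple T) i x j :
  tnth (tset t i x) j = if j == i then x else tnth t j.
Proof. by rewrite tnth_mktuple. Qed.

Lemma tset_tcons0 n x (t : n.-tuple T) y :
  tset (tcons (x, t)) ord0 y = tcons (y, t).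
Proof.
apply: eq_from_tnth => j; rewrite tnth_tset.
by case: (unliftP ord0 j) => [k|] ->; rewrite /tcons ?tnthS ?tnth0 ?eqxx.
Qed.

Lemma tset_tconsS n x (t : n.-tuple T) (i : 'I_n) y :
  tset (tcons (x, t)) (lift ord0 i) y = tcons (x, tset t i y).
Proof.
apply: eq_from_tnth => j; rewrite tnth_tset.
case: (unliftP ord0 j) => [k|] ->; rewrite /tcons ?tnthS ?tnth0//=.
by rewrite tnth_tset (inj_eq (@lift_inj _ ord0)).
Qed.

Lemma measurable_tset n (i : 'I_n) (phi : n.-tuple T -> T) :
  measurable_fun setT phi -> measurable_fun setT (fun t => tset t i (phi t)).
Proof.
move=> mphi; apply/measurable_fun_tnthP => j.
have [->|ji] := eqVneq j i.
  by apply: eq_measurable_fun mphi => t _ /=; rewrite tnth_tset eqxx.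
apply: eq_measurable_fun (measurable_tnth j) => t _ /=.
by rewrite tnth_tset (negbTE ji).
Qed.

Lemma mpres_cons n (nu : {sigma_finite_measure set (n.-tuple T) -> \bar R})
    (f : n.+1.-tuple T -> n.+1.-tuple T) f' :
  measurable_fun setT f -> mpres (mu \x nu)%E f' ->
  (forall p, f (tcons p) = tcons (f' p)) -> mpres (cons_measure mu nu) f.
Proof.
move=> mf [mf' pf'] ff'; split => // A mA.
rewrite /= /cons_measure /pushforward.
rewrite -[RHS]pf'; last first.
  by rewrite -[X in measurable X]setTI; exact: measurable_tcons.
by congr (product_measure1 _ _ _); apply/seteqP; split => p /=; rewrite ff'.
Qed.

(** The displacement of the coordinate i may depend on the other coordinates.
    The induction peels off the first coordinate, so that either this
    coordinate or the remaining tuple is the moving fibre. *)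
Lemma mpres_coord n (i : 'I_n) (x0 : T) (phi : n.-tuple T * T -> T) :
  measurable_fun setT phi ->
  (forall t, mpres mu (fun x => phi (t, x))) ->
  (forall t x y, phi (tset t i y, x) = phi (t, x)) ->
  mpres (power_measure mu n) (fun t => tset t i (phi (t, tnth t i))).
Proof.
elim: n i phi => [[]//|n IH] i phi mphi pphi iphi.
have mf : measurable_fun setT (fun t => tset t i (phi (t, tnth t i))).
  apply: measurable_tset; apply: measurableT_comp => //.
  by apply: measurable_fun_pair => //; exact: measurable_tnth.
have mtc : measurable_fun setT (@tcons _ T n) by exact: measurable_tcons.
case: (unliftP ord0 i) iphi mf => [j|] -> iphi mf.
  pose phi' (p : T * n.-tuple T) :=
    tset p.2 j (phi (tcons p, tnth p.2 j)).
  apply: (@mpres_cons _ _ _ (fun p => (p.1, phi' p))) => //; last first.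
    move=> [x t]; rewrite tset_tconsS; congr (tcons (_, tset _ _ (phi (_, _)))).
    by rewrite /tcons tnthS.
  have mj : measurable_fun [set: T * n.-tuple T] (fun p => tnth p.2 j).
    exact: (measurableT_comp (measurable_tnth j) measurable_snd).
  apply: mpres_fiber2.
    apply/measurable_fun_tnthP => k.
    have [->|kj] := eqVneq k j.
      apply: (@eq_measurable_fun _ _ _ _ _ (fun p => phi (tcons p, tnth p.2 j))).
        by move=> p _ /=; rewrite tnth_tset eqxx.
      apply: measurableT_comp => //; exact: measurable_fun_pair.
    apply: (@eq_measurable_fun _ _ _ _ _ (fun p => tnth p.2 k)).
      by move=> p _ /=; rewrite tnth_tset (negbTE kj).
    exact: (measurableT_comp (measurable_tnth k) measurable_snd).
  move=> x; apply: (IH j (fun p => phi (tcons (x, p.1), p.2))).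
  - apply: measurableT_comp => //; apply: measurable_fun_pair => //.
    apply: (measurableT_comp mtc); exact: measurable_fun_pair.
  - by move=> t; exact: (pphi (tcons (x, t))).
  - by move=> t y z /=; rewrite -tset_tconsS iphi.
pose phi' (p : T * n.-tuple T) := phi (tcons p, p.1).
apply: (@mpres_cons _ _ _ (fun p => (phi' p, p.2))) => //; last first.
  by move=> [x t]; rewrite tset_tcons0 /phi' /tcons tnth0.
apply: mpres_fiber1.
  by apply: measurableT_comp => //; exact: measurable_fun_pair.
move=> t; rewrite [X in mpres _ X](_ : _ = fun x => phi (tcons (x0, t), x)).
  exact: pphi.
(* x0 fills the coordinate of which phi is independent. *)
apply/funext => x; rewrite /phi' /=.
by rewrite -(tset_tcons0 x0 t x) iphi.
Qed.

(** Tonelli, one coordinate at a time. *)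
Lemma ge0_integral_power_prod n (f : 'I_n -> T -> R) :
  (forall i, measurable_fun setT (f i)) -> (forall i x, 0 <= f i x) ->
  (\int[power_measure mu n]_t (\prod_(i < n) f i (tnth t i))%:E =
   \prod_(i < n) \int[mu]_x (f i x)%:E)%E.
Proof.
elim: n f => [|n IH] f mf f0.
  rewrite big_ord0; under eq_integral do rewrite big_ord0.
  by rewrite integral_cst//= diracT mul1e.
have mprod m (g : 'I_m -> T -> R) : (forall i, measurable_fun setT (g i)) ->
    measurable_fun setT (fun t : m.-tuple T => \prod_(i < m) g i (tnth t i)).
  move=> mg; apply: measurable_prod => i _.
  by apply: measurableT_comp => //; exact: measurable_tnth.
have mtc : measurable_fun setT (@tcons _ T n) by exact: measurable_tcons.
rewrite big_ord_recl -IH//.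
transitivity (\int[mu \x (power_measure mu n)]_p
    (\prod_(i < n.+1) f i (tnth (tcons p) i))%:E)%E.
  rewrite -[LHS]/(\int[pushforward (mu \x (power_measure mu n)) (@tcons _ T n)]_t
    (\prod_(i < n.+1) f i (tnth t i))%:E)%E.
  rewrite ge0_integral_pushforward//.
    by apply/measurable_EFinP; exact: mprod.
  by move=> t _; rewrite lee_fin prodr_ge0.
under eq_integral => p _.
  rewrite big_ord_recl; under eq_bigr do rewrite {1}/tcons tnthS.
  rewrite {1}/tcons tnth0.
  over.
rewrite fubini_tonelli1; last 2 first.
- apply/measurable_EFinP; apply: measurable_funM.
    by apply: measurableT_comp => //.
  exact: (measurableT_comp (mprod n (fun i => f (lift ord0 i)) _) measurable_snd).
- by move=> p; rewrite lee_fin mulr_ge0// prodr_ge0.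
rewrite /fubini_F /=.
under eq_integral => x _.
  under eq_integral do rewrite EFinM.
  rewrite ge0_integralZl//=; last 3 first.
  - apply/measurable_EFinP.
    exact: (mprod n (fun i => f (lift ord0 i)) (fun i => mf (lift ord0 i))).
  - by move=> t _; rewrite lee_fin prodr_ge0.
  - by rewrite lee_fin.
  over.
rewrite ge0_integralZr//.
- by apply/measurable_EFinP.
- by move=> x _; rewrite lee_fin.
- by apply: integral_ge0 => t _; rewrite lee_fin prodr_ge0.
Qed.

End power.

(** * Complex numbers and complex-valued integrals *)

Section complex_facts.
Variable R : realType.
Implicit Types z w : R[i].
Local Notation Re := (@complex.Re R).
Local Notation Im := (@complex.Im R).
Local Notation normc := (@Normc.normc R).

Lemma complex_eqP z w : Re z = Re w -> Im z = Im w -> z = w.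
Proof. by case: z w => [a b] [c d] /= -> ->. Qed.

Lemma ReD z w : Re (z + w) = Re z + Re w. Proof. by case: z; case: w. Qed.
Lemma ImD z w : Im (z + w) = Im z + Im w. Proof. by case: z; case: w. Qed.
Lemma ReN z : Re (- z) = - Re z. Proof. by case: z. Qed.
Lemma ImN z : Im (- z) = - Im z. Proof. by case: z. Qed.
Lemma ReM z w : Re (z * w) = Re z * Re w - Im z * Im w.
Proof. by case: z; case: w. Qed.
Lemma ImM z w : Im (z * w) = Re z * Im w + Im z * Re w.
Proof. by case: z; case: w. Qed.
Lemma ReJ z : Re z^* = Re z. Proof. by case: z. Qed.
Lemma ImJ z : Im z^* = - Im z. Proof. by case: z. Qed.

Lemma Re_sum I (s : seq I) (P : pred I) (F : I -> R[i]) :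
  Re (\sum_(i <- s | P i) F i) = \sum_(i <- s | P i) Re (F i).
Proof. by apply: (big_morph Re ReD). Qed.
Lemma Im_sum I (s : seq I) (P : pred I) (F : I -> R[i]) :
  Im (\sum_(i <- s | P i) F i) = \sum_(i <- s | P i) Im (F i).
Proof. by apply: (big_morph Im ImD). Qed.

Lemma normcE z : normc z = Num.sqrt (Re z ^+ 2 + Im z ^+ 2).
Proof. by case: z. Qed.

Lemma normc_ge0 z : 0 <= normc z. Proof. by rewrite normcE sqrtr_ge0. Qed.
Hint Resolve normc_ge0 : core.

Lemma normc_sqr z : normc z ^+ 2 = Re z ^+ 2 + Im z ^+ 2.
Proof. by rewrite normcE sqr_sqrtr// addr_ge0 ?sqr_ge0. Qed.

Lemma mulJ_normc z : z * z^* = (normc z ^+ 2)%:C.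
Proof.
rewrite normc_sqr; apply: complex_eqP; rewrite ?ReM ?ImM ReJ ImJ /=.
  by ring.
by ring.
Qed.

Lemma conjM z w : (z * w)^* = z^* * w^*.
Proof. exact: rmorphM. Qed.

Lemma conjR (x : R) : (x%:C : R[i])^* = x%:C.
Proof. by apply: complex_eqP; rewrite ?ReJ ?ImJ//= oppr0. Qed.

Lemma normcJ z : normc z^* = normc z.
Proof. by rewrite !normcE ReJ ImJ sqrrN. Qed.

Lemma normcM z w : normc (z * w) = normc z * normc w.
Proof. exact: Normc.normcM. Qed.

Lemma normcD z w : normc (z + w) <= normc z + normc w.
Proof. exact: le_normcD. Qed.

Lemma normc_real (x : R) : normc x%:C = `|x|.
Proof. by rewrite normcE /= expr0n/= addr0 sqrtr_sqr. Qed.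

Lemma normcX z n : normc (z ^+ n) = normc z ^+ n.
Proof.
by elim: n => [|n IH]; rewrite ?expr0 ?Normc.normc1// !exprS normcM IH.
Qed.

Lemma normc_prod I (s : seq I) (P : pred I) (F : I -> R[i]) :
  normc (\prod_(i <- s | P i) F i) = \prod_(i <- s | P i) normc (F i).
Proof. by apply: (big_morph normc normcM); rewrite Normc.normc1. Qed.

Lemma normc_sum I (s : seq I) (P : pred I) (F : I -> R[i]) :
  normc (\sum_(i <- s | P i) F i) <= \sum_(i <- s | P i) normc (F i).
Proof.
elim/big_rec2: _ => [|i x y _ xy]; first by rewrite Normc.normc0.
by apply: le_trans (normcD _ _) _; rewrite lerD2l.
Qed.

Lemma normRe z : `|Re z| <= normc z.
Proof.
rewrite -[leLHS]sqrtr_sqr normcE ler_sqrt ?addr_ge0 ?sqr_ge0//.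
by rewrite lerDl sqr_ge0.
Qed.

Lemma normIm z : `|Im z| <= normc z.
Proof.
rewrite -[leLHS]sqrtr_sqr normcE ler_sqrt ?addr_ge0 ?sqr_ge0//.
by rewrite lerDr sqr_ge0.
Qed.

(** Convergence of the real and imaginary parts, so that limits of complex
    sequences come down to limits of real ones. *)
Definition cvgC (u : nat -> R[i]) (l : R[i]) : Prop :=
  (Re (u n) @[n --> \oo] --> Re l) /\ (Im (u n) @[n --> \oo] --> Im l).

Lemma cvgC_cst l : cvgC (fun=> l) l.
Proof. by split; exact: cvg_cst. Qed.

Lemma cvgCD u v l m : cvgC u l -> cvgC v m -> cvgC (fun n => u n + v n) (l + m).
Proof.
move=> [ru iu] [rv iv]; split.
  by rewrite ReD; under eq_cvg do rewrite ReD; exact: cvgD.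
by rewrite ImD; under eq_cvg do rewrite ImD; exact: cvgD.
Qed.

Lemma cvgCN u l : cvgC u l -> cvgC (fun n => - u n) (- l).
Proof.
move=> [ru iu]; split.
  by rewrite ReN; under eq_cvg do rewrite ReN; exact: cvgN.
by rewrite ImN; under eq_cvg do rewrite ImN; exact: cvgN.
Qed.

Lemma cvgCM u v l m : cvgC u l -> cvgC v m -> cvgC (fun n => u n * v n) (l * m).
Proof.
move=> [ru iu] [rv iv]; split.
  rewrite ReM; under eq_cvg do rewrite ReM.
  by apply: cvgB; exact: cvgM.
rewrite ImM; under eq_cvg do rewrite ImM.
by apply: cvgD; exact: cvgM.
Qed.

Lemma cvgC_sum I (s : seq I) (u : I -> nat -> R[i]) (l : I -> R[i]) :
  (forall i, cvgC (u i) (l i)) ->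
  cvgC (fun n => \sum_(i <- s) u i n) (\sum_(i <- s) l i).
Proof.
move=> ul; elim: s => [|i s IH].
  rewrite big_nil [X in cvgC X _](_ : _ = fun=> 0); first exact: cvgC_cst.
  by apply/funext => n; rewrite big_nil.
rewrite big_cons [X in cvgC X _](_ : _ = fun n => u i n + \sum_(j <- s) u j n).
  exact: cvgCD.
by apply/funext => n; rewrite big_cons.
Qed.

Lemma cvgC_prod I (s : seq I) (u : I -> nat -> R[i]) (l : I -> R[i]) :
  (forall i, cvgC (u i) (l i)) ->
  cvgC (fun n => \prod_(i <- s) u i n) (\prod_(i <- s) l i).
Proof.
move=> ul; elim: s => [|i s IH].
  rewrite big_nil [X in cvgC X _](_ : _ = fun=> 1); first exact: cvgC_cst.
  by apply/funext => n; rewrite big_nil.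
rewrite big_cons [X in cvgC X _](_ : _ = fun n => u i n * \prod_(j <- s) u j n).
  exact: cvgCM.
by apply/funext => n; rewrite big_cons.
Qed.

Lemma cvgC_unique u l m : cvgC u l -> cvgC u m -> l = m.
Proof.
move=> [r i] [r' i']; apply: complex_eqP.
  exact: (cvg_unique _ r r').
exact: (cvg_unique _ i i').
Qed.

Lemma cvgC_norm u l : cvgC u l -> normc (u n) @[n --> \oo] --> normc l.
Proof.
move=> [r i]; rewrite normcE; under eq_cvg do rewrite normcE.
apply: continuous_cvg; first exact: sqrt_continuous.
by apply: cvgD; rewrite expr2; under eq_cvg do rewrite expr2; exact: cvgM.
Qed.

Lemma cvgC_squeeze u l (e : nat -> R) : (forall n, normc (u n - l) <= e n) ->
  e n @[n --> \oo] --> 0 -> cvgC u l.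
Proof.
move=> ue e0; split; apply/subr_cvg0/norm_cvg0P/(squeeze_cvgr _ (cvg_cst 0) e0).
  apply: nearW => n; rewrite normr_ge0/= -ReN -ReD.
  exact: le_trans (normRe _) (ue n).
apply: nearW => n; rewrite normr_ge0/= -ImN -ImD.
exact: le_trans (normIm _) (ue n).
Qed.

(** An increment bound by a convergent real sequence gives convergence without
    appealing to completeness of the complex numbers: adding the dominating
    sequence makes the real and imaginary parts monotone. *)
Lemma cvgC_dominated (u : nat -> R[i]) (A : nat -> R) (B : R) :
  (forall m n, (m <= n)%N -> normc (u n - u m) <= A n - A m) ->
  (forall n, A n <= B) -> exists l, cvgC u l.
Proof.
move=> uA AB.
have ndA : {homo A : m n / (m <= n)%N >-> m <= n}.
  by move=> m n /uA /(le_trans (normc_ge0 _)); rewrite subr_ge0.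
have key (f : R[i] -> R) : (forall z w, f (z - w) = f z - f w) ->
    (forall z, `|f z| <= normc z) -> cvgn (fun n => f (u n)).
  move=> fB fle.
  have cA : cvgn A.
    apply: nondecreasing_is_cvgn => //.
    by exists B => _ [n _ <-]; exact: AB.
  have incr m n : (m <= n)%N -> `|f (u n) - f (u m)| <= A n - A m.
    by move=> mn; rewrite -fB; exact: le_trans (fle _) (uA _ _ mn).
  have -> : (fun n => f (u n)) = (fun n => (f (u n) + A n) - A n).
    by apply/funext => n; rewrite addrK.
  apply: is_cvgB => //; apply: nondecreasing_is_cvgn => [m n mn|].
    by have /ler_normlP[] := incr _ _ mn; lra.
  exists (f (u 0%N) + 2 * B - A 0%N) => _ [n _ <-].
  by have /ler_normlP[] := incr _ _ (leq0n n); have := AB n; lra.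
exists (limn (fun n => Re (u n)) +i* limn (fun n => Im (u n))); split.
  apply: key; [by move=> z w; rewrite ReD ReN|exact: normRe].
apply: key; [by move=> z w; rewrite ImD ImN|exact: normIm].
Qed.

End complex_facts.
#[global] Hint Extern 0 (is_true (0 <= Normc.normc _)) => (exact: normc_ge0) : core.

Section complex_integral.
Context d (T : measurableType d) (R : realType).
Variable mu : {measure set T -> \bar R}.
Implicit Types f g : T -> R[i].
Local Notation Re := (@complex.Re R).
Local Notation Im := (@complex.Im R).
Local Notation normc := (@Normc.normc R).

Definition cmeas f := measurable_fun setT (fun x => Re (f x)) /\
  measurable_fun setT (fun x => Im (f x)).

Definition cintegrable f := mu.-integrable setT (fun x => (Re (f x))%:E) /\
  mu.-integrable setT (fun x => (Im (f x))%:E).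

Definition cI f : R[i] :=
  (\int[mu]_x Re (f x)) +i* (\int[mu]_x Im (f x)).

Lemma cmeas_cst c : cmeas (fun=> c).
Proof. by split; exact: measurable_cst. Qed.

Lemma cmeasD f g : cmeas f -> cmeas g -> cmeas (fun x => f x + g x).
Proof.
move=> [rf imf] [rg img]; split.
  by under eq_fun do rewrite ReD; exact: measurable_funD.
by under eq_fun do rewrite ImD; exact: measurable_funD.
Qed.

Lemma cmeasM f g : cmeas f -> cmeas g -> cmeas (fun x => f x * g x).
Proof.
move=> [rf imf] [rg img]; split.
  by under eq_fun do rewrite ReM; apply: measurable_funB; exact: measurable_funM.
by under eq_fun do rewrite ImM; apply: measurable_funD; exact: measurable_funM.
Qed.

Lemma cmeasJ f : cmeas f -> cmeas (fun x => (f x)^*).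
Proof.
move=> [rf imf]; split; first by under eq_fun do rewrite ReJ.
by under eq_fun do rewrite ImJ; exact: measurable_funN.
Qed.

Lemma cmeas_real (h : T -> R) : measurable_fun setT h -> cmeas (fun x => (h x)%:C).
Proof. by move=> mh; split => //=; exact: measurable_cst. Qed.

Lemma cmeasX f n : cmeas f -> cmeas (fun x => f x ^+ n).
Proof.
move=> mf; elim: n => [|n IH].
  by under eq_fun do rewrite expr0; exact: cmeas_cst.
by under eq_fun do rewrite exprS; exact: cmeasM.
Qed.

Lemma cmeas_sum I (s : seq I) (F : I -> T -> R[i]) :
  (forall i, cmeas (F i)) -> cmeas (fun x => \sum_(i <- s) F i x).
Proof.
move=> mF; elim: s => [|i s IH].
  by under eq_fun do rewrite big_nil; exact: cmeas_cst.
by under eq_fun do rewrite big_cons; exact: cmeasD.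
Qed.

Lemma cmeas_prod I (s : seq I) (F : I -> T -> R[i]) :
  (forall i, cmeas (F i)) -> cmeas (fun x => \prod_(i <- s) F i x).
Proof.
move=> mF; elim: s => [|i s IH].
  by under eq_fun do rewrite big_nil; exact: cmeas_cst.
by under eq_fun do rewrite big_cons; exact: cmeasM.
Qed.

Lemma cmeas_cvg (F : nat -> T -> R[i]) f : (forall n, cmeas (F n)) ->
  (forall x, cvgC (F ^~ x) (f x)) -> cmeas f.
Proof.
move=> mF Ff; split.
  apply: (@measurable_fun_cvg _ _ _ _ (fun n x => Re (F n x))) => [n|x _].
    by have [] := mF n.
  by have [] := Ff x.
apply: (@measurable_fun_cvg _ _ _ _ (fun n x => Im (F n x))) => [n|x _].
  by have [] := mF n.
by have [] := Ff x.
Qed.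

Lemma measurable_normc f : cmeas f -> measurable_fun setT (fun x => normc (f x)).
Proof.
move=> [rf imf]; under eq_fun do rewrite normcE.
have msqrt : measurable_fun setT (@Num.sqrt R).
  by apply: continuous_measurable_fun; exact: sqrt_continuous.
apply: (measurableT_comp msqrt).
by apply: measurable_funD; exact: measurable_funX.
Qed.

Lemma cintegrable_dom f (G : T -> R) : cmeas f ->
  (forall x, normc (f x) <= G x) -> mu.-integrable setT (fun x => (G x)%:E) ->
  cintegrable f.
Proof.
move=> [rf imf] fG iG; split.
  apply: (le_integrable _ _ _ iG) => //; first exact/measurable_EFinP.
  move=> x _; rewrite lee_fin; apply: le_trans (ler_norm _).
  exact: le_trans (normRe _) (fG x).
apply: (le_integrable _ _ _ iG) => //; first exact/measurable_EFinP.
move=> x _; rewrite lee_fin; apply: le_trans (ler_norm _).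
exact: le_trans (normIm _) (fG x).
Qed.

Lemma cintegrableD f g : cintegrable f -> cintegrable g ->
  cintegrable (fun x => f x + g x).
Proof.
move=> [rf imf] [rg img]; split.
  by under eq_fun do rewrite ReD EFinD; exact: integrableD.
by under eq_fun do rewrite ImD EFinD; exact: integrableD.
Qed.

Lemma cintegrableZ c f : cintegrable f -> cintegrable (fun x => c * f x).
Proof.
move=> [rf imf]; split.
  under eq_fun do rewrite ReM EFinB !EFinM.
  by apply: integrableB => //; exact: integrableZl.
under eq_fun do rewrite ImM EFinD !EFinM.
by apply: integrableD => //; exact: integrableZl.
Qed.

Lemma cintegrable0 : cintegrable (fun=> 0).
Proof. by split; exact: integrable0. Qed.

Lemma cintegrable_sum I (s : seq I) (F : I -> T -> R[i]) :
  (forall i, cintegrable (F i)) -> cintegrable (fun x => \sum_(i <- s) F i x).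
Proof.
move=> mF; elim: s => [|i s IH].
  by under eq_fun do rewrite big_nil; exact: cintegrable0.
by under eq_fun do rewrite big_cons; exact: cintegrableD.
Qed.

Lemma cI_D f g : cintegrable f -> cintegrable g ->
  cI (fun x => f x + g x) = cI f + cI g.
Proof.
move=> [rf imf] [rg img]; apply: complex_eqP; rewrite ?ReD ?ImD /=.
  by rewrite -RintegralD//; apply: eq_Rintegral => x _; rewrite ReD.
by rewrite -RintegralD//; apply: eq_Rintegral => x _; rewrite ImD.
Qed.

Lemma cI_Z c f : cintegrable f -> cI (fun x => c * f x) = c * cI f.
Proof.
move=> [rf imf].
have iZ (a : R) (h : T -> R) : mu.-integrable setT (fun x => (h x)%:E) ->
    mu.-integrable setT (EFin \o (fun x => a * h x)).
  by move=> ih; rewrite /comp; under eq_fun do rewrite EFinM; exact: integrableZl.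
apply: complex_eqP; rewrite ?ReM ?ImM /=.
  rewrite -!RintegralZl// -RintegralB//; last 2 first.
  - exact: iZ.
  - exact: iZ.
  by apply: eq_Rintegral => x _; rewrite ReM.
rewrite -!RintegralZl// -RintegralD//; last 2 first.
- exact: iZ.
- exact: iZ.
by apply: eq_Rintegral => x _; rewrite ImM.
Qed.

Lemma cI_0 : cI (fun=> 0) = 0.
Proof. by apply: complex_eqP; rewrite /= Rintegral_cst// mul0r. Qed.

Lemma cI_sum I (s : seq I) (F : I -> T -> R[i]) :
  (forall i, cintegrable (F i)) ->
  cI (fun x => \sum_(i <- s) F i x) = \sum_(i <- s) cI (F i).
Proof.
move=> mF; elim: s => [|i s IH].
  rewrite big_nil -[RHS]cI_0; congr cI; apply/funext => x; exact: big_nil.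
rewrite big_cons -IH -cI_D//; last exact: cintegrable_sum.
by congr cI; apply/funext => x; exact: big_cons.
Qed.

Lemma cI_real (h : T -> R) : cI (fun x => (h x)%:C) = (\int[mu]_x h x)%:C.
Proof. by apply: complex_eqP => //=; rewrite Rintegral_cst// mul0r. Qed.

Lemma cI_conj f : cintegrable f -> cI (fun x => (f x)^*) = (cI f)^*.
Proof.
move=> [rf imf]; apply: complex_eqP; rewrite ?ReJ ?ImJ /=.
  by apply: eq_Rintegral => x _; rewrite ReJ.
rewrite -[RHS]mulN1r -RintegralZl//.
by apply: eq_Rintegral => x _; rewrite ImJ mulN1r.
Qed.

Lemma cI_mpres f p : mpres mu p -> cmeas f -> cI (fun x => f (p x)) = cI f.
Proof.
move=> pp [rf imf]; apply: complex_eqP; rewrite /= /Rintegral; congr fine.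
  by apply: (@integral_mpres _ _ _ _ _ (fun x => (Re (f x))%:E)) => //;
    exact/measurable_EFinP.
by apply: (@integral_mpres _ _ _ _ _ (fun x => (Im (f x))%:E)) => //;
    exact/measurable_EFinP.
Qed.

Lemma cI_dominated (F : nat -> T -> R[i]) f (G : T -> R) :
  (forall n, cmeas (F n)) -> (forall x, cvgC (F ^~ x) (f x)) ->
  (forall n x, normc (F n x) <= G x) ->
  mu.-integrable setT (fun x => (G x)%:E) -> cvgC (fun n => cI (F n)) (cI f).
Proof.
move=> mF Ff FG iG; have mf := cmeas_cvg mF Ff.
have key (r : R[i] -> R) : (forall z, `|r z| <= normc z) ->
    (forall n, measurable_fun setT (fun x => r (F n x))) ->
    measurable_fun setT (fun x => r (f x)) ->
    (forall x, r (F n x) @[n --> \oo] --> r (f x)) ->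
    \int[mu]_x r (F n x) @[n --> \oo] --> \int[mu]_x r (f x).
  move=> rle mrF mrf rFf.
  have mF' n : measurable_fun setT (fun x => (r (F n x))%:E).
    exact/measurable_EFinP.
  have mf' : measurable_fun setT (fun x => (r (f x))%:E).
    exact/measurable_EFinP.
  have [|||irf _ cvI] := @dominated_convergence _ _ _ mu setT measurableT
    (fun n x => (r (F n x))%:E) (fun x => (r (f x))%:E) (fun x => (G x)%:E) mF' mf'.
  - by apply: aeW => x _; apply: cvg_EFin; [exact: nearW|exact: rFf].
  - exact: iG.
  - by apply: aeW => x n _; rewrite lee_fin; exact: le_trans (rle _) (FG n x).
  apply: fine_cvg; rewrite fineK//.
  exact: integrable_fin_num.
split; apply: key => //.
- exact: normRe.
- by move=> n; case: (mF n).
- by case: mf.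
- by move=> x; case: (Ff x).
- exact: normIm.
- by move=> n; case: (mF n).
- by case: mf.
- by move=> x; case: (Ff x).
Qed.

End complex_integral.

(** * Integrals of functions that agree almost everywhere *)

Section nonmeasurable.
Context d (T : measurableType d) (R : realType).
Variable mu : {measure set T -> \bar R}.
Import HBNNSimple.

(** The integral of f, measurable or not, is the supremum of the integrals of
    the simple functions below it. Such a function is below h almost
    everywhere, and one below h becomes one below f when it is set to zero on
    a null set. *)
Lemma ge0_integral_ae (f h : T -> \bar R) :
  (forall x, 0 <= f x)%E -> (forall x, 0 <= h x)%E -> measurable_fun setT h ->
  {ae mu, forall x, f x = h x} -> (\int[mu]_x f x = \int[mu]_x h x)%E.
Proof.
move=> f0 h0 mh fh; apply/eqP; rewrite eq_le; apply/andP; split.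
  rewrite [leLHS]ge0_integralTE//; apply: ge_ereal_sup => _ [s /= sf <-].
  have -> : sintegral mu s = (\int[mu]_x (s x)%:E)%E.
    by rewrite integral_nnsfun// patch_setT.
  apply: ae_ge0_le_integral => //.
  - by move=> x _; rewrite lee_fin.
  - by apply/measurable_EFinP; exact: measurable_funP.
  - by apply: filterS fh => x <- _; exact: sf.
rewrite [leLHS]ge0_integralTE//; apply: ge_ereal_sup => _ [s /= sh <-].
have [N [mN N0 fhN]] := fh.
pose s' := mul_nnsfun s (indic_nnsfun R (measurableC mN)).
have -> : sintegral mu s = sintegral mu s'.
  have E (v : {nnsfun T >-> R}) : sintegral mu v = (\int[mu]_x (v x)%:E)%E.
    by rewrite integral_nnsfun// patch_setT.
  rewrite !E; apply: ge0_ae_eq_integral => //.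
  - by apply/measurable_EFinP; exact: measurable_funP.
  - by apply/measurable_EFinP; exact: measurable_funP.
  - by move=> x _; rewrite lee_fin.
  - by move=> x _; rewrite lee_fin.
  exists N; split => // x /= /not_implyP[_]; apply: contra_notP => Nx.
  by rewrite -[mindic _ _ _]/(\1_(~` N) x) indicE mem_set// mulr1.
rewrite ge0_integralTE//; apply: ereal_sup_ubound; exists s' => // x /=.
rewrite -[mindic _ _ _]/(\1_(~` N) x) indicE.
have [xN|xN] := boolP (x \in ~` N); last by rewrite mulr0.
rewrite mulr1; have -> : f x = h x.
  by apply: contrapT => /fhN Nx; move: xN; rewrite inE => /(_ Nx).
exact: sh.
Qed.

Lemma integral_ae (f h : T -> \bar R) : measurable_fun setT h ->
  {ae mu, forall x, f x = h x} -> (\int[mu]_x f x = \int[mu]_x h x)%E.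
Proof.
move=> mh fh; rewrite integralE [in RHS]integralE.
congr (_ - _)%E; apply: ge0_integral_ae => //.
- exact: measurable_funepos.
- by apply: filterS fh => x fh; rewrite !unlock fh.
- exact: measurable_funeneg.
- by apply: filterS fh => x fh; rewrite !unlock fh.
Qed.

Lemma cI_ae (f h : T -> R[i]) : cmeas h -> {ae mu, forall x, f x = h x} ->
  cI mu f = cI mu h.
Proof.
move=> [rh ih] fh; apply: complex_eqP; rewrite /= /Rintegral; congr fine.
  apply: integral_ae; first exact/measurable_EFinP.
  by apply: filterS fh => x ->.
apply: integral_ae; first exact/measurable_EFinP.
by apply: filterS fh => x ->.
Qed.

End nonmeasurable.

(** * The complex exponential series *)

Lemma sum_triangle (V : nmodType) N (F : nat -> nat -> V) :
  \sum_(s < N) \sum_(p < s.+1) F p (s - p)%N =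
  \sum_(p < N) \sum_(0 <= q < N - p) F p q.
Proof.
elim: N => [|N IH]; first by rewrite !big_ord0.
rewrite big_ord_recr/= {}IH [in RHS]big_ord_recr/= subSn// subnn big_nat1.
rewrite big_ord_recr/= subnn addrA; congr (_ + _).
rewrite -big_split/=; apply: eq_bigr => p _.
by rewrite subSn 1?ltnW// big_nat_recr.
Qed.

Section exponential.

Definition pexp (K : fieldType) (N : nat) (x : K) : K :=
  \sum_(k < N) x ^+ k / k`!%:R.

Lemma exprD_fact (K : numFieldType) (a b : K) n :
  (a + b) ^+ n / n`!%:R =
  \sum_(i < n.+1) (a ^+ i / i`!%:R) * (b ^+ (n - i) / (n - i)`!%:R).
Proof.
rewrite addrC exprDn mulr_suml; apply: eq_bigr => i _.
have in' : (i <= n)%N by rewrite -ltnS.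
have f0 k : k`!%:R != 0 :> K by rewrite pnatr_eq0 -lt0n fact_gt0.
have /(congr1 (fun m => m%:R : K)) := bin_fact in'.
rewrite !natrM => E; apply: (mulIf (f0 n)); rewrite divfK// -E -mulr_natr.
by field; rewrite !f0.
Qed.

(** Minus the truncation at the sum, the product of the truncations keeps the
    terms of total degree at least N. Bounding them termwise by the same
    difference for the moduli reduces the convergence of complex series to
    that of real ones. *)
Lemma pexpD (K : numFieldType) N (a b : K) :
  pexp N a * pexp N b - pexp N (a + b) =
  \sum_(i < N) \sum_(N - i <= j < N) (a ^+ i / i`!%:R) * (b ^+ j / j`!%:R).
Proof.
have -> : pexp N (a + b) =
    \sum_(i < N) \sum_(0 <= j < N - i) (a ^+ i / i`!%:R) * (b ^+ j / j`!%:R).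
  rewrite -(sum_triangle N (fun i j => (a ^+ i / i`!%:R) * (b ^+ j / j`!%:R))).
  by apply: eq_bigr => s _; exact: exprD_fact.
rewrite /pexp mulr_suml -sumrB; apply: eq_bigr => i _.
rewrite mulr_sumr -(big_mkord xpredT (fun j =>
  (a ^+ i / i`!%:R) * (b ^+ j / j`!%:R))).
by rewrite (big_cat_nat (leq0n _) (leq_subr i N))/= addrAC subrr add0r.
Qed.

Variable R : realType.
Implicit Types z w : R[i].

Lemma pexp_cvg_expR (x : R) : pexp N x @[N --> \oo] --> expR x.
Proof.
have -> : (fun N => pexp N x) = series (exp_coeff x).
  by apply/funext => N; rewrite /pexp/series/= big_mkord.
exact: is_cvg_series_exp_coeff.
Qed.

Lemma pexp_le_expR N (x : R) : 0 <= x -> pexp N x <= expR x.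
Proof.
move=> x0.
have -> : pexp N x = series (exp_coeff x) N.
  by rewrite /pexp/series/= big_mkord.
apply: nondecreasing_cvgn_le; last exact: is_cvg_series_exp_coeff.
by apply: nondecreasing_series => k _ _; exact: exp_coeff_ge0.
Qed.

Lemma natr_complex k : (k%:R : R[i]) = (k%:R : R)%:C.
Proof. by rewrite rmorph_nat. Qed.

Lemma normc_pexp_term k z :
  Normc.normc (z ^+ k / k`!%:R) = Normc.normc z ^+ k / k`!%:R.
Proof.
by rewrite normcM normcX natr_complex -fmorphV normc_real ger0_norm.
Qed.

Lemma normc_pexp N z : Normc.normc (pexp N z) <= expR (Normc.normc z).
Proof.
apply: le_trans (pexp_le_expR N (normc_ge0 z)).
apply: le_trans (normc_sum _ _ _) _.
by apply: ler_sum => k _; rewrite normc_pexp_term.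
Qed.

Lemma pexp_real N (x : R) : pexp N x%:C = (pexp N x)%:C.
Proof.
rewrite /pexp rmorph_sum; apply: eq_bigr => k _.
by rewrite natr_complex rmorphM rmorphXn fmorphV.
Qed.

Lemma pexp_imaginary (y : R) :
  cvgC (fun N => pexp N (0 +i* y)) (cos y +i* sin y).
Proof.
have E k : (0 +i* y) ^+ k / k`!%:R = (cos_coeff y k) +i* (sin_coeff y k).
  have E2 m : (0 +i* y) ^+ m.*2 = ((-1) ^+ m * y ^+ m.*2)%:C.
    rewrite -muln2 mulnC !exprM expr2.
    have -> : (0 +i* y) * (0 +i* y) = (- (y ^+ 2))%:C.
      by apply: complex_eqP => /=; ring.
    by rewrite -rmorphXn [X in X%:C = _]exprNn.
  rewrite natr_complex -fmorphV cos_coeffE sin_coeffE.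
  rewrite -[k]odd_double_half; case: (odd k); rewrite /= ?add0n ?add1n.
    rewrite exprS E2 /= odd_double /= doubleK [y ^+ _.+1]exprS.
    by apply: complex_eqP => /=; ring.
  rewrite E2 /= odd_double /= doubleK.
  by apply: complex_eqP => /=; ring.
split => /=.
  have -> : cos y = limn (series (cos_coeff y)) by rewrite cosE cos_coeffE.
  rewrite [X in X @ _](_ : _ = series (cos_coeff y)).
    exact: is_cvg_series_cos_coeff.
  apply/funext => N; rewrite /pexp Re_sum /series/= big_mkord.
  by apply: eq_bigr => k _; rewrite E.
have -> : sin y = limn (series (sin_coeff y)) by rewrite sinE sin_coeffE.
rewrite [X in X @ _](_ : _ = series (sin_coeff y)).
  exact: is_cvg_series_sin_coeff.
apply/funext => N; rewrite /pexp Im_sum /series/= big_mkord.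
by apply: eq_bigr => k _; rewrite E.
Qed.

(** The exponential series is known on the real and on the imaginary axis, and
    pexpD compares its truncations at a sum with their products. *)
Lemma pexp_cvg_cexp z : cvgC (fun N => pexp N z) (cexp z).
Proof.
case: z => x y.
have zE : x +i* y = x%:C + (0 +i* y) by apply: complex_eqP => /=; ring.
set a := x%:C; set b := 0 +i* y.
pose D N := pexp N a * pexp N b - pexp N (a + b).
have Dle N : Normc.normc (D N - 0) <= pexp N (Normc.normc a) *
    pexp N (Normc.normc b) - pexp N (Normc.normc a + Normc.normc b).
  rewrite subr0 /D !pexpD; apply: le_trans (normc_sum _ _ _) _.
  apply: ler_sum => i _; apply: le_trans (normc_sum _ _ _) _.
  by apply: ler_sum => j _; rewrite normcM !normc_pexp_term.
have D0 : cvgC D 0.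
  apply: (cvgC_squeeze Dle).
  rewrite -[X in _ --> X](subrr (expR (Normc.normc a + Normc.normc b))).
  apply: cvgB; last exact: pexp_cvg_expR.
  by rewrite expRD; apply: cvgM; exact: pexp_cvg_expR.
rewrite zE [X in cvgC X _](_ : _ = fun N => pexp N a * pexp N b + - D N).
  have -> : cexp (a + b) = (expR x)%:C * (cos y +i* sin y) + - 0.
    by rewrite /cexp/= addr0 add0r subr0.
  apply: cvgCD; last exact: cvgCN.
  apply: cvgCM; last exact: pexp_imaginary.
  split => /=.
    by under eq_cvg do rewrite pexp_real; exact: pexp_cvg_expR.
  by under eq_cvg do rewrite pexp_real; exact: cvg_cst.
by apply/funext => N; rewrite /D subKr.
Qed.

Lemma cexpD z w : cexp (z + w) = cexp z * cexp w.
Proof.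
case: z w => [a b] [c e]; rewrite /cexp /= expRD cosD sinD.
by apply: complex_eqP => /=; ring.
Qed.

Lemma cexp_sum I (s : seq I) (F : I -> R[i]) :
  cexp (\sum_(i <- s) F i) = \prod_(i <- s) cexp (F i).
Proof.
elim: s => [|i s IH].
  rewrite !big_nil /cexp/= expR0 cos0 sin0.
  by apply: complex_eqP => /=; ring.
by rewrite !big_cons cexpD IH.
Qed.

End exponential.

(** * Isometries of complex space *)

Section coordinates.
Variables (R : realType) (n : nat).
Local Notation mR := (measurableTypeR R).
Local Notation X := (mR * mR)%type.
Local Notation leb := (@lebesgue_measure R).
Local Notation leb2 := (prod_measure leb leb).
Local Notation L := (@lebesgueC R n).
Local Notation normc := (@Normc.normc R).
Implicit Types (p : n.-tuple X) (i j : 'I_n).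

Definition coord j p : R[i] := (tnth p j).1 +i* (tnth p j).2.

Arguments coord : simpl never.

Lemma cvecE p j : cvec p 0 j = coord j p. Proof. by rewrite /cvec mxE. Qed.

Lemma cmeas_coord j : cmeas (coord j).
Proof.
split => /=.
  exact: (measurableT_comp measurable_fst (measurable_tnth j)).
exact: (measurableT_comp measurable_snd (measurable_tnth j)).
Qed.

Lemma sqnorm_cvec p : sqnorm (cvec p) = \sum_(j < n) normc (coord j p) ^+ 2.
Proof. by apply: eq_bigr => j _; rewrite cvecE. Qed.

Lemma measurable_sqnorm_cvec : measurable_fun setT (fun p => sqnorm (cvec p)).
Proof.
under eq_fun do rewrite sqnorm_cvec.
apply: measurable_sum => j; apply: measurable_funX.
exact: measurable_normc (cmeas_coord j).
Qed.

(** What a radial weight sees of a unitary map: it preserves Lebesgue measure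
    and the norm. *)
Definition isometric (f : n.-tuple X -> n.-tuple X) : Prop :=
  mpres L f /\ forall p, sqnorm (cvec (f p)) = sqnorm (cvec p).

Definition turn (c s : R) j p : n.-tuple X := tset p j (rot2 c s (tnth p j)).

Lemma coord_turn c s j p k :
  coord k (turn c s j p) = if k == j then (c +i* s) * coord j p else coord k p.
Proof.
rewrite /turn /coord tnth_tset; case: ifP => // _.
by apply: complex_eqP => /=; ring.
Qed.

Lemma isometric_turn c s j : c ^+ 2 + s ^+ 2 = 1 -> s != 0 ->
  isometric (turn c s j).
Proof.
move=> cs s0; split.
  apply: (@mpres_coord _ _ _ leb2 n j ((0 : mR), (0 : mR))
    (fun q => rot2 c s q.2)) => //.
  - have [mr _] := mpres_rot2 cs s0.
    exact: (measurableT_comp mr measurable_snd).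
  - by move=> t; exact: mpres_rot2.
move=> p; rewrite !sqnorm_cvec; apply: eq_bigr => k _.
rewrite coord_turn; case: ifP => // /eqP ->.
by rewrite normcM exprMn [X in X * _]normc_sqr/= cs mul1r.
Qed.

Definition shear (a : R) i j p : n.-tuple X :=
  tset p i ((tnth p i).1 + a * (tnth p j).1, (tnth p i).2 + a * (tnth p j).2).

Lemma coord_shear a i j p k :
  coord k (shear a i j p) =
  if k == i then coord i p + a%:C * coord j p else coord k p.
Proof.
rewrite /shear /coord tnth_tset; case: ifP => // _.
by apply: complex_eqP => /=; ring.
Qed.

Lemma mpres_shear a i j : i != j -> mpres L (shear a i j).
Proof.
move=> ij.
apply: (@mpres_coord _ _ _ leb2 n i ((0 : mR), (0 : mR))
  (fun q => (q.2.1 + a * (tnth q.1 j).1, q.2.2 + a * (tnth q.1 j).2))) => //.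
- have mj : measurable_fun [set: n.-tuple X * X] (fun q => tnth q.1 j).
    exact: (measurableT_comp (measurable_tnth j) measurable_fst).
  apply: measurable_fun_pair; apply: measurable_funD.
  + exact: (measurableT_comp measurable_fst measurable_snd).
  + by apply: measurable_funM => //; exact: (measurableT_comp measurable_fst mj).
  + exact: (measurableT_comp measurable_snd measurable_snd).
  + by apply: measurable_funM => //; exact: (measurableT_comp measurable_snd mj).
- move=> t.
  exact: (mpres_translation2 (a * (tnth t j).1, a * (tnth t j).2)).
- by move=> t x y /=; rewrite !tnth_tset eq_sym (negbTE ij).
Qed.

(** The rotation of the coordinates i and j by a real angle, in the form of
    three shears that visibly preserve the measure. *)
Definition mix (c s : R) i j : n.-tuple X -> n.-tuple X :=
  shear (- ((1 - c) / s)) i j \o (shear s j i \o shear (- ((1 - c) / s)) i j).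

Lemma coord_mix c s i j p k : i != j -> c ^+ 2 + s ^+ 2 = 1 -> s != 0 ->
  coord k (mix c s i j p) =
  if k == i then c%:C * coord i p - s%:C * coord j p
  else if k == j then s%:C * coord i p + c%:C * coord j p
  else coord k p.
Proof.
move=> ij cs s0; set t := (1 - c) / s.
have ts : t * s = 1 - c by rewrite /t divfK.
have tc : t * (1 + c) = s.
  apply: (mulIf s0); rewrite mulrAC ts -expr2.
  by rewrite -[s ^+ 2](addKr (c ^+ 2)) cs; ring.
have ji : (j == i) = false by rewrite eq_sym; exact: negbTE.
rewrite /mix /= -/t !coord_shear !eqxx ji (negbTE ij).
have tsC : t%:C * s%:C = 1 - c%:C by rewrite -rmorphM ts rmorphB rmorph1.
have tcC : t%:C * (1 + c%:C) = s%:C.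
  by rewrite -[1]/(1%:C) -rmorphD -rmorphM tc.
case: ifP => [_|ki].
  rewrite rmorphN.
  transitivity ((1 - t%:C * s%:C) * coord i p -
    t%:C * (2 - t%:C * s%:C) * coord j p); first by ring.
  by rewrite tsC -[in RHS]tcC; ring.
case: ifP => kj; last by rewrite ki.
transitivity (s%:C * coord i p + (1 - t%:C * s%:C) * coord j p); first by ring.
by rewrite tsC; ring.
Qed.

Lemma isometric_mix c s i j : i != j -> c ^+ 2 + s ^+ 2 = 1 -> s != 0 ->
  isometric (mix c s i j).
Proof.
move=> ij cs s0; have ji : j != i by rewrite eq_sym.
split; first by do ![apply: mpres_comp|exact: mpres_shear].
have split_ij (F : 'I_n -> R) :
    \sum_k F k = F i + F j + \sum_(k | (k != i) && (k != j)) F k.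
  by rewrite (bigD1 i)//= (bigD1 j)//= addrA.
move=> p; rewrite !sqnorm_cvec !split_ij; congr (_ + _); last first.
  apply: eq_bigr => k /andP[ki kj].
  by rewrite coord_mix// (negbTE ki) (negbTE kj).
rewrite !coord_mix// !eqxx (negbTE ji) !normc_sqr.
rewrite !(ReD, ImD, ReN, ImN, ReM, ImM)/=.
move: (tnth p i) (tnth p j) => [a b] [a' b'] /=.
transitivity ((c ^+ 2 + s ^+ 2) * (a ^+ 2 + b ^+ 2 + a' ^+ 2 + b' ^+ 2)).
  by ring.
by rewrite cs; ring.
Qed.

End coordinates.

(** * Gaussian moments in the plane *)

Section plane_moments.
Variable R : realType.
Local Notation mR := (measurableTypeR R).
Local Notation leb := (@lebesgue_measure R).
Local Notation leb2 := (prod_measure leb leb).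

Lemma integral_gauss (b : R) : 0 < b ->
  (\int[leb]_x (expR (- (b * x ^+ 2)))%:E = (Num.sqrt (pi / b))%:E)%E.
Proof.
move=> b0; pose s := Num.sqrt (2 * b)^-1.
have s0 : s != 0 by rewrite gt_eqF// sqrtr_gt0 invr_gt0 mulr_gt0.
have s2 : s ^+ 2 = (2 * b)^-1.
  by rewrite sqr_sqrtr// invr_ge0 mulr_ge0// ltW.
have := integral_normal_pdf 0 s.
under eq_integral do rewrite /normal_pdf (negbTE s0) EFinM.
rewrite ge0_integralZl//; last 3 first.
- by apply/measurable_EFinP; exact: measurable_normal_fun.
- by move=> x _; rewrite lee_fin normal_fun_ge0.
- by rewrite lee_fin normal_peak_ge0.
have -> : normal_peak s = (Num.sqrt (pi / b))^-1.
  rewrite /normal_peak s2 -mulr_natr; congr (Num.sqrt _)^-1.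
  by field; rewrite gt_eqF.
under eq_integral => x _.
  rewrite /normal_fun subr0 s2 -mulr_natr (_ : _ / _ = - (b * x ^+ 2)); last first.
    by field; rewrite gt_eqF.
  over.
have q0 : Num.sqrt (pi / b) != 0 by rewrite gt_eqF// sqrtr_gt0 divr_gt0// pi_gt0.
move=> /(congr1 (fun x => (Num.sqrt (pi / b))%:E * x)%E).
by rewrite muleA -EFinM divff// mul1e mule1.
Qed.

Definition sq2 (x : mR * mR) : R := x.1 ^+ 2 + x.2 ^+ 2.

Lemma sq2_ge0 x : 0 <= sq2 x. Proof. by rewrite addr_ge0 ?sqr_ge0. Qed.

Lemma measurable_sq2 : measurable_fun setT sq2.
Proof.
apply: measurable_funD; apply: measurable_funX.
  exact: measurable_fst.
exact: measurable_snd.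
Qed.

Lemma measurable_moment (b : R) k :
  measurable_fun setT (fun x => sq2 x ^+ k * expR (- (b * sq2 x))).
Proof.
apply: measurable_funM; first by apply: measurable_funX; exact: measurable_sq2.
apply: measurableT_comp => //; apply: measurable_funN.
by apply: measurable_funM => //; exact: measurable_sq2.
Qed.

Lemma integral_gauss2 (b : R) : 0 < b ->
  (\int[leb2]_x (expR (- (b * sq2 x)))%:E = (pi / b)%:E)%E.
Proof.
move=> b0.
have mg : measurable_fun setT (fun x : mR => (expR (- (b * x ^+ 2)))%:E).
  apply/measurable_EFinP; apply: measurableT_comp => //.
  by apply: measurable_funN; apply: measurable_funM => //; exact: measurable_funX.
rewrite [LHS](@fubini_tonelli1 _ _ mR mR R leb leb
  (fun x => (expR (- (b * sq2 x)))%:E)); last 2 first.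
- have := measurable_moment b 0; under eq_fun do rewrite expr0 mul1r.
  by move=> ?; exact/measurable_EFinP.
- by move=> x; rewrite lee_fin expR_ge0.
rewrite /fubini_F.
have inner x : (\int[leb]_y (expR (- (b * sq2 (x, y))))%:E =
    (expR (- (b * x ^+ 2)))%:E * (Num.sqrt (pi / b))%:E)%E.
  under eq_integral => y _ do
    rewrite /sq2/= mulrDr opprD expRD EFinM.
  by rewrite ge0_integralZl ?integral_gauss//; rewrite lee_fin expR_ge0.
under eq_integral do rewrite inner.
rewrite ge0_integralZr//.
rewrite integral_gauss// -EFinM -expr2 sqr_sqrtr//.
by rewrite divr_ge0 ?pi_ge0// ltW.
Qed.

Lemma expR_sub_bounds (b b' s : R) : 0 <= s -> b < b' ->
  (b' - b) * s * expR (- (b' * s)) <=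
    expR (- (b * s)) - expR (- (b' * s)) <= (b' - b) * s * expR (- (b * s)).
Proof.
move=> s0 bb'; apply/andP; split.
  have -> : expR (- (b * s)) = expR ((b' - b) * s) * expR (- (b' * s)).
    by rewrite -expRD; congr expR; ring.
  rewrite [leRHS](_ : _ = (expR ((b' - b) * s) - 1) * expR (- (b' * s))); last first.
    by rewrite [RHS]mulrBl mul1r.
  rewrite ler_pM2r ?expR_gt0//.
  by rewrite lerBrDl expR_ge1Dx.
have -> : expR (- (b' * s)) = expR (- ((b' - b) * s)) * expR (- (b * s)).
  by rewrite -expRD; congr expR; ring.
rewrite [leLHS](_ : _ = (1 - expR (- ((b' - b) * s))) * expR (- (b * s))); last first.
  by rewrite [RHS]mulrBl mul1r.
rewrite ler_pM2r ?expR_gt0//.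
by rewrite lerBlDr -lerBlDl expR_ge1Dx.
Qed.

Lemma expr_sub_bounds (x y : R) m : 0 <= x -> x <= y ->
  (y - x) * (x ^+ m *+ m.+1) <= y ^+ m.+1 - x ^+ m.+1
    <= (y - x) * (y ^+ m *+ m.+1).
Proof.
move=> x0 xy; have y0 := le_trans x0 xy.
have yx0 : 0 <= y - x by rewrite subr_ge0.
rewrite subrXX !ler_wpM2l//=.
  rewrite -[X in _ *+ X]card_ord -sumr_const; apply: ler_sum => i _.
  have im : (i <= m)%N by rewrite -ltnS.
  by rewrite -[in leRHS](subnK im) exprD ler_wpM2l ?exprn_ge0// lerXn2r.
rewrite -[X in _ *+ X]card_ord -sumr_const; apply: ler_sum => i _.
have im : (i <= m)%N by rewrite -ltnS.
by rewrite -[in leLHS](subnK im) exprD ler_wpM2r ?exprn_ge0// lerXn2r.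
Qed.

(** The moment of order k + 1 is minus the derivative in b of the moment of
    order k; the difference quotients squeeze it, which avoids differentiating
    under the integral sign and proves its finiteness at the same time. *)
Lemma integral_moment k (b : R) : 0 < b ->
  (\int[leb2]_x (sq2 x ^+ k * expR (- (b * sq2 x)))%:E =
   (pi * k`!%:R / b ^+ k.+1)%:E)%E.
Proof.
elim: k b => [|k IH] b b0.
  by under eq_integral do rewrite expr0 mul1r; rewrite integral_gauss2// fact0 mulr1.
have mm c m : measurable_fun setT (fun x => (sq2 x ^+ m * expR (- (c * sq2 x)))%:E).
  by apply/measurable_EFinP; exact: measurable_moment.
have m0 c m x : (0 <= (sq2 x ^+ m * expR (- (c * sq2 x)))%:E)%E.
  by rewrite lee_fin mulr_ge0 ?expR_ge0// exprn_ge0// sq2_ge0.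
pose I c := (\int[leb2]_x (sq2 x ^+ k.+1 * expR (- (c * sq2 x)))%:E)%E.
have I0 c : (0 <= I c)%E by exact: integral_ge0.
pose C := pi * k`!%:R : R.
have C0 : 0 < C by rewrite mulr_gt0 ?pi_gt0// ltr0n fact_gt0.
have scale c (r : R) : 0 <= r -> (r%:E * I c =
    \int[leb2]_x (r * (sq2 x ^+ k.+1 * expR (- (c * sq2 x))))%:E)%E.
  by move=> r0; under eq_integral do rewrite EFinM; rewrite ge0_integralZl.
have mr c (r : R) : measurable_fun setT
    (fun x => (r * (sq2 x ^+ k.+1 * expR (- (c * sq2 x))))%:E).
  apply/measurable_EFinP; apply: measurable_funM => //.
  exact: measurable_moment.
(* up and lo are the two halves of expR_sub_bounds, integrated. *)
have up c c' : 0 < c -> c < c' ->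
    ((c' - c)%:E * I c' + (C / c' ^+ k.+1)%:E <= (C / c ^+ k.+1)%:E)%E.
  move=> c0 cc'; have c'0 := lt_trans c0 cc'.
  have d0 : 0 <= c' - c by rewrite subr_ge0 ltW.
  rewrite /C -!IH// scale// -ge0_integralD//; last first.
    by move=> x _; rewrite EFinM; apply: mule_ge0; [rewrite lee_fin|exact: m0].
  apply: ge0_le_integral => //.
  - move=> x _; rewrite adde_ge0//.
    by rewrite EFinM; apply: mule_ge0; [rewrite lee_fin|exact: m0].
  - exact: emeasurable_funD.
  move=> x _; rewrite lee_fin.
  have /andP[+ _] := expR_sub_bounds (sq2_ge0 x) cc'.
  move=> H.
  rewrite -lerBrDr -mulrBr; apply: le_trans (ler_wpM2l (exprn_ge0 k (sq2_ge0 x)) H).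
  by rewrite exprS le_eqVlt; apply/orP; left; apply/eqP; ring.
have lo c c' : 0 < c -> c < c' ->
    ((C / c ^+ k.+1)%:E <= (c' - c)%:E * I c + (C / c' ^+ k.+1)%:E)%E.
  move=> c0 cc'; have c'0 := lt_trans c0 cc'.
  have d0 : 0 <= c' - c by rewrite subr_ge0 ltW.
  rewrite /C -!IH// scale// -ge0_integralD//; last first.
    by move=> x _; rewrite EFinM; apply: mule_ge0; [rewrite lee_fin|exact: m0].
  apply: ge0_le_integral => //.
  - exact: emeasurable_funD.
  move=> x _; rewrite lee_fin.
  have /andP[_ H] := expR_sub_bounds (sq2_ge0 x) cc'.
  rewrite -lerBlDr -mulrBr; apply: le_trans (ler_wpM2l (exprn_ge0 k (sq2_ge0 x)) H) _.
  by rewrite exprS le_eqVlt; apply/orP; left; apply/eqP; ring.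
have b20 : 0 < b / 2 by rewrite divr_gt0.
(* up at b / 2 and b bounds the moment of order k + 1 at b. *)
have Ifin : I b \is a fin_num.
  rewrite ge0_fin_numE//; have b2b : b / 2 < b by lra.
  have d0 : 0 < b - b / 2 by lra.
  have := up _ _ b20 b2b; case: (I b) (I0 b) => [r| |]//.
    by rewrite ltry.
  by rewrite gt0_muley ?lte_fin// addye.
rewrite -/(I b) -(fineK Ifin); congr EFin; set y := fine _.
have Iy : I b = y%:E by rewrite /y fineK.
have Ck0 : 0 < C * k.+1%:R by rewrite mulr_gt0// ltr0n.
(* The claim, normalised to 1: up and lo, divided by the distance from c to b,
   give the two inequalities as c tends to b from the left and the right. *)
have y1 : b ^+ k.+1 * (y * b / (C * k.+1%:R)) = 1.
  have cvy : (fun c => c ^+ k.+1 * (y * b / (C * k.+1%:R))) @ b -->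
      b ^+ k.+1 * (y * b / (C * k.+1%:R)).
    by apply: cvgM; [exact: exprn_continuous|exact: cvg_cst].
  apply/eqP; rewrite eq_le; apply/andP; split.
    apply: (cvgr_to_le (cvg_at_left_filter cvy)).
    near=> c; have cb : c < b by near: c; exact: nbhs_left_lt.
    have c0 : 0 < c by near: c; exact: nbhs_left_gt.
    have := up _ _ c0 cb; rewrite Iy -EFinM -EFinD lee_fin -lerBrDr.
    have bn0 := exprn_gt0 k b0; have cm0 := exprn_gt0 k.+1 c0.
    have -> : C / c ^+ k.+1 - C / b ^+ k.+1 =
        C * (b ^+ k.+1 - c ^+ k.+1) / (b * b ^+ k * c ^+ k.+1).
      by rewrite [b ^+ k.+1]exprS; field; rewrite !gt_eqF.
    rewrite ler_pdivlMr ?mulr_gt0// => H.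
    have /andP[_ Hb] := expr_sub_bounds k (ltW c0) (ltW cb).
    have {}H := le_trans H (ler_wpM2l (ltW C0) Hb).
    rewrite mulrA ler_pdivrMr// mul1r.
    rewrite -(@ler_pM2l _ ((b - c) * b ^+ k)) ?mulr_gt0 ?subr_gt0//.
    apply: le_trans (le_trans H _); rewrite le_eqVlt; apply/orP; left; apply/eqP.
      by ring.
    by rewrite -[_ *+ k.+1]mulr_natr; ring.
  apply: (cvgr_to_ge (cvg_at_right_filter cvy)).
  near=> c; have bc : b < c by near: c; exact: nbhs_right_gt.
  have c0 : 0 < c by exact: lt_trans bc.
  have := lo _ _ b0 bc; rewrite Iy -EFinM -EFinD lee_fin.
  have bn0 := exprn_gt0 k b0; have cm0 := exprn_gt0 k.+1 c0.
  rewrite -lerBlDr.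
  have -> : C / b ^+ k.+1 - C / c ^+ k.+1 =
      C * (c ^+ k.+1 - b ^+ k.+1) / (b * b ^+ k * c ^+ k.+1).
    by rewrite [b ^+ k.+1]exprS; field; rewrite !gt_eqF.
  rewrite ler_pdivrMr ?mulr_gt0// => H.
  have /andP[Hb _] := expr_sub_bounds k (ltW b0) (ltW bc).
  have {}H := le_trans (ler_wpM2l (ltW C0) Hb) H.
  rewrite mulrA ler_pdivlMr// mul1r.
  rewrite -(@ler_pM2l _ ((c - b) * b ^+ k)) ?mulr_gt0 ?subr_gt0//.
  apply: le_trans (le_trans _ H) _; rewrite le_eqVlt; apply/orP; left; apply/eqP.
    by rewrite -[_ *+ k.+1]mulr_natr; ring.
  by ring.
have k0 : k.+1%:R != 0 :> R by rewrite pnatr_eq0.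
have -> : y = (b ^+ k.+1 * (y * b / (C * k.+1%:R))) *
    (C * k.+1%:R / (b * b ^+ k.+1)).
  have := Ck0; move: (C * _) => D D0.
  by field; rewrite !gt_eqF// exprn_gt0.
by rewrite y1 mul1r factS natrM [b ^+ k.+2]exprS /C; congr (_ / _); ring.
Unshelve. all: by end_near.
Qed.

End plane_moments.

(** * Square integrability for the Gaussian measure *)

Section gaussian_space.
Variables (R : realType) (n : nat).
Local Notation mR := (measurableTypeR R).
Local Notation X := (mR * mR)%type.
Local Notation leb := (@lebesgue_measure R).
Local Notation leb2 := (prod_measure leb leb).
Local Notation L := (@lebesgueC R n).
Local Notation normc := (@Normc.normc R).
Implicit Types (p : n.-tuple X) (j : 'I_n) (F G : n.-tuple X -> R[i]).

Lemma normc_coord j p : normc (coord j p) ^+ 2 = sq2 (tnth p j).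
Proof. by rewrite normc_sqr. Qed.

Lemma expR_sqnorm (b : R) p :
  expR (- (b * sqnorm (cvec p))) = \prod_(j < n) expR (- (b * sq2 (tnth p j))).
Proof.
rewrite sqnorm_cvec mulr_sumr -sumrN.
rewrite (big_morph expR (@expRD R) (@expR0 R)).
by apply: eq_bigr => j _; rewrite normc_coord.
Qed.

Lemma measurable_expR_sqnorm (b : R) :
  measurable_fun setT (fun p => expR (- (b * sqnorm (cvec p)))).
Proof.
apply: measurableT_comp => //; apply: measurable_funN.
by apply: measurable_funM => //; exact: measurable_sqnorm_cvec.
Qed.

Lemma integral_expR_sqnorm (b : R) : 0 < b ->
  (\int[L]_p (expR (- (b * sqnorm (cvec p))))%:E = ((pi / b) ^+ n)%:E)%E.
Proof.
move=> b0; under eq_integral do rewrite expR_sqnorm.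
rewrite (ge0_integral_power_prod leb2 (f := fun _ x => expR (- (b * sq2 x)))).
- under eq_bigr do rewrite integral_gauss2//.
  by rewrite prodEFin prodr_const card_ord.
- move=> _; have := measurable_moment b 0.
  by under eq_fun do rewrite expr0 mul1r.
- by move=> _ x; exact: expR_ge0.
Qed.

Lemma integrable_expR_sqnorm (b : R) : 0 < b ->
  L.-integrable setT (fun p => (expR (- (b * sqnorm (cvec p))))%:E).
Proof.
move=> b0; apply/integrableP; split.
  by apply/measurable_EFinP; exact: measurable_expR_sqnorm.
under eq_integral do rewrite gee0_abs ?lee_fin ?expR_ge0//.
by rewrite integral_expR_sqnorm// ltry.
Qed.

Definition gd p : R := gauss_density (cvec p).

Lemma gdE p : gd p = ((2 * pi) ^+ n)^-1 * expR (- (2^-1 * sqnorm (cvec p))).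
Proof. by rewrite /gd /gauss_density [_ / 2]mulrC. Qed.

Lemma gd_ge0 p : 0 <= gd p.
Proof.
by rewrite gdE mulr_ge0 ?expR_ge0// invr_ge0 exprn_ge0// mulr_ge0// pi_ge0.
Qed.

Lemma measurable_gd : measurable_fun setT gd.
Proof.
rewrite (funext gdE); apply: measurable_funM => //.
exact: measurable_expR_sqnorm.
Qed.

Lemma cmeas_gd : cmeas (fun p => (gd p)%:C).
Proof. exact: cmeas_real measurable_gd. Qed.

Definition mono (alpha : {ffun 'I_n -> nat}) p : R[i] :=
  \prod_(j < n) coord j p ^+ alpha j.

Lemma cmeas_mono alpha : cmeas (mono alpha).
Proof. by apply: cmeas_prod => j; exact/cmeasX/cmeas_coord. Qed.

Lemma integral_mono alpha :
  (\int[L]_p (normc (mono alpha p) ^+ 2 * gd p)%:E =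
   (\prod_(j < n) (2 ^+ alpha j * (alpha j)`!%:R))%:E)%E.
Proof.
pose f j x : R := (2 * pi)^-1 * (sq2 x ^+ alpha j * expR (- (2^-1 * sq2 x))).
have E p : normc (mono alpha p) ^+ 2 * gd p = \prod_(j < n) f j (tnth p j).
  rewrite gdE expR_sqnorm -exprVn.
  have -> : ((2 * pi)^-1 ^+ n : R) = \prod_(j < n) (2 * pi)^-1.
    by rewrite prodr_const card_ord.
  rewrite /mono normc_prod -prodrXl -!big_split/=.
  by apply: eq_bigr => j _; rewrite normcX -exprM mulnC exprM normc_coord mulrCA.
under eq_integral do rewrite E.
rewrite (ge0_integral_power_prod leb2 (f := f)).
- rewrite -prodEFin; apply: eq_bigr => j _.
  have h0 : (0 : R) < 2^-1 by rewrite invr_gt0.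
  under eq_integral do rewrite EFinM.
  rewrite ge0_integralZl//; last 3 first.
  + by apply/measurable_EFinP; exact: measurable_moment.
  + by move=> x _; rewrite lee_fin mulr_ge0 ?expR_ge0// exprn_ge0// sq2_ge0.
  + by rewrite lee_fin invr_ge0 mulr_ge0// pi_ge0.
  rewrite integral_moment// -EFinM; congr EFin.
  rewrite exprVn invrK exprS; have : (pi : R) != 0 by rewrite gt_eqF// pi_gt0.
  by move: pi => q q0; field.
- by move=> j; apply: measurable_funM => //; exact: measurable_moment.
- move=> j x; rewrite /f !mulr_ge0 ?expR_ge0 ?exprn_ge0 ?sq2_ge0//.
  by rewrite invr_ge0 mulr_ge0// pi_ge0.
Qed.

Definition sqint F := L.-integrable setT (fun p => (normc (F p) ^+ 2 * gd p)%:E).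

Lemma measurable_sq F : cmeas F ->
  measurable_fun setT (fun p => normc (F p) ^+ 2 * gd p).
Proof.
move=> mF; apply: measurable_funM; last exact: measurable_gd.
by apply: measurable_funX; exact: measurable_normc.
Qed.

Lemma sq_gd_ge0 F p : 0 <= normc (F p) ^+ 2 * gd p.
Proof. by rewrite mulr_ge0 ?sqr_ge0 ?gd_ge0. Qed.

Lemma sqintP F : cmeas F ->
  (\int[L]_p (normc (F p) ^+ 2 * gd p)%:E < +oo)%E -> sqint F.
Proof.
move=> mF oo; apply/integrableP; split.
  by apply/measurable_EFinP; exact: measurable_sq.
under eq_integral => p _.
  rewrite gee0_abs; last by rewrite lee_fin sq_gd_ge0.
  over.
exact: oo.
Qed.

Lemma sqint_mono alpha : sqint (mono alpha).
Proof.
by apply: sqintP; [exact: cmeas_mono|rewrite integral_mono ltry].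
Qed.

Lemma sqintJ F : sqint F -> sqint (fun p => (F p)^*).
Proof. by move=> sF; rewrite /sqint; under eq_fun do rewrite normcJ. Qed.

Lemma sqintZ c F : sqint F -> sqint (fun p => c * F p).
Proof.
move=> sF; rewrite /sqint.
under eq_fun do rewrite normcM exprMn -mulrA EFinM.
exact: integrableZl.
Qed.

Lemma cintegrable_sqint F G : cmeas F -> cmeas G -> sqint F -> sqint G ->
  cintegrable L (fun p => F p * G p * (gd p)%:C).
Proof.
move=> mF mG sF sG.
apply: (@cintegrable_dom _ _ _ _ _
  (fun p => normc (F p) ^+ 2 * gd p + normc (G p) ^+ 2 * gd p)).
- apply: cmeasM; [exact: cmeasM|exact: cmeas_gd].
- move=> p; rewrite !normcM normc_real ger0_norm ?gd_ge0// -mulrDl.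
  apply: ler_wpM2r; first exact: gd_ge0.
  have := sqr_ge0 (normc (F p) - normc (G p)).
  have := sqr_ge0 (normc (F p)); have := sqr_ge0 (normc (G p)).
  by rewrite sqrrB; nra.
- by under eq_fun do rewrite EFinD; exact: integrableD.
Qed.

Lemma sqintD F G : cmeas F -> cmeas G -> sqint F -> sqint G ->
  sqint (fun p => F p + G p).
Proof.
move=> mF mG sF sG.
apply: (@le_integrable _ _ _ _ _ measurableT _ (fun p =>
    (2%:E * (normc (F p) ^+ 2 * gd p)%:E + 2%:E * (normc (G p) ^+ 2 * gd p)%:E)%E)).
- by apply/measurable_EFinP; apply: measurable_sq; exact: cmeasD.
- move=> p _.
  have g0 := gd_ge0 p.
  have F0 := sq_gd_ge0 F p; have G0 := sq_gd_ge0 G p.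
  rewrite -!EFinM -EFinD lee_fin ger0_norm; last exact: (sq_gd_ge0 (fun p => F p + G p)).
  rewrite ger0_norm; last by lra.
  rewrite [leRHS](_ : _ = (2 * normc (F p) ^+ 2 + 2 * normc (G p) ^+ 2) * gd p); last first.
    by ring.
  apply: ler_wpM2r => //.
  have := normcD (F p) (G p); have := normc_ge0 (F p + G p).
  have := sqr_ge0 (normc (F p) - normc (G p)).
  by rewrite sqrrB; nra.
- by apply: integrableD => //; apply: integrableZl.
Qed.

(** Bounds the modulus of the reproducing kernel and of all its truncations.
    *)
Definition kernel_bound (z : 'I_n -> R[i]) p : R :=
  \prod_(j < n) expR (normc (z j) * normc (coord j p) / 2).

Lemma measurable_kernel_bound z : measurable_fun setT (kernel_bound z).
Proof.
apply: measurable_prod => j _; apply: measurableT_comp => //.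
apply: measurable_funM => //; apply: measurable_funM => //.
apply: measurable_normc; exact: cmeas_coord.
Qed.

(** Completing the square in each coordinate: a t - t ^ 2 / 2 <= a ^ 2 - t ^ 2
    / 4. *)
Lemma sqint_kernel_bound z : sqint (fun p => (kernel_bound z p)%:C).
Proof.
pose C := ((2 * pi) ^+ n)^-1 * \prod_(j < n) expR (normc (z j) ^+ 2) : R.
have C0 : 0 <= C.
  rewrite mulr_ge0//; first by rewrite invr_ge0 exprn_ge0// mulr_ge0// pi_ge0.
  by apply: prodr_ge0 => j _; exact: expR_ge0.
apply: (@le_integrable _ _ _ _ _ measurableT _ (fun p =>
    (C%:E * (expR (- (4^-1 * sqnorm (cvec p))))%:E)%E)).
- apply/measurable_EFinP; apply: measurable_sq.
  by apply: cmeas_real; exact: measurable_kernel_bound.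
- move=> p _; rewrite -EFinM gee0_abs; last first.
    exact: (sq_gd_ge0 (fun p => (kernel_bound z p)%:C)).
  rewrite gee0_abs; last by rewrite lee_fin; apply: mulr_ge0 => //; exact: expR_ge0.
  rewrite lee_fin normc_real real_normK ?num_real// gdE [leLHS]mulrCA /C -[leRHS]mulrA.
  apply: ler_wpM2l; first by rewrite invr_ge0 exprn_ge0// mulr_ge0// pi_ge0.
  rewrite !expR_sqnorm -prodrXl -!big_split; apply: ler_prod => j _.
  rewrite mulr_ge0 ?expR_ge0 ?exprn_ge0// andTb.
  rewrite -[leLHS]/(expR (normc (z j) * normc (coord j p) / 2) ^+ 2 *
    expR (- (2^-1 * sq2 (tnth p j)))).
  rewrite -[leRHS]/(expR (normc (z j) ^+ 2) * expR (- (4^-1 * sq2 (tnth p j)))).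
  rewrite -normc_coord -expRM_natl -!expRD ler_expR.
  set a := normc _; set t := normc _.
  rewrite -subr_ge0 [leRHS](_ : _ = (a - t / 2) ^+ 2) ?sqr_ge0//.
  by field.
- apply: integrableZl => //; apply: integrable_expR_sqnorm.
  by rewrite invr_gt0.
Qed.

End gaussian_space.

(** * Pairings of monomials against a radial weight *)

(** The difference of the two polynomials has degree at most m and the roots
    1, ..., m + 1. *)
Lemma eq_sum_powers (K : numFieldType) m (a b : nat -> K) :
  (forall k, \sum_(p < m.+1) a p * k.+1%:R ^+ p = \sum_(p < m.+1) b p * k.+1%:R ^+ p) ->
  forall p, (p <= m)%N -> a p = b p.
Proof.
move=> ab p pm; apply/eqP; rewrite -subr_eq0; apply/eqP.
pose q := \poly_(i < m.+1) (a i - b i).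
have q0 : q = 0.
  apply: (@roots_geq_poly_eq0 _ q [seq k.+1%:R | k <- iota 0 m.+1]).
  - apply/allP => _ /mapP[k _ ->]; rewrite /root horner_poly.
    under eq_bigr do rewrite mulrBl.
    by rewrite sumrB ab subrr.
  - rewrite map_inj_uniq ?iota_uniq// => x y /eqP.
    by rewrite eqr_nat => /eqP[].
  - by rewrite size_map size_iota size_poly.
by have := coef_poly m.+1 (fun i => a i - b i) p; rewrite -/q q0 coef0 ltnS pm.
Qed.

Section unit_numbers.
Variable R : realType.

Lemma cexpX (z : R[i]) k : cexp z ^+ k = cexp (z *+ k).
Proof.
elim: k => [|k IH]; last by rewrite exprS IH mulrS cexpD.
rewrite expr0 mulr0n /cexp/= expR0 cos0 sin0.
by apply: complex_eqP => /=; ring.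
Qed.

(** The angle pi / (2 |a - b|) makes the product equal to i or - i. *)
Lemma unit_power_neq1 (a b : nat) : a != b ->
  exists c s : R, [/\ c ^+ 2 + s ^+ 2 = 1, s != 0 &
    (c +i* s) ^+ a * ((c +i* s)^*) ^+ b != 1].
Proof.
wlog ab : a b / (b < a)%N.
  move=> H; rewrite neq_ltn => /orP[ab|ba]; last by apply: H => //; rewrite gt_eqF.
  have [|c [s [cs s0 u1]]] := H _ _ ab; first by rewrite gt_eqF.
  exists c, s; split => //; move: (c +i* s) u1 => u.
  apply: contra => /eqP/(congr1 Num.conj).
  by rewrite rmorph1 rmorphM !rmorphXn /= conjCK mulrC => ->.
move=> _; pose m := (a - b)%N; have m0 : (0 < m)%N by rewrite subn_gt0.
pose t : R := pi / (2 * m%:R).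
have t0 : 0 < t by rewrite divr_gt0 ?pi_gt0// mulr_gt0// ltr0n.
have tpi : t < pi.
  rewrite /t ltr_pdivrMr ?mulr_gt0 ?ltr0n// ltr_pMr ?pi_gt0//.
  by rewrite -natrM ltr1n leq_pmulr.
exists (cos t), (sin t); split.
- exact: cos2Dsin2.
- by rewrite gt_eqF// sin_gt0_pi// t0.
set u := _ +i* _.
have uu : u * u^* = 1.
  by rewrite mulJ_normc normc_sqr/= cos2Dsin2.
have -> : u ^+ a * u^* ^+ b = u ^+ m.
  by rewrite -{1}(subnK (ltnW ab)) exprD -mulrA -exprMn uu expr1n mulr1.
have -> : u = cexp (0 +i* t).
  by rewrite /cexp/= expR0; apply: complex_eqP => /=; ring.
rewrite cexpX; have -> : (0 +i* t) *+ m = 0 +i* (pi / 2).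
  have muln_im k : (0 +i* t) *+ k = 0 +i* (t *+ k).
    elim: k => [|k IH]; first by rewrite !mulr0n.
    by rewrite !mulrS IH; apply: complex_eqP => /=; ring.
  rewrite muln_im -mulr_natr /t; congr (_ +i* _); field.
  by rewrite pnatr_eq0 -lt0n.
apply/eqP => /(congr1 (@complex.Re R)); rewrite /cexp /= cos_pihalf sin_pihalf.
by rewrite mulr0 mul0r subr0 => /eqP; rewrite eq_sym oner_eq0.
Qed.

End unit_numbers.

Section radial_symbol.
Variables (R : realType) (n : nat).
Local Notation mR := (measurableTypeR R).
Local Notation X := (mR * mR)%type.
Local Notation L := (@lebesgueC R n).
Local Notation normc := (@Normc.normc R).
Implicit Types (p : n.-tuple X) (i j : 'I_n) (F G : n.-tuple X -> R[i]).
Implicit Types (alpha beta : {ffun 'I_n -> nat}).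

(** A Borel function that agrees almost everywhere with a radial one is
    invariant up to a null set, which depends on the isometry. *)
Definition radial_symbol (h : n.-tuple X -> R[i]) : Prop :=
  [/\ cmeas h, forall f, isometric f -> {ae L, forall p, h (f p) = h p}
  & forall alpha, sqint (fun p => h p * mono alpha p)].

Variable h : n.-tuple X -> R[i].
Hypothesis hP : radial_symbol h.

Let mh : cmeas h. Proof. by case: hP. Qed.

Definition weighted F : R[i] := cI L (fun p => h p * F p * (gd p)%:C).

Lemma weighted_isometric f F : cmeas F -> isometric f ->
  weighted (fun p => F (f p)) = weighted F.
Proof.
move=> mF [pf nf]; have [mf _] := pf.
have mhF : cmeas (fun p => h p * F p * (gd p)%:C).
  by apply: cmeasM; [exact: cmeasM|exact: cmeas_gd].
rewrite [RHS]/weighted -(cI_mpres pf mhF); apply: cI_ae.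
  case: mhF => rhF ihF; split.
    exact: (measurableT_comp rhF mf).
  exact: (measurableT_comp ihF mf).
have [_ hinv _] := hP; apply: filterS (hinv f (conj pf nf)) => p ->.
by rewrite /gd /gauss_density nf.
Qed.

Definition pairing alpha beta := weighted (fun p => mono alpha p * (mono beta p)^*).

Lemma cintegrable_pairing alpha beta :
  cintegrable L (fun p => h p * (mono alpha p * (mono beta p)^*) * (gd p)%:C).
Proof.
under eq_fun do rewrite mulrA.
apply: cintegrable_sqint.
- by apply: cmeasM => //; exact: cmeas_mono.
- by apply: cmeasJ; exact: cmeas_mono.
- by have [_ _] := hP; exact.
- by apply: sqintJ; exact: sqint_mono.
Qed.

Lemma mono_turn alpha c s j p :
  mono alpha (turn c s j p) = (c +i* s) ^+ alpha j * mono alpha p.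
Proof.
rewrite /mono (bigD1 j)//= [in RHS](bigD1 j)//= coord_turn eqxx exprMn mulrA.
congr (_ * _); apply: eq_bigr => k kj.
by rewrite coord_turn (negbTE kj).
Qed.

(** Multiplying the coordinate j by u of modulus 1 multiplies the pairing by u
    ^ (alpha j) times the conjugate of u ^ (beta j), which differs from 1 for
    a suitable u. *)
Lemma pairing_neq alpha beta : alpha != beta -> pairing alpha beta = 0.
Proof.
move=> ab; have [j abj] : exists j, alpha j != beta j.
  apply/existsP; apply: contraR ab => /existsPn ab.
  by apply/eqP/ffunP => j; have := ab j; rewrite negbK => /eqP.
have [c [s [cs s0 u1]]] := unit_power_neq1 R abj.
set k := _ * _ in u1.
have E : pairing alpha beta = k * pairing alpha beta.
  have mab : cmeas (fun p => mono alpha p * (mono beta p)^*).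
    by apply: cmeasM; [exact: cmeas_mono|apply: cmeasJ; exact: cmeas_mono].
  rewrite -[LHS](weighted_isometric mab (isometric_turn j cs s0)).
  rewrite -[RHS]cI_Z; last exact: cintegrable_pairing.
  congr cI; apply/funext => p; rewrite !mono_turn rmorphM rmorphXn/=.
  by rewrite /k; ring.
apply/eqP; have := subrr (pairing alpha beta); rewrite {1}E => /eqP.
rewrite -[X in _ - X]mul1r -mulrBl mulf_eq0 => /orP[|//].
by rewrite subr_eq0 (negbTE u1).
Qed.

Definition upd alpha i j (a b : nat) : {ffun 'I_n -> nat} :=
  [ffun l => if l == i then a else if l == j then b else alpha l].

Lemma mono_upd alpha i j a b p : i != j ->
  mono (upd alpha i j a b) p =
  coord i p ^+ a * coord j p ^+ b * mono (upd alpha i j 0 0) p.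
Proof.
move=> ij; have ji : j != i by rewrite eq_sym.
rewrite /mono (bigD1 i)// (bigD1 j)//= [in RHS](bigD1 i)// (bigD1 j)//=.
rewrite !ffunE !eqxx (negbTE ji) !expr0 !mul1r mulrA; congr (_ * _).
by apply: eq_bigr => l /andP[li lj]; rewrite !ffunE (negbTE li) (negbTE lj).
Qed.

(** Rotating the coordinates i and j by an angle of tangent sqrt y turns the
    invariance of the weight into an identity between two polynomials in y,
    valid at all positive integers; k selects one coefficient. *)
Lemma pairing_upd alpha i j m k : i != j -> (k <= m)%N ->
  pairing (upd alpha i j m 0) (upd alpha i j m 0) =
  'C(m, k)%:R * pairing (upd alpha i j (m - k) k) (upd alpha i j (m - k) k).
Proof.
move=> ij km; set P0 := pairing _ _.
pose a (q : 'I_m.+1) := upd alpha i j (m - q) q.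
pose D (q : nat) := pairing (upd alpha i j (m - q) q) (upd alpha i j (m - q) q).
have aN (q r : 'I_m.+1) : q != r -> a q != a r.
  apply: contra => /eqP/ffunP/(_ j); rewrite !ffunE eqxx.
  by rewrite (eq_sym j i) (negbTE ij) => /eqP.
have key y : \sum_(q < m.+1) ('C(m, q)%:R * P0) * y.+1%:R ^+ q =
    \sum_(q < m.+1) ('C(m, q)%:R ^+ 2 * D q) * y.+1%:R ^+ q.
  have y0 : 0 < (y.+1%:R : R) by rewrite ltr0n.
  pose Y : R := y.+1%:R; have Y1 : 0 < 1 + Y by rewrite addr_gt0.
  pose c := (Num.sqrt (1 + Y))^-1; pose s := Num.sqrt Y * c.
  have c2 : c ^+ 2 = (1 + Y)^-1 by rewrite exprVn sqr_sqrtr// ltW.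
  have s2 : s ^+ 2 = Y * (1 + Y)^-1 by rewrite exprMn c2 sqr_sqrtr// ltW.
  have cs : c ^+ 2 + s ^+ 2 = 1 by rewrite c2 s2; field; rewrite gt_eqF.
  have s0 : s != 0 by rewrite mulf_neq0 ?invr_eq0 ?gt_eqF ?sqrtr_gt0.
  pose e q := (c ^+ (m - q) * (- s) ^+ q * 'C(m, q)%:R) : R.
  have E p : mono (upd alpha i j m 0) (mix c s i j p) =
      \sum_(q < m.+1) (e q)%:C * mono (a q) p.
    rewrite mono_upd// expr0 mulr1 coord_mix// eqxx.
    have -> : mono (upd alpha i j 0 0) (mix c s i j p) = mono (upd alpha i j 0 0) p.
      apply: eq_bigr => l _; rewrite ffunE coord_mix//.
      by case: ifP => //; case: ifP.
    rewrite exprDn mulr_suml; apply: eq_bigr => q _.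
    rewrite /a [in RHS]mono_upd// -mulr_natr natr_complex.
    rewrite exprMn -mulNr -rmorphN exprMn -!rmorphXn !rmorphM/=.
    by ring.
  have EJ p : (mono (upd alpha i j m 0) (mix c s i j p))^* =
      \sum_(q < m.+1) (e q)%:C * (mono (a q) p)^*.
    rewrite E; elim/big_rec2: _ => [|q z w _ <-]; 
      first by apply: complex_eqP => //=; rewrite oppr0.
    case: (mono _ _) w => [x1 x2] [y1 y2].
    by apply: complex_eqP => /=; ring.
  have mm : cmeas (fun p => mono (upd alpha i j m 0) p * (mono (upd alpha i j m 0) p)^*).
    by apply: cmeasM; [exact: cmeas_mono|apply: cmeasJ; exact: cmeas_mono].
  have P0E : P0 = \sum_(q < m.+1) \sum_(r < m.+1)
      ((e q)%:C * (e r)%:C) * pairing (a q) (a r).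
    rewrite -[LHS](weighted_isometric mm (isometric_mix ij cs s0)).
    have -> : weighted (fun p => mono (upd alpha i j m 0) (mix c s i j p) *
          (mono (upd alpha i j m 0) (mix c s i j p))^*) =
        cI L (fun p => \sum_(q < m.+1) \sum_(r < m.+1) ((e q)%:C * (e r)%:C) *
          (h p * (mono (a q) p * (mono (a r) p)^*) * (gd p)%:C)).
      congr cI; apply/funext => p; rewrite EJ E.
      rewrite mulr_suml mulr_sumr mulr_suml; apply: eq_bigr => q _.
      rewrite mulr_sumr mulr_sumr mulr_suml; apply: eq_bigr => r _.
      by ring.
    rewrite cI_sum => [|q]; last first.
      apply: cintegrable_sum => r; apply: cintegrableZ; exact: cintegrable_pairing.
    apply: eq_bigr => q _; rewrite cI_sum => [|r]; last first.
      by apply: cintegrableZ; exact: cintegrable_pairing.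
    by apply: eq_bigr => r _; rewrite cI_Z//; exact: cintegrable_pairing.
  have {}P0E : P0 = \sum_(q < m.+1) ((e q) ^+ 2)%:C * D q.
    rewrite P0E; apply: eq_bigr => q _; rewrite (bigD1 q)//= big1 ?addr0.
      by rewrite rmorphXn expr2.
    by move=> r rq; rewrite pairing_neq ?mulr0// aN// eq_sym.
  (* Multiplying by (1 + Y) ^+ m, the common denominator of the e q ^+ 2. *)
  have e2 (q : 'I_m.+1) : (1 + Y) ^+ m * e q ^+ 2 = 'C(m, q)%:R ^+ 2 * Y ^+ q.
    have qm : (q <= m)%N by rewrite -ltnS.
    rewrite /e !exprMn -!exprM ![(_ * 2)%N]mulnC !exprM sqrrN c2 s2.
    rewrite -{1}(subnK qm) exprD exprMn !exprVn.
    by field; rewrite !expf_neq0// gt_eqF.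
  transitivity (((1 + Y) ^+ m)%:C * P0).
    rewrite exprDn rmorph_sum/= mulr_suml; apply: eq_bigr => q _.
    rewrite expr1n mul1r -[X in _ = X%:C * _]mulr_natr rmorphM rmorphXn /Y !rmorph_nat.
    by ring.
  rewrite {1}P0E mulr_sumr; apply: eq_bigr => q _.
  rewrite mulrA -rmorphM e2 rmorphM !rmorphXn /Y !rmorph_nat.
  by ring.
have /(_ k km) := @eq_sum_powers _ m (fun q => 'C(m, q)%:R * P0)
  (fun q => 'C(m, q)%:R ^+ 2 * D q) key.
have C0 : 'C(m, k)%:R != 0 :> R[i] by rewrite pnatr_eq0 -lt0n bin_gt0.
by rewrite expr2 -mulrA => /(mulfI C0).
Qed.

Definition mdeg alpha : nat := \sum_(j < n) alpha j.
Definition mfact alpha : nat := \prod_(j < n) (alpha j)`!.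

Definition single i (k : nat) : {ffun 'I_n -> nat} :=
  [ffun l => if l == i then k else 0%N].

(** By pairing_diag all monomials of degree k give the same normalised value,
    so that the powers of one coordinate represent every degree. *)
Definition level i k : R[i] := pairing (single i k) (single i k) / k`!%:R.

(** The degrees of the other coordinates are moved into the coordinate i one
    after the other, by pairing_upd. *)
Lemma pairing_diag i alpha :
  pairing alpha alpha = level i (mdeg alpha) * (mfact alpha)%:R.
Proof.
have [N] := ubnP (\sum_(j < n | j != i) alpha j)%N.
elim: N alpha => // N IH alpha; rewrite ltnS => leN.
have [/eqP|] := posnP (\sum_(j < n | j != i) alpha j)%N.
  rewrite sum_nat_eq0 => /forall_inP a0.
  have aE : alpha = single i (alpha i).
    apply/ffunP => l; rewrite ffunE; case: eqP => [->//|/eqP/a0/eqP//].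
  have -> : mdeg alpha = alpha i.
    rewrite /mdeg (bigD1 i)//= big1 ?addn0// => l /a0/eqP//.
  have -> : mfact alpha = (alpha i)`!.
    rewrite /mfact (bigD1 i)//= big1 ?muln1// => l /a0/eqP ->//.
  by rewrite /level -aE divfK// pnatr_eq0 -lt0n fact_gt0.
rewrite lt0n sum_nat_eq0 negb_forall_in => /exists_inP[j ji aj0].
have ij : i != j by rewrite eq_sym.
pose m := (alpha i + alpha j)%N; pose beta := upd alpha i j m 0.
have aE : alpha = upd alpha i j (m - alpha j) (alpha j).
  apply/ffunP => l; rewrite ffunE /m addnK.
  by case: eqP => [->//|_]; case: eqP => [->//|].
have ajm : (alpha j <= m)%N by rewrite leq_addl.
have split_ij (T : Type) (idx : T) (op : Monoid.com_law idx) (F : 'I_n -> T) :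
    \big[op/idx]_k F k =
    op (F i) (op (F j) (\big[op/idx]_(k | (k != i) && (k != j)) F k)).
  by rewrite (bigD1 i)//= (bigD1 j).
have beta_out l : l != i -> l != j -> beta l = alpha l.
  by move=> li lj; rewrite ffunE (negbTE li) (negbTE lj).
have bi : beta i = m by rewrite ffunE eqxx.
have bj : beta j = 0%N by rewrite ffunE eqxx (negbTE ji).
have Hdeg : mdeg beta = mdeg alpha.
  rewrite /mdeg !split_ij bi bj /= add0n /m -addnA; congr (_ + (_ + _))%N.
  by apply: eq_bigr => l /andP[li lj]; rewrite beta_out.
have Hfact : (mfact beta * ((alpha i)`! * (alpha j)`!) = mfact alpha * m`!)%N.
  rewrite /mfact !split_ij bi bj /= fact0 mul1n.
  under eq_bigr => l /andP[li lj] do rewrite beta_out//.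
  by lia.
have := pairing_upd alpha ij ajm; rewrite -aE -/beta (IH beta); last first.
  apply: leq_trans leN; rewrite (bigD1 j)//= bj add0n [ltnRHS](bigD1 j)//=.
  under eq_bigr => l /andP[li lj] do rewrite beta_out//.
  by rewrite -[ltnLHS]add0n ltn_add2r lt0n.
rewrite Hdeg => E.
have f0 k : k`!%:R != 0 :> R[i] by rewrite pnatr_eq0 -lt0n fact_gt0.
have C0 : 'C(m, alpha j)%:R != 0 :> R[i] by rewrite pnatr_eq0 -lt0n bin_gt0.
apply: (mulfI C0); rewrite -E mulrCA; congr (_ * _).
have /(congr1 (fun k => k%:R : R[i])) := Hfact.
have /(congr1 (fun k => k%:R : R[i])) := bin_fact ajm.
rewrite /m addnK !natrM -/m => E1 E2.
apply: (mulIf (mulf_neq0 (f0 (alpha i)) (f0 (alpha j)))).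
by rewrite E2 -E1; ring.
Qed.

End radial_symbol.

(** * Coefficients in the monomial basis *)

Section fock_expansion.
Variables (R : realType) (n : nat).
Local Notation mR := (measurableTypeR R).
Local Notation X := (mR * mR)%type.
Local Notation L := (@lebesgueC R n).
Local Notation normc := (@Normc.normc R).
Implicit Types (p : n.-tuple X) (F G : n.-tuple X -> R[i]).
Implicit Types (alpha beta : {ffun 'I_n -> nat}) (z : 'rV[R[i]]_n).

Definition zeta_coef alpha : R :=
  (Num.sqrt (2 ^+ mdeg alpha))^-1 * (Num.sqrt (\prod_(j < n) (alpha j)`!%:R))^-1.

Lemma zeta_coef_ge0 alpha : 0 <= zeta_coef alpha.
Proof. by rewrite mulr_ge0 ?invr_ge0 ?sqrtr_ge0. Qed.

Lemma zeta_coef_sqr alpha :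
  zeta_coef alpha ^+ 2 = \prod_(j < n) (2 ^+ alpha j * (alpha j)`!%:R)^-1.
Proof.
rewrite exprMn !exprVn !sqr_sqrtr ?exprn_ge0 ?prodr_ge0// -invfM prodfV.
by rewrite big_split /= prodrXr.
Qed.

Lemma zetaE alpha p :
  zeta alpha (cvec p) = mono alpha p * (zeta_coef alpha)%:C.
Proof.
rewrite /zeta; congr (_ * _).
by apply: eq_bigr => j _; rewrite cvecE.
Qed.

Lemma cmeas_zeta alpha : cmeas (fun p => zeta alpha (cvec p)).
Proof.
under eq_fun do rewrite zetaE.
by apply: cmeasM; [exact: cmeas_mono|exact: cmeas_cst].
Qed.

Lemma sqint_zeta alpha : sqint (fun p => zeta alpha (cvec p)).
Proof.
under eq_fun do rewrite zetaE mulrC.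
by apply: sqintZ; exact: sqint_mono.
Qed.

Definition coef F alpha : R[i] :=
  cI L (fun p => F p * (zeta alpha (cvec p))^* * (gd p)%:C).

Lemma cintegrable_coef F alpha : cmeas F -> sqint F ->
  cintegrable L (fun p => F p * (zeta alpha (cvec p))^* * (gd p)%:C).
Proof.
move=> mF sF; apply: cintegrable_sqint => //.
  by apply: cmeasJ; exact: cmeas_zeta.
by apply: sqintJ; exact: sqint_zeta.
Qed.

Lemma coefD F G c alpha : cmeas F -> cmeas G -> sqint F -> sqint G ->
  coef (fun p => c * F p + G p) alpha = c * coef F alpha + coef G alpha.
Proof.
move=> mF mG sF sG; rewrite /coef -cI_Z; last exact: cintegrable_coef.
rewrite -cI_D; last 2 first.
- by apply: cintegrableZ; exact: cintegrable_coef.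
- exact: cintegrable_coef.
by congr cI; apply/funext => p; ring.
Qed.

Section linear_combinations.
Variables (I : Type) (c : I -> R[i]) (G : I -> n.-tuple X -> R[i]).
Hypotheses (mG : forall i, cmeas (G i)) (sG : forall i, sqint (G i)).
Implicit Types s : seq I.

Lemma cmeas_lincomb s : cmeas (fun p => \sum_(i <- s) c i * G i p).
Proof. by apply: cmeas_sum => i; apply: cmeasM => //; exact: cmeas_cst. Qed.

Lemma sqint_lincomb s : sqint (fun p => \sum_(i <- s) c i * G i p).
Proof.
elim: s => [|i s IH].
  under eq_fun do rewrite big_nil; rewrite /sqint.
  under eq_fun do rewrite normc_real normr0 expr0n mul0r.
  exact: integrable0.
under eq_fun do rewrite big_cons.
apply: sqintD => //; [|exact: cmeas_lincomb|exact: sqintZ].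
by apply: cmeasM => //; exact: cmeas_cst.
Qed.

Lemma coef_lincomb s alpha : coef (fun p => \sum_(i <- s) c i * G i p) alpha =
  \sum_(i <- s) c i * coef (G i) alpha.
Proof.
rewrite /coef; under [RHS]eq_bigr do (rewrite -cI_Z; last exact: cintegrable_coef).
rewrite -cI_sum => [|i]; last by apply: cintegrableZ; exact: cintegrable_coef.
congr cI; apply/funext => p; rewrite !mulr_suml.
by apply: eq_bigr => i _; rewrite !mulrA.
Qed.

End linear_combinations.

(** A radial symbol acts diagonally on the basis zeta, by a scalar that
    depends on the degree alone. *)
Lemma coef_radial h i alpha beta : radial_symbol h ->
  coef (fun p => h p * zeta beta (cvec p)) alpha =
  if beta == alpha then level h i (mdeg alpha) / 2 ^+ mdeg alpha else 0.
Proof.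
move=> hP.
have -> : coef (fun p => h p * zeta beta (cvec p)) alpha =
    (zeta_coef beta)%:C * (zeta_coef alpha)%:C * pairing h beta alpha.
  rewrite -cI_Z; last exact: cintegrable_pairing.
  congr cI; apply/funext => p; rewrite !zetaE conjM conjR.
  by ring.
case: eqVneq => [->|ba]; last by rewrite pairing_neq// mulr0.
rewrite (pairing_diag hP i) -rmorphM -expr2 zeta_coef_sqr mulrCA; congr (_ * _).
rewrite /mfact natr_complex natr_prod -rmorphM -big_split/=.
have -> : (2 ^+ mdeg alpha : R[i])^-1 = ((2 ^+ mdeg alpha)^-1)%:C.
  by rewrite fmorphV rmorphXn rmorph_nat.
congr (_%:C); rewrite /mdeg -prodrXr -prodfV; apply: eq_bigr => j _.
by rewrite invfM -mulrA mulVf ?mulr1// pnatr_eq0 -lt0n fact_gt0.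
Qed.

Lemma radial_symbol1 : radial_symbol (fun _ : n.-tuple X => (1 : R[i])).
Proof.
split; first exact: cmeas_cst.
- by move=> f _; exact: aeW.
- by move=> alpha; under eq_fun do rewrite mul1r; exact: sqint_mono.
Qed.

(** The constant weight is radial, which gives orthogonality; the norms are
    Gaussian moments. *)
Lemma coef_zeta alpha beta :
  coef (fun p => zeta beta (cvec p)) alpha = (beta == alpha)%:R.
Proof.
have E : coef (fun p => zeta beta (cvec p)) alpha =
    (zeta_coef beta)%:C * (zeta_coef alpha)%:C * pairing (fun=> 1) beta alpha.
  rewrite -cI_Z; last exact: (cintegrable_pairing radial_symbol1).
  congr cI; apply/funext => p; rewrite !zetaE conjM conjR.
  by ring.
rewrite E; case: eqVneq => [->|ba]; last first.
  by rewrite (pairing_neq radial_symbol1)// mulr0.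
have -> : pairing (fun _ : n.-tuple X => (1 : R[i])) alpha alpha =
    (\prod_(j < n) (2 ^+ alpha j * (alpha j)`!%:R))%:C.
  rewrite /pairing /weighted.
  rewrite (_ : (fun p => _) = fun p => (normc (mono alpha p) ^+ 2 * gd p)%:C).
    by rewrite cI_real /Rintegral integral_mono.
  by apply/funext => p; rewrite mul1r mulJ_normc -rmorphM.
rewrite -!rmorphM -expr2 zeta_coef_sqr -big_split big1//= => j _.
by rewrite mulVf// mulf_neq0 ?expf_neq0 ?pnatr_eq0 -?lt0n ?fact_gt0.
Qed.

Definition nrm2 F : R := \int[L]_p (normc (F p) ^+ 2 * gd p).

Definition zsum (s : seq {ffun 'I_n -> nat}) (d : {ffun 'I_n -> nat} -> R[i]) z :=
  \sum_(alpha <- s) d alpha * zeta alpha z.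

Lemma cmeas_zsum s d : cmeas (fun p => zsum s d (cvec p)).
Proof. exact: (cmeas_lincomb d cmeas_zeta). Qed.

Lemma sqint_zsum s d : sqint (fun p => zsum s d (cvec p)).
Proof. exact: (sqint_lincomb d cmeas_zeta sqint_zeta). Qed.

Lemma cI_zsum F s d : cmeas F -> sqint F ->
  cI L (fun p => F p * (zsum s d (cvec p))^* * (gd p)%:C) =
  \sum_(alpha <- s) (d alpha)^* * coef F alpha.
Proof.
move=> mF sF; rewrite /coef.
under [RHS]eq_bigr do (rewrite -cI_Z; last exact: cintegrable_coef).
rewrite -cI_sum => [|alpha]; last by apply: cintegrableZ; exact: cintegrable_coef.
congr cI; apply/funext => p; rewrite /zsum rmorph_sum mulr_sumr mulr_suml.
by apply: eq_bigr => alpha _; rewrite rmorphM/=; ring.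
Qed.

Lemma coef_zsum s d alpha : uniq s ->
  coef (fun p => zsum s d (cvec p)) alpha = if alpha \in s then d alpha else 0.
Proof.
move=> us; rewrite [LHS](coef_lincomb d cmeas_zeta sqint_zeta).
under eq_bigr do rewrite coef_zeta.
case: ifPn => as_; last first.
  rewrite big_seq big1// => beta bs; case: eqVneq => [ba|]; last by rewrite mulr0.
  by move: as_; rewrite -ba bs.
rewrite (bigD1_seq alpha)//= eqxx mulr1 big1 ?addr0// => beta /negbTE ->.
by rewrite mulr0.
Qed.

Lemma nrm2E F : (nrm2 F)%:C = cI L (fun p => F p * (F p)^* * (gd p)%:C).
Proof.
rewrite /nrm2 -cI_real; congr cI; apply/funext => p.
by rewrite mulJ_normc rmorphM.
Qed.

Lemma nrm2_zsum s d : uniq s ->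
  nrm2 (fun p => zsum s d (cvec p)) = \sum_(alpha <- s) normc (d alpha) ^+ 2.
Proof.
move=> us; apply: (@complexI R); rewrite nrm2E cI_zsum; last 2 first.
- exact: cmeas_zsum.
- exact: sqint_zsum.
rewrite rmorph_sum big_seq [RHS]big_seq; apply: eq_bigr => alpha as_.
by rewrite coef_zsum// as_ mulrC mulJ_normc.
Qed.

Lemma nrm2_ge0 F : 0 <= nrm2 F.
Proof. by apply: Rintegral_ge0 => p _; exact: sq_gd_ge0. Qed.

Lemma bessel F s : uniq s -> cmeas F -> sqint F ->
  \sum_(alpha <- s) normc (coef F alpha) ^+ 2 <= nrm2 F.
Proof.
move=> us mF sF; set S := \sum_(alpha <- s) _.
pose G p := zsum s (coef F) (cvec p).
have mG : cmeas G by exact: cmeas_zsum.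
have sG : sqint G by exact: sqint_zsum.
have FG : cI L (fun p => F p * (G p)^* * (gd p)%:C) = S%:C.
  rewrite cI_zsum// rmorph_sum; apply: eq_bigr => alpha _.
  by rewrite mulrC mulJ_normc.
have GG : cI L (fun p => G p * (G p)^* * (gd p)%:C) = S%:C.
  by rewrite -nrm2E nrm2_zsum.
have iFG A B : cmeas A -> cmeas B -> sqint A -> sqint B ->
    cintegrable L (fun p => A p * (B p)^* * (gd p)%:C).
  by move=> mA mB sA sB; apply: cintegrable_sqint => //;
    [exact: cmeasJ|exact: sqintJ].
have GF : cI L (fun p => G p * (F p)^* * (gd p)%:C) = S%:C.
  rewrite -[S%:C]conjCK -[X in _ = X^*]/(Num.conj S%:C).
  rewrite conjR -{}FG -cI_conj; last exact: iFG.
  congr cI; apply/funext => p; rewrite !conjM conjR conjCK.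
  by ring.
have : (nrm2 (fun p => F p - G p))%:C = (nrm2 F - S)%:C.
  have -> : (nrm2 F - S)%:C = (nrm2 F)%:C + -1 * S%:C + (-1 * S%:C + S%:C).
    by rewrite rmorphB; ring.
  rewrite -{1}GF -{1}FG -GG !nrm2E -!cI_Z; [|exact: iFG..].
  rewrite -!cI_D; try by do ?[exact: iFG|apply: cintegrableZ|apply: cintegrableD].
  by congr cI; apply/funext => p; rewrite rmorphB; ring.
by move=> /complexI E; rewrite -subr_ge0 -E nrm2_ge0.
Qed.

(** Exponents are exhausted by boxes instead of by degree because sums over
    boxes factor over the coordinates. *)
Definition box N : seq {ffun 'I_n -> nat} :=
  [seq [ffun j => nat_of_ord (a j)] | a : {ffun 'I_n -> 'I_N}].

Lemma big_box (V : nmodType) N (F : {ffun 'I_n -> nat} -> V) :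
  \sum_(alpha <- box N) F alpha =
  \sum_(a : {ffun 'I_n -> 'I_N}) F [ffun j => nat_of_ord (a j)].
Proof. by rewrite /box big_image. Qed.

Lemma box_uniq N : uniq (box N).
Proof.
rewrite map_inj_uniq ?enum_uniq// => a b /ffunP ab.
by apply/ffunP => j; apply: val_inj; have := ab j; rewrite !ffunE.
Qed.

Lemma mem_box N alpha : (alpha \in box N) = [forall j, (alpha j < N)%N].
Proof.
apply/mapP/forallP => [[a _ ->] j|aN]; first by rewrite ffunE.
exists [ffun j => Ordinal (aN j)]; first by rewrite mem_enum.
by apply/ffunP => j; rewrite !ffunE.
Qed.

Lemma box_mono M N alpha : (M <= N)%N -> alpha \in box M -> alpha \in box N.
Proof.
move=> MN; rewrite !mem_box => /forallP aM; apply/forallP => j.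
exact: leq_trans (aM j) MN.
Qed.

Lemma big_box_le (V : nmodType) M N (F : {ffun 'I_n -> nat} -> V) : (M <= N)%N ->
  \sum_(alpha <- box N) F alpha =
  \sum_(alpha <- box M) F alpha +
  \sum_(alpha <- box N | alpha \notin box M) F alpha.
Proof.
move=> MN; rewrite (bigID (mem (box M)))/=; congr (_ + _).
rewrite -big_filter; apply: perm_big; apply: uniq_perm.
- by rewrite filter_uniq// box_uniq.
- exact: box_uniq.
- move=> alpha; rewrite mem_filter.
  by apply/andP/idP => [[]//|aM]; split => //; exact: box_mono aM.
Qed.

Lemma sum_box_prod (K : comNzRingType) N (f : 'I_n -> nat -> K) :
  \sum_(alpha <- box N) \prod_(j < n) f j (alpha j) =
  \prod_(j < n) \sum_(k < N) f j k.
Proof.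
rewrite bigA_distr_bigA big_box/=; apply: eq_bigr => a _.
by apply: eq_bigr => j _; rewrite ffunE.
Qed.

(** Truncating the exponential series of every coordinate truncates the
    expansion of the reproducing kernel to a box. *)
Lemma kernel_box N z p :
  \prod_(j < n) pexp N (z 0 j * (coord j p)^* / 2) =
  \sum_(alpha <- box N) zeta alpha z * (zeta alpha (cvec p))^*.
Proof.
rewrite -(sum_box_prod N (fun j k => (z 0 j * (coord j p)^* / 2) ^+ k / k`!%:R)).
apply: eq_bigr => alpha _; rewrite zetaE conjM conjR.
have -> : zeta alpha z = \prod_(j < n) z 0 j ^+ alpha j * (zeta_coef alpha)%:C.
  by [].
rewrite mulrACA -rmorphM -expr2 zeta_coef_sqr /mono rmorph_prod.
rewrite rmorph_prod -!big_split/=; apply: eq_bigr => j _.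
rewrite rmorphXn/= fmorphV rmorphM rmorphXn !rmorph_nat exprMn exprVn exprMn.
by rewrite invfM; ring.
Qed.

Definition proj F z : R[i] :=
  cI L (fun p => F p * cexp (hdot z (cvec p) / 2) * (gd p)%:C).

Definition kernel_approx z N p : R[i] :=
  \prod_(j < n) pexp N (z 0 j * (coord j p)^* / 2).

Lemma cmeas_kernel_approx z N : cmeas (kernel_approx z N).
Proof.
apply: cmeas_prod => j; rewrite /pexp; apply: cmeas_sum => k.
apply: cmeasM; last exact: cmeas_cst.
apply: cmeasX; apply: cmeasM; last exact: cmeas_cst.
by apply: cmeasM; [exact: cmeas_cst|apply: cmeasJ; exact: cmeas_coord].
Qed.

Lemma cvg_kernel_approx z p :
  cvgC (fun N => kernel_approx z N p) (cexp (hdot z (cvec p) / 2)).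
Proof.
rewrite /hdot mulr_suml cexp_sum; apply: cvgC_prod => j.
by rewrite cvecE; exact: pexp_cvg_cexp.
Qed.

Lemma cmeas_kernel z : cmeas (fun p => cexp (hdot z (cvec p) / 2)).
Proof.
exact: cmeas_cvg (cmeas_kernel_approx z) (cvg_kernel_approx z).
Qed.

(** The truncated kernels converge pointwise and stay below kernel_bound,
    which is square integrable, so that dominated convergence applies at every
    point z. *)
Lemma proj_expansion F z : cmeas F -> sqint F ->
  cvgC (fun N => zsum (box N) (coef F) z) (proj F z).
Proof.
move=> mF sF.
have -> : (fun N => zsum (box N) (coef F) z) =
    fun N => cI L (fun p => F p * kernel_approx z N p * (gd p)%:C).
  apply/funext => N; rewrite /zsum /coef.
  under [LHS]eq_bigr do (rewrite mulrC -cI_Z; last exact: cintegrable_coef).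
  rewrite -cI_sum => [|alpha]; last by apply: cintegrableZ; exact: cintegrable_coef.
  congr cI; apply/funext => p; rewrite /kernel_approx kernel_box mulr_sumr mulr_suml.
  by apply: eq_bigr => alpha _; ring.
pose zf j := z 0 j.
apply: (@cI_dominated _ _ _ _ _ _ (fun p =>
    normc (F p) ^+ 2 * gd p + normc (kernel_bound zf p)%:C ^+ 2 * gd p)).
- move=> N; apply: cmeasM; last exact: cmeas_gd.
  by apply: cmeasM => //; exact: cmeas_kernel_approx.
- move=> p; apply: cvgCM; last exact: cvgC_cst.
  by apply: cvgCM; [exact: cvgC_cst|exact: cvg_kernel_approx].
- move=> N p; rewrite !normcM [X in _ * X]normc_real ger0_norm ?gd_ge0// -mulrDl.
  apply: ler_wpM2r; first exact: gd_ge0.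
  have kb0 : 0 <= kernel_bound zf p by apply: prodr_ge0 => j _; exact: expR_ge0.
  rewrite normc_real ger0_norm//.
  have KB : normc (kernel_approx z N p) <= kernel_bound zf p.
    rewrite normc_prod; apply: ler_prod => j _; rewrite normc_ge0/=.
    apply: le_trans (normc_pexp _ _) _; rewrite ler_expR !normcM normcJ.
    rewrite natr_complex -fmorphV normc_real ger0_norm//.
  apply: le_trans (ler_wpM2l (normc_ge0 _) KB) _.
  have := sqr_ge0 (normc (F p) - kernel_bound zf p).
  have := sqr_ge0 (normc (F p)); have := sqr_ge0 (kernel_bound zf p).
  by rewrite sqrrB; nra.
- under eq_fun do rewrite EFinD; apply: integrableD => //.
  exact: sqint_kernel_bound.
Qed.

End fock_expansion.

(** * Entire functions with bounded coefficients *)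

Section entire_series.
Variables (R : realType) (n : nat).
Local Notation normc := (@Normc.normc R).
Implicit Types (alpha : {ffun 'I_n -> nat}) (z h : 'rV[R[i]]_n) (w : seq 'I_n).

(** A total function, equal to the limit whenever there is one. *)
Definition climit (u : nat -> R[i]) : R[i] :=
  limn (fun N => complex.Re (u N)) +i* limn (fun N => complex.Im (u N)).

Lemma climitE u l : cvgC u l -> climit u = l.
Proof.
by move=> [ru iu]; apply: complex_eqP; rewrite /climit/=; exact: cvg_lim.
Qed.

Definition fser (d : {ffun 'I_n -> nat} -> R[i]) z : R[i] :=
  climit (fun N => zsum (box n N) d z).

(** The value of zeta alpha at the point whose coordinates all equal x. *)
Definition zeta_major (x : R) alpha : R := zeta_coef R alpha * x ^+ mdeg alpha.

Definition box_bound (x : R) : R := ((expR (x ^+ 2) + 2) / 2) ^+ n.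

Lemma zeta_coef_prod alpha : zeta_coef R alpha =
  \prod_(j < n) (Num.sqrt (2 ^+ alpha j * (alpha j)`!%:R))^-1.
Proof.
have p0 j : 0 <= (Num.sqrt (2 ^+ alpha j * (alpha j)`!%:R))^-1 :> R.
  by rewrite invr_ge0 sqrtr_ge0.
apply/eqP; rewrite -(@eqrXn2 _ 2)//; [|exact: zeta_coef_ge0|exact: prodr_ge0].
rewrite zeta_coef_sqr -prodrXl; apply/eqP/eq_bigr => j _.
by rewrite exprVn sqr_sqrtr// mulr_ge0 ?exprn_ge0.
Qed.

Lemma le_mean (a b r : R) : 0 <= a -> 0 <= b -> 0 <= r -> r ^+ 2 = a * b ->
  r <= (a + b) / 2.
Proof.
move=> a0 b0 r0 rab; rewrite -(@ler_pXn2r _ 2) ?nnegrE ?divr_ge0 ?addr_ge0// rab.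
by rewrite -subr_ge0 (_ : _ - _ = ((a - b) / 2) ^+ 2) ?sqr_ge0//; field.
Qed.

(** The square root of the exponential coefficients is still summable: by the
    arithmetic-geometric inequality the general term is at most half the sum
    of an exponential and a geometric term. *)
Lemma sum_zeta_major N (x : R) : 0 <= x ->
  \sum_(alpha <- box n N) zeta_major x alpha <= box_bound x.
Proof.
move=> x0; pose r k : R := (Num.sqrt (2 ^+ k * k`!%:R))^-1 * x ^+ k.
have -> : \sum_(alpha <- box n N) zeta_major x alpha =
    \sum_(alpha <- box n N) \prod_(j < n) r (alpha j).
  apply: eq_bigr => alpha _.
  by rewrite /zeta_major zeta_coef_prod /mdeg -prodrXr -big_split.
have r0 k : 0 <= r k by rewrite mulr_ge0 ?invr_ge0 ?sqrtr_ge0 ?exprn_ge0.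
rewrite (sum_box_prod N (fun _ k => r k)) prodr_const card_ord.
apply: lerXn2r; rewrite ?nnegrE ?sumr_ge0//.
have rle k : r k <= ((x ^+ 2) ^+ k / k`!%:R + 2^-1 ^+ k) / 2.
  set a := _ / k`!%:R; set b := 2^-1 ^+ k.
  have a0 : 0 <= a by rewrite divr_ge0 ?exprn_ge0.
  have b0 : 0 <= b by rewrite exprn_ge0 ?invr_ge0.
  have r2 : r k ^+ 2 = a * b.
    rewrite exprMn exprVn sqr_sqrtr; last by rewrite mulr_ge0 ?exprn_ge0.
    rewrite /a /b exprVn -!exprM mulnC invfM.
    by rewrite [LHS]mulrC mulrCA mulrC [_ / _ / _]mulrAC mulrC; ring.
  exact: le_mean.
apply: (@le_trans _ _ (\sum_(k < N) ((x ^+ 2) ^+ k / k`!%:R + 2^-1 ^+ k) / 2)).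
  by apply: ler_sum => k _; exact: rle.
rewrite -mulr_suml ler_wpM2r ?invr_ge0// big_split/= lerD//.
  by apply: (pexp_le_expR N); rewrite exprn_ge0.
have -> : \sum_(k < N) (2^-1 : R) ^+ k = 2 - 2 * 2^-1 ^+ N.
  elim: N => [|N IH]; first by rewrite big_ord0 expr0; ring.
  by rewrite big_ord_recr/= IH exprS; field.
by rewrite lerBlDr lerDl mulr_ge0// exprn_ge0// invr_ge0.
Qed.

Lemma cvg_box_sum (F : {ffun 'I_n -> nat} -> R[i]) (B x : R) : 0 <= B -> 0 <= x ->
  (forall alpha, normc (F alpha) <= B * zeta_major x alpha) ->
  exists2 l, cvgC (fun N => \sum_(alpha <- box n N) F alpha) l &
             normc l <= B * box_bound x.
Proof.
move=> B0 x0 FB.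
have sumle N : \sum_(alpha <- box n N) B * zeta_major x alpha <= B * box_bound x.
  by rewrite -mulr_sumr; apply: ler_wpM2l => //; exact: sum_zeta_major.
have [|l ul] := @cvgC_dominated _ (fun N => \sum_(alpha <- box n N) F alpha)
  (fun N => \sum_(alpha <- box n N) B * zeta_major x alpha) (B * box_bound x) _ sumle.
  move=> M N MN; rewrite !(big_box_le _ MN) [X in normc X]addrC addKr.
  rewrite [leRHS]addrC addKr; apply: le_trans (normc_sum _ _ _) _.
  by apply: ler_sum => alpha _.
exists l => //; apply: (cvgr_to_le (cvgC_norm ul)); apply: nearW => N.
apply: le_trans (normc_sum _ _ _) (le_trans _ (sumle N)).
by apply: ler_sum => alpha _.
Qed.

(** A monomial as the product along a word in the coordinates: inductions on
    the word replace the bookkeeping of exponents. *)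
Definition wval w z : R[i] := \prod_(i <- w) z 0 i.

(** The partial derivative of wval w in the coordinate k, by the product rule
    along the word. *)
Fixpoint wpart (k : 'I_n) w z : R[i] :=
  if w is i :: w' then (i == k)%:R * wval w' z + z 0 i * wpart k w' z else 0.

Definition word alpha : seq 'I_n := flatten [seq nseq (alpha j) j | j <- enum 'I_n].

Lemma wval_word alpha z : wval (word alpha) z = \prod_(j < n) z 0 j ^+ alpha j.
Proof.
rewrite /wval /word big_flatten big_map big_enum/=; apply: eq_bigr => j _.
by rewrite big_nseq iter_mulr_1.
Qed.

Lemma size_word alpha : size (word alpha) = mdeg alpha.
Proof.
rewrite /word size_flatten /shape -map_comp sumnE big_map big_enum/=.
by apply: eq_bigr => j _; rewrite size_nseq.
Qed.

Lemma zeta_word alpha z : zeta alpha z = wval (word alpha) z * (zeta_coef R alpha)%:C.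
Proof. by rewrite wval_word. Qed.

Lemma wpart_le k w z (rho : R) : (forall j, normc (z 0 j) <= rho) -> 0 <= rho ->
  normc (wval w z) <= (rho + 1) ^+ size w /\
  normc (wpart k w z) <= (rho + 1) ^+ size w.
Proof.
move=> zr r0; have r1 : 0 <= rho + 1 by rewrite addr_ge0.
elim: w => [|i w [IH1 IH2]].
  by rewrite /wval big_nil -[wpart _ _ _]/(0 : R[i]) Normc.normc1 Normc.normc0 expr0.
rewrite -[wpart k (i :: w) z]/((i == k)%:R * wval w z + z 0 i * wpart k w z).
rewrite /wval big_cons -/(wval w z) exprS mulrDl mul1r; split.
  rewrite normcM -[leLHS]addr0 lerD ?exprn_ge0// ler_pM//.
rewrite [leRHS]addrC; apply: le_trans (normcD _ _) _; apply: lerD.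
  case: eqP => _; first by rewrite mul1r.
  by rewrite mul0r Normc.normc0 exprn_ge0.
by rewrite normcM ler_pM.
Qed.

Lemma wval_le w z (rho : R) : (forall j, normc (z 0 j) <= rho) -> 0 <= rho ->
  normc (wval w z) <= rho ^+ size w.
Proof.
move=> zr r0; elim: w => [|i w IH].
  by rewrite /wval big_nil Normc.normc1 expr0.
by rewrite /wval big_cons normcM [size _]/= exprS; apply: ler_pM.
Qed.

(** An increment of size delta costs a factor delta or delta ^ 2 against the
    value of the monomial at the polyradius rho + 1. The constant does not
    depend on the degree, so that the estimates can be summed over all
    monomials. *)
Lemma wval_taylor w z h (rho delta : R) :
  (forall j, normc (z 0 j) <= rho) -> 0 <= rho ->
  (forall j, normc (h 0 j) <= delta) -> delta <= 1 -> 0 <= delta ->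
  normc (wval w (z + h) - wval w z) <= delta * (rho + 1) ^+ size w /\
  normc (wval w (z + h) - wval w z - \sum_k h 0 k * wpart k w z)
    <= delta ^+ 2 * (rho + 1) ^+ size w.
Proof.
move=> zr r0 hd d1 d0; have r1 : 0 <= rho + 1 by rewrite addr_ge0.
have zhr j : normc ((z + h) 0 j) <= rho + 1.
  by rewrite mxE; apply: le_trans (normcD _ _) _; apply: lerD => //; exact: le_trans d1.
elim: w => [|i w [IH1 IH2]].
  rewrite /wval !big_nil subrr big1 => [|k _]; last by rewrite mulr0.
  by rewrite subr0 Normc.normc0 expr0 !mulr1 d0 exprn_ge0.
rewrite /wval !big_cons -/(wval w z) -/(wval w (z + h)) [size _]/= exprS; split.
  have -> : (z + h) 0 i * wval w (z + h) - z 0 i * wval w z =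
      z 0 i * (wval w (z + h) - wval w z) + h 0 i * wval w (z + h).
    by rewrite mxE; ring.
  apply: le_trans (normcD _ _) _; rewrite !normcM.
  have -> : delta * ((rho + 1) * (rho + 1) ^+ size w) =
     rho * (delta * (rho + 1) ^+ size w) + delta * (rho + 1) ^+ size w by ring.
  by apply: lerD; apply: ler_pM => //; exact: wval_le.
have -> : \sum_k h 0 k * wpart k (i :: w) z =
    \sum_k h 0 k * ((i == k)%:R * wval w z + z 0 i * wpart k w z) by [].
have -> : \sum_k h 0 k * ((i == k)%:R * wval w z + z 0 i * wpart k w z) =
    h 0 i * wval w z + z 0 i * \sum_k h 0 k * wpart k w z.
  rewrite mulr_sumr; under eq_bigr do rewrite mulrDr.
  rewrite big_split/=; congr (_ + _); last by apply: eq_bigr => k _; ring.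
  rewrite (bigD1 i)//= eqxx mul1r big1 ?addr0// => k ki.
  by rewrite eq_sym (negbTE ki) mul0r mulr0.
have -> : (z + h) 0 i * wval w (z + h) - z 0 i * wval w z -
    (h 0 i * wval w z + z 0 i * \sum_k h 0 k * wpart k w z) =
    z 0 i * (wval w (z + h) - wval w z - \sum_k h 0 k * wpart k w z) +
    h 0 i * (wval w (z + h) - wval w z).
  by rewrite mxE; ring.
apply: le_trans (normcD _ _) _; rewrite !normcM.
have -> : delta ^+ 2 * ((rho + 1) * (rho + 1) ^+ size w) =
   rho * (delta ^+ 2 * (rho + 1) ^+ size w) + delta * (delta * (rho + 1) ^+ size w).
  by ring.
by apply: lerD; apply: ler_pM.
Qed.

Definition coord_bound z : R := \sum_(j < n) normc (z 0 j).

Lemma coord_bound_ge0 z : 0 <= coord_bound z.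
Proof. by apply: sumr_ge0 => j _. Qed.

Lemma coord_le_bound z j : normc (z 0 j) <= coord_bound z.
Proof. by rewrite /coord_bound (bigD1 j)//= lerDl sumr_ge0. Qed.

Lemma normc_zeta_le alpha z :
  normc (zeta alpha z) <= zeta_major (coord_bound z) alpha.
Proof.
rewrite zeta_word normcM normc_real ger0_norm ?zeta_coef_ge0// mulrC.
rewrite /zeta_major -size_word.
apply: ler_wpM2l; first exact: zeta_coef_ge0.
by apply: wval_le; [exact: coord_le_bound|exact: coord_bound_ge0].
Qed.

Lemma fser_cvg d z (B : R) : 0 <= B -> (forall alpha, normc (d alpha) <= B) ->
  cvgC (fun N => zsum (box n N) d z) (fser d z).
Proof.
move=> B0 dB; have [|l ul _] := @cvg_box_sum
  (fun alpha => d alpha * zeta alpha z) _ _ B0 (coord_bound_ge0 z).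
  move=> alpha; rewrite normcM; apply: ler_pM => //; exact: normc_zeta_le.
by rewrite /fser (climitE ul).
Qed.

(** Termwise differentiation: by wval_taylor the remainders of the monomials
    have the common factor delta ^ 2 and are summable by sum_zeta_major. *)
Lemma fser_taylor d z (B : R) : 0 <= B -> (forall alpha, normc (d alpha) <= B) ->
  exists (g : 'I_n -> R[i]) (C : R), 0 <= C /\
  forall h (delta : R), (forall j, normc (h 0 j) <= delta) -> delta <= 1 ->
    0 <= delta ->
    normc (fser d (z + h) - fser d z - \sum_k h 0 k * g k) <= C * delta ^+ 2.
Proof.
move=> B0 dB; set rho := coord_bound z; have r0 : 0 <= rho := coord_bound_ge0 z.
have r1 : 0 <= rho + 1 by rewrite addr_ge0.
pose dz k alpha := d alpha * (wpart k (word alpha) z * (zeta_coef R alpha)%:C).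
have /choice[g gP] k : exists l, cvgC (fun N => \sum_(alpha <- box n N) dz k alpha) l.
  have [|l ul _] := @cvg_box_sum (dz k) _ _ B0 r1; last by exists l.
  move=> alpha; rewrite normcM; apply: ler_pM => //.
  rewrite normcM normc_real ger0_norm ?zeta_coef_ge0// mulrC.
  rewrite /zeta_major -size_word.
  apply: ler_wpM2l; first exact: zeta_coef_ge0.
  by have [_ ->] := wpart_le k (word alpha) (coord_le_bound z) r0.
exists g, (B * box_bound (rho + 1)); split.
  rewrite mulr_ge0// exprn_ge0// divr_ge0// addr_ge0// expR_ge0.
move=> h delta hd d1 d0.
pose E alpha := d alpha * (zeta alpha (z + h)) - d alpha * zeta alpha z -
  \sum_k h 0 k * dz k alpha.
have [|||l ul lle] := @cvg_box_sum E (B * delta ^+ 2) (rho + 1).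
- by rewrite mulr_ge0// exprn_ge0.
- by [].
- move=> alpha.
  have -> : E alpha = d alpha * (zeta_coef R alpha)%:C *
     (wval (word alpha) (z + h) - wval (word alpha) z -
      \sum_k h 0 k * wpart k (word alpha) z).
    rewrite /E !zeta_word mulrBr mulr_sumr; congr (_ - _); first by ring.
    by apply: eq_bigr => k _; rewrite /dz; ring.
  have [_ T] := wval_taylor (word alpha) (coord_le_bound z) r0 hd d1 d0.
  rewrite -/rho size_word in T.
  rewrite !normcM normc_real ger0_norm ?zeta_coef_ge0//.
  have -> : B * delta ^+ 2 * zeta_major (rho + 1) alpha =
      B * zeta_coef R alpha * (delta ^+ 2 * (rho + 1) ^+ mdeg alpha).
    by rewrite /zeta_major; ring.
  apply: ler_pM => //; first by rewrite mulr_ge0// zeta_coef_ge0.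
  by apply: ler_wpM2r => //; exact: zeta_coef_ge0.
have -> : fser d (z + h) - fser d z - \sum_k h 0 k * g k = l; last first.
  by rewrite mulrAC in lle.
apply: (cvgC_unique _ ul).
rewrite [X in cvgC X _](_ : _ = fun N => zsum (box n N) d (z + h) +
   - zsum (box n N) d z + - \sum_k h 0 k * \sum_(alpha <- box n N) dz k alpha).
  apply: cvgCD; first apply: cvgCD.
  - exact: fser_cvg dB.
  - by apply: cvgCN; exact: fser_cvg dB.
  - apply: cvgCN; apply: cvgC_sum => k; apply: cvgCM; last exact: gP.
    exact: cvgC_cst.
apply/funext => N; rewrite /E !sumrB; congr (_ - _).
rewrite exchange_big; apply: eq_bigr => k _.
by rewrite mulr_sumr.
Qed.

End entire_series.

Lemma differentiable_quadratic (K : numFieldType) n (f : 'rV[K]_n -> K)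
    (z : 'rV[K]_n) (g : 'I_n -> K) (C : K) : 0 <= C ->
  (forall h : 'rV[K]_n, `|h| <= 1 ->
    `|f (z + h) - f z - \sum_k h 0 k * g k| <= C * `|h| ^+ 2) ->
  differentiable f z.
Proof.
move=> C0 fC.
pose df (h : 'rV[K]_n) : K := \sum_k h 0 k * g k.
have dfl : linear df.
  move=> a u v; rewrite /df scaler_sumr -big_split/=; apply: eq_bigr => k _.
  by rewrite !mxE -[a *: _]/(a * _); ring.
pose dfL := GRing.isLinear.Build _ _ _ _ df dfl.
pose dfM : {linear 'rV[K]_n -> K} := HB.pack df dfL.
have dfc : continuous dfM.
  rewrite /dfM/= /df; elim: (index_enum _) => [|k s IH] x.
    under [X in continuous_at _ X]eq_fun do rewrite big_nil.
    exact: cst_continuous.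
  under [X in continuous_at _ X]eq_fun do rewrite big_cons.
  have ck : continuous (fun h : 'rV[K]_n => h 0 k * g k).
    move=> y; apply: (@continuous_comp _ _ _ (fun h : 'rV[K]_n => h 0 k)
      (fun u : K => u * g k)); first exact: coord_continuous.
    exact: mulrr_continuous.
  exact: cvgD (ck x) (IH x).
have dfo : f \o shift z = cst (f z) + dfM +o_ (0 : 'rV[K]_n) id.
  apply/eqaddoP => e e0.
  have C1 : 0 < C + 1 by rewrite ltr_wpDl.
  have eC : 0 < e / (C + 1) by rewrite divr_gt0.
  have N1 := @nbhs0_le K 'rV[K]_n 1 ltr01.
  have N2 := @nbhs0_le K 'rV[K]_n _ eC.
  apply: filterS2 N1 N2 => h h1 hC.
  rewrite /= -[X in `|X|]/(f (h + z) - (f z + df h)) opprD addrA [h + z]addrC.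
  apply: le_trans (fC h h1) _.
  rewrite expr2 mulrA ler_wpM2r//; apply: le_trans (ler_wpM2l C0 hC) _.
  rewrite mulrCA; apply: ler_piMr; first exact: ltW.
  by rewrite ler_pdivrMr// mul1r lerDl.
apply/diff_locallyP; rewrite (diff_unique dfc dfo); split => //.
Qed.

Section fser_entire.
Variables (R : realType) (n : nat).
Implicit Types (alpha : {ffun 'I_n -> nat}) (z h : 'rV[R[i]]_n).

Lemma complex_normE (x : R[i]) : `|x| = (Normc.normc x)%:C.
Proof. by case: x. Qed.

Lemma coord_le_norm h j : `|h 0 j| <= `|h|.
Proof.
by rewrite [leRHS]mx_normE -[leLHS]nngE num_le; exact: (le_bigmax _ _ (0, j)).
Qed.

Lemma fser_entire (d : {ffun 'I_n -> nat} -> R[i]) (B : R) : 0 <= B ->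
  (forall alpha, Normc.normc (d alpha) <= B) -> entire (fser d).
Proof.
move=> B0 dB z; have [g [C [C0 T]]] := fser_taylor z B0 dB.
apply: (@differentiable_quadratic _ _ _ _ g C%:C).
  by rewrite lecE /= eqxx.
move=> h h1.
have hr : `|h| = (complex.Re `|h|)%:C.
  by rewrite -[LHS]RRe_real// ger0_real.
rewrite complex_normE hr -rmorphXn -rmorphM lecR; apply: T.
- by move=> j; rewrite -lecR -complex_normE -hr; exact: coord_le_norm.
- by move: h1; rewrite hr -[1]/(1%:C) lecR.
- by have : 0 <= `|h| by []; rewrite hr -[0]/(0%:C) lecR.
Qed.

End fser_entire.

(** * Laguerre and multinomial identities *)

Lemma sum_triangle_square (K : pzSemiRingType) N (c e f : nat -> K) :
  (forall s, (N <= s)%N -> c s = 0) ->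
  \sum_(s < N) c s * \sum_(p < s.+1) e p * f (s - p)%N =
  \sum_(p < N) \sum_(q < N) c (p + q)%N * (e p * f q).
Proof.
move=> c0.
transitivity (\sum_(s < N) \sum_(p < s.+1)
    c (p + (s - p))%N * (e p * f (s - p)%N)).
  apply: eq_bigr => s _; rewrite mulr_sumr; apply: eq_bigr => p _.
  by rewrite subnKC// -ltnS.
rewrite (sum_triangle N (fun p q => c (p + q)%N * (e p * f q))).
apply: eq_bigr => p _.
rewrite -(big_mkord xpredT (fun q => c (p + q)%N * (e p * f q))).
rewrite [RHS](big_cat_nat (leq0n _) (leq_subr p N))/=.
rewrite [X in _ = _ + X]big_nat_cond [X in _ = _ + X]big1 ?addr0// => q /andP[/andP[Npq _] _].
by rewrite c0 ?mul0r// -leq_subLR.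
Qed.

Lemma sum_bin_col i m : (\sum_(l < i.+1) 'C(l + m, m) = 'C(i + m.+1, m.+1))%N.
Proof.
elim: i => [|i IH]; first by rewrite big_ord_recr big_ord0/= !add0n !binn.
by rewrite big_ord_recr/= IH !addSn !addnS binS.
Qed.

(** Vandermonde convolution over the upper indices, by Pascal's rule on the
    second factor. *)
Lemma sum_bin_conv M p q :
  (\sum_(l < M.+1) 'C(l, p) * 'C(M - l, q) = 'C(M.+1, (p + q).+1))%N.
Proof.
elim: M q => [|M IH] q.
  rewrite big_ord_recr big_ord0/= subn0 add0n.
  by case: p q => [|p] [|q]//; rewrite ?bin0n ?muln0 ?mul0n// bin_small.
rewrite big_ord_recr/= subnn.
case: q => [|q]; last first.
  rewrite bin0n muln0 addn0.
  transitivity (\sum_(l < M.+1) ('C(l, p) * 'C(M - l, q.+1) +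
      'C(l, p) * 'C(M - l, q)))%N.
    by apply: eq_bigr => l _; rewrite subSn ?binS ?mulnDr// -ltnS.
  by rewrite big_split/= !IH addnS binS.
rewrite bin0 muln1 addn0.
transitivity (\sum_(l < M.+1) 'C(l, p) * 'C(M - l, 0) + 'C(M.+1, p))%N.
  by congr addn; apply: eq_bigr => l _; rewrite !bin0.
by rewrite IH addn0 binS.
Qed.

Lemma bin_mul_bin n m l : (l <= m)%N -> (m <= n)%N ->
  ('C(n, m) * 'C(m, l) = 'C(n, l) * 'C(n - l, m - l))%N.
Proof.
move=> lm mn; have ln := leq_trans lm mn.
have f0 := fact_gt0.
apply/eqP; rewrite -(eqn_pmul2r (f0 l)) -(eqn_pmul2r (f0 (m - l)%N)).
rewrite -(eqn_pmul2r (f0 (n - m)%N)); apply/eqP.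
have := bin_fact mn; have := bin_fact lm; have := bin_fact ln.
have := bin_fact (leq_sub2r l mn); rewrite subnBA// subnK//.
set a := 'C(n, m); set b := 'C(m, l); set c := 'C(n, l); set e := 'C(_, _).
move=> E1 E2 E3 E4.
transitivity (a * ((b * (l`! * (m - l)`!)) * (n - m)`!))%N; first by lia.
rewrite E3 E4 -E2 -E1; lia.
Qed.

Section laguerre_minus.
Variable K : numFieldType.
Implicit Types (x y : K).

(** The Laguerre polynomial of type a and degree i at - y. Its coefficients
    are nonnegative, as befits the moments that it computes in
    integral_two_gauss and integral_gap_moment. *)
Definition lagm a i y : K := \sum_(j < i.+1) 'C(i + a, a + j)%:R * (y ^+ j / j`!%:R).

Lemma lagm_widen a i N y : (i < N)%N ->
  lagm a i y = \sum_(j < N) 'C(i + a, a + j)%:R * (y ^+ j / j`!%:R).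
Proof.
move=> iN; rewrite /lagm.
rewrite -(big_mkord xpredT (fun j => 'C(i + a, a + j)%:R * (y ^+ j / j`!%:R))).
rewrite -(big_mkord xpredT (fun j => 'C(i + a, a + j)%:R * (y ^+ j / j`!%:R))).
rewrite [RHS](big_cat_nat (leq0n _) iN)/=.
rewrite [X in _ = _ + X]big_nat_cond [X in _ = _ + X]big1 ?addr0// => j /andP[/andP[ij _] _].
by rewrite bin_small ?mul0r// addnC ltn_add2l.
Qed.

(** The addition theorem of Laguerre polynomials; comparing coefficients
    reduces it to sum_bin_conv. *)
Lemma lagmD m i x y :
  \sum_(l < i.+1) lagm 0 l x * lagm m (i - l) y = lagm m.+1 i (x + y).
Proof.
pose N := i.+1; pose c s : K := 'C((i + m).+1, (m + s).+1)%:R.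
have -> : lagm m.+1 i (x + y) = \sum_(s < N) c s *
    \sum_(p < s.+1) (x ^+ p / p`!%:R) * (y ^+ (s - p) / (s - p)`!%:R).
  apply: eq_bigr => s _; rewrite exprD_fact /c addnS addSn; congr (_ * _).
rewrite (@sum_triangle_square _ N c (fun p => x ^+ p / p`!%:R)
  (fun q => y ^+ q / q`!%:R)); last first.
  by move=> s Ns; rewrite /c bin_small// ltnS addnC ltn_add2l.
transitivity (\sum_(l < i.+1) \sum_(p < N) \sum_(q < N)
   ('C(l, p) * 'C(i + m - l, m + q))%:R * ((x ^+ p / p`!%:R) * (y ^+ q / q`!%:R))).
  apply: eq_bigr => l _; have li : (l <= i)%N by rewrite -ltnS.
  rewrite (@lagm_widen 0 l N)// (@lagm_widen m (i - l) N) ?ltnS ?leq_subr//.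
  rewrite mulr_suml; apply: eq_bigr => p _.
  rewrite mulr_sumr; apply: eq_bigr => q _.
  by rewrite addn0 add0n natrM addnC addnBA// [(m + i)%N]addnC; ring.
rewrite exchange_big; apply: eq_bigr => p _; rewrite exchange_big; apply: eq_bigr => q _.
rewrite -mulr_suml -natr_sum /c; congr (_%:R * _).
rewrite addnCA -sum_bin_conv.
rewrite -(big_mkord xpredT (fun l => 'C(l, p) * 'C(i + m - l, m + q))%N).
rewrite -(big_mkord xpredT (fun l => 'C(l, p) * 'C(i + m - l, m + q))%N).
rewrite [RHS](@big_cat_nat _ _ _ i.+1)/= ?ltnS ?leq_addr//.
rewrite [X in _ = (_ + X)%N]big_nat_cond [X in _ = (_ + X)%N]big1 ?addn0// => l /andP[/andP[il lm] _].
by rewrite ['C(i + m - l, _)]bin_small ?muln0//; lia.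
Qed.

(** Binomial inversion: exchanging the sums leaves the alternating sum of a
    full row of binomial coefficients, which vanishes unless j = k. *)
Lemma lagm_inversion a k y :
  \sum_(i < k.+1) ((-1) ^+ i * 'C(k + a, k - i)%:R) * lagm a i y =
  (- y) ^+ k / k`!%:R.
Proof.
transitivity (\sum_(j < k.+1) (y ^+ j / j`!%:R) * (\sum_(i < k.+1)
    (-1) ^+ i * ('C(k + a, i + a) * 'C(i + a, a + j))%:R)).
  under [RHS]eq_bigr do rewrite mulr_sumr.
  rewrite [RHS]exchange_big; apply: eq_bigr => i _.
  rewrite (@lagm_widen a i k.+1)// mulr_sumr; apply: eq_bigr => j _.
  have ik : (i <= k)%N by rewrite -ltnS.
  have -> : 'C(k + a, k - i) = 'C(k + a, i + a).
    by rewrite -(@bin_sub (k + a) (i + a)) ?leq_add2r// subnDr.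
  by rewrite natrM; ring.
have inner (j : nat) : (j <= k)%N -> \sum_(i < k.+1)
    (-1) ^+ i * ('C(k + a, i + a) * 'C(i + a, a + j))%:R =
    (if j == k then (-1) ^+ k else 0) :> K.
  move=> jk.
  rewrite -(big_mkord xpredT (fun i => (-1) ^+ i *
    ('C(k + a, i + a) * 'C(i + a, a + j))%:R)).
  rewrite (@big_cat_nat _ _ _ j)//=; last exact: leqW.
  rewrite big_nat_cond big1 ?add0r; last first.
    move=> i /andP[/andP[_ ij] _].
    by rewrite ['C(i + a, _)]bin_small ?muln0 ?mulr0// addnC ltn_add2l.
  rewrite -{1}[j]add0n big_addn subSn// big_mkord.
  transitivity ((-1) ^+ j * 'C(k + a, a + j)%:R *
      \sum_(i < (k - j).+1) (1 ^+ (k - j - i) * (-1) ^+ i) *+ 'C(k - j, i) : K).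
    rewrite mulr_sumr; apply: eq_bigr => i _.
    have ikj : (i <= k - j)%N by rewrite -ltnS.
    rewrite bin_mul_bin; [|lia|lia].
    have -> : (k + a - (a + j) = k - j)%N by lia.
    have -> : (i + j + a - (a + j) = i)%N by lia.
    by rewrite expr1n mul1r exprD natrM -[_ *+ 'C(_, _)]mulr_natr; ring.
  rewrite -exprDn subrr; case: eqVneq => [->|jk'].
    by rewrite subnn expr0 mulr1 addnC binn mulr1.
  by rewrite expr0n subn_eq0 leqNgt ltn_neqAle jk' jk/= mulr0.
rewrite (bigD1 ord_max)//= inner// eqxx big1 ?addr0.
  by rewrite mulrAC -exprMn mulrN1.
move=> j jk; rewrite inner; last by rewrite -ltnS.
have /negbTE -> : (j : nat) != k; last by rewrite mulr0.
by apply: contra jk => /eqP e; apply/eqP/val_inj.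
Qed.

End laguerre_minus.

Section homogeneous_coefficients.
Variable (K : numFieldType).

(** A sum over the exponents of degree k is the coefficient of degree k in a
    product of one-variable polynomials; the identities below become
    inductions on the number of variables. *)
Definition hpoly k (u : nat -> K) : {poly K} := \poly_(a < k.+1) u a.

Lemma coef_hpoly k u i : (i <= k)%N -> (hpoly k u)`_i = u i.
Proof. by move=> ik; rewrite coef_poly ltnS ik. Qed.

Lemma coef_prod_hpoly n k (u : 'I_n -> nat -> K) :
  (\prod_(j < n) hpoly k (u j))`_k =
  \sum_(alpha <- box n k.+1 | mdeg alpha == k) \prod_(j < n) u j (alpha j).
Proof.
under eq_bigr do rewrite /hpoly poly_def.
rewrite -(sum_box_prod k.+1 (fun j a => u j a *: 'X^a)) coef_sum [RHS]big_mkcond.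
apply: eq_bigr => alpha _; rewrite scaler_prod prodrXr coefZ coefXn eq_sym /mdeg.
by case: eqP => _; rewrite ?mulr1 ?mulr0.
Qed.

Lemma sum_multinomial n k (x : 'I_n -> K) :
  \sum_(alpha <- box n k.+1 | mdeg alpha == k)
    \prod_(j < n) (x j ^+ alpha j / (alpha j)`!%:R) =
  (\sum_(j < n) x j) ^+ k / k`!%:R.
Proof.
rewrite -(coef_prod_hpoly k (fun j a => x j ^+ a / a`!%:R)).
suff H : forall i, (i <= k)%N ->
    (\prod_(j < n) hpoly k (fun a => x j ^+ a / a`!%:R))`_i =
    (\sum_(j < n) x j) ^+ i / i`!%:R by exact: H.
elim: (index_enum _) => [|j s IH] i ik.
  rewrite !big_nil coef1 expr0n; case: eqP => [->|_]; last by rewrite mul0r.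
  by rewrite fact0 divr1.
rewrite !big_cons coefM exprD_fact; apply: eq_bigr => l _.
rewrite coef_hpoly; last by rewrite (leq_trans _ ik)// -ltnS.
by rewrite IH// (leq_trans _ ik)// leq_subr.
Qed.

Lemma sum_mdeg1 n k : (0 < n)%N ->
  \sum_(alpha <- box n k.+1 | mdeg alpha == k) (1 : K) = 'C(k + n.-1, n.-1)%:R.
Proof.
case: n => // n _.
transitivity (\sum_(alpha <- box n.+1 k.+1 | mdeg alpha == k) \prod_(j < n.+1) (1 : K)).
  by apply: eq_bigr => alpha _; rewrite big1.
rewrite -(coef_prod_hpoly k (fun _ _ => 1)) prodr_const card_ord /=.
suff H : forall i, (i <= k)%N -> (hpoly k (fun=> 1) ^+ n.+1)`_i = 'C(i + n, n)%:R.
  exact: H.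
elim: n => [|n IH] i ik; first by rewrite expr1 coef_hpoly// bin0.
rewrite exprSr coefM -sum_bin_col natr_sum; apply: eq_bigr => l _.
have li : (l <= i)%N by rewrite -ltnS.
by rewrite IH ?(leq_trans li ik)// coef_hpoly ?mulr1// (leq_trans _ ik)// leq_subr.
Qed.

Lemma sum_lagm n k (y : 'I_n -> K) : (0 < n)%N ->
  \sum_(alpha <- box n k.+1 | mdeg alpha == k) \prod_(j < n) lagm 0 (alpha j) (y j) =
  lagm n.-1 k (\sum_(j < n) y j).
Proof.
move=> n0; rewrite -(coef_prod_hpoly k (fun j a => lagm 0 a (y j))).
suff H : forall m (s : seq 'I_n), size s = m.+1 -> forall i, (i <= k)%N ->
    (\prod_(j <- s) hpoly k (fun a => lagm 0 a (y j)))`_i =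
    lagm m i (\sum_(j <- s) y j).
  apply: H => //; rewrite /index_enum -enumT.
  by rewrite size_enum_ord prednK.
elim=> [|m IH] [//|j s] [ss] i ik.
  by move/size0nil : ss => ->; rewrite !big_seq1 coef_hpoly.
rewrite !big_cons coefM -lagmD; apply: eq_bigr => l _.
have li : (l <= i)%N by rewrite -ltnS.
by rewrite coef_hpoly ?(leq_trans li ik)// IH// (leq_trans _ ik)// leq_subr.
Qed.

End homogeneous_coefficients.

(** * Noncentral Gaussian moments in the plane *)

Section plane_orthogonality.
Variable R : realType.
Local Notation mR := (measurableTypeR R).
Local Notation X := (mR * mR)%type.
Local Notation leb := (@lebesgue_measure R).
Local Notation leb2 := (prod_measure leb leb).
Local Notation normc := (@Normc.normc R).

Definition cplx (x : X) : R[i] := x.1 +i* x.2.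

Lemma cmeas_cplx : cmeas cplx.
Proof.
by split => /=; [exact: measurable_fst|exact: measurable_snd].
Qed.

Lemma normc_cplx x : normc (cplx x) ^+ 2 = sq2 x.
Proof. by rewrite normc_sqr. Qed.

Definition pmono (b : R) p q x : R[i] :=
  cplx x ^+ p * (cplx x)^* ^+ q * (expR (- (b * sq2 x)))%:C.

Lemma cmeas_pmono b p q : cmeas (pmono b p q).
Proof.
apply: cmeasM; last first.
  apply: cmeas_real; have := measurable_moment b 0.
  by under eq_fun do rewrite expr0 mul1r.
by apply: cmeasM; apply: cmeasX; [exact: cmeas_cplx|apply: cmeasJ; exact: cmeas_cplx].
Qed.

Lemma integrable_moment b k : 0 < b ->
  leb2.-integrable setT (fun x => (sq2 x ^+ k * expR (- (b * sq2 x)))%:E).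
Proof.
move=> b0; apply/integrableP; split.
  by apply/measurable_EFinP; exact: measurable_moment.
under eq_integral do rewrite gee0_abs ?lee_fin ?mulr_ge0 ?expR_ge0 ?exprn_ge0 ?sq2_ge0//.
by rewrite integral_moment// ltry.
Qed.

Lemma cintegrable_pmono b p q : 0 < b -> cintegrable leb2 (pmono b p q).
Proof.
move=> b0; apply: (@cintegrable_dom _ _ _ _ _ (fun x =>
  sq2 x ^+ p * expR (- (b * sq2 x)) + sq2 x ^+ q * expR (- (b * sq2 x)))).
- exact: cmeas_pmono.
- move=> x; rewrite !normcM !normcX normcJ normc_real ger0_norm ?expR_ge0//.
  rewrite -mulrDl ler_wpM2r ?expR_ge0// -!normc_cplx.
  rewrite -!exprM ![(2 * _)%N]mulnC !exprM.
  have := sqr_ge0 (normc (cplx x) ^+ p - normc (cplx x) ^+ q).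
  set u := _ ^+ p; set v := _ ^+ q.
  have := sqr_ge0 u; have := sqr_ge0 v; nra.
- by under eq_fun do rewrite EFinD; apply: integrableD => //; exact: integrable_moment.
Qed.

(** Off the diagonal, a rotation multiplies the integral by a number different
    from 1; on the diagonal it is a radial moment. *)
Lemma cI_pmono b p q : 0 < b -> cI leb2 (pmono b p q) =
  if p == q then (pi * p`!%:R / b ^+ p.+1)%:C else 0.
Proof.
move=> b0; case: eqVneq => [<-|pq].
  rewrite [X in cI _ X](_ : _ = fun x => (sq2 x ^+ p * expR (- (b * sq2 x)))%:C).
    by rewrite cI_real /Rintegral integral_moment.
  apply/funext => x; rewrite /pmono -exprMn mulJ_normc normc_cplx.
  by rewrite -rmorphXn -rmorphM.
have [c [s [cs s0 u1]]] := unit_power_neq1 R pq.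
set k := _ * _ in u1.
have E : cI leb2 (pmono b p q) = k * cI leb2 (pmono b p q).
  rewrite -[LHS](cI_mpres (mpres_rot2 cs s0) (cmeas_pmono b p q)).
  rewrite -[RHS]cI_Z; last exact: cintegrable_pmono.
  congr cI; apply/funext => x; rewrite /pmono.
  have -> : cplx (rot2 c s x) = (c +i* s) * cplx x.
    by apply: complex_eqP => /=; ring.
  have -> : sq2 (rot2 c s x) = sq2 x.
    by rewrite -[RHS]mul1r -cs /sq2 /=; ring.
  by rewrite conjM !exprMn /k; ring.
apply/eqP; have := subrr (cI leb2 (pmono b p q)); rewrite {1}E => /eqP.
rewrite -[X in _ - X]mul1r -mulrBl mulf_eq0 => /orP[|//].
by rewrite subr_eq0 (negbTE u1).
Qed.

(** In the expansion of |c + x| ^ (2 a) in powers of x and of its conjugate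
    only the diagonal terms contribute. *)
Lemma integral_noncentral (b : R) (v : R * R) a : 0 < b ->
  (\int[leb2]_x (sq2 (x.1 + v.1, x.2 + v.2) ^+ a * expR (- (b * sq2 x)))%:E =
   (\sum_(p < a.+1) 'C(a, p)%:R ^+ 2 * sq2 v ^+ (a - p) *
      (pi * p`!%:R / b ^+ p.+1))%:E)%E.
Proof.
move=> b0; pose c := cplx v.
pose F x := sq2 (x.1 + v.1, x.2 + v.2) ^+ a * expR (- (b * sq2 x)).
have FE x : (F x)%:C = \sum_(p < a.+1) \sum_(q < a.+1)
    ('C(a, p)%:R * 'C(a, q)%:R * c ^+ (a - p) * c^* ^+ (a - q)) * pmono b p q x.
  rewrite /F; have -> : sq2 (x.1 + v.1, x.2 + v.2) = normc (c + cplx x) ^+ 2.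
    by rewrite normc_sqr /c /cplx /sq2 /=; ring.
  have realE (u e : R) : (u ^+ a * e)%:C = u%:C ^+ a * e%:C by rewrite rmorphM rmorphXn.
  rewrite realE -mulJ_normc exprMn [(c + cplx x)^*]rmorphD/=.
  rewrite !exprDn mulr_suml mulr_suml; apply: eq_bigr => p _.
  rewrite mulr_sumr mulr_suml; apply: eq_bigr => q _.
  rewrite -[X in X * _ * _ = _]mulr_natr -[X in _ * X * _ = _]mulr_natr.
  by rewrite /pmono; ring.
have ipq p q : cintegrable leb2 (fun x =>
    ('C(a, p)%:R * 'C(a, q)%:R * c ^+ (a - p) * c^* ^+ (a - q)) * pmono b p q x).
  by apply: cintegrableZ; exact: cintegrable_pmono.
have iF : cintegrable leb2 (fun x => (F x)%:C).
  rewrite (funext FE); apply: cintegrable_sum => p; apply: cintegrable_sum => q.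
  exact: ipq.
have cF : cI leb2 (fun x => (F x)%:C) =
    (\sum_(p < a.+1) 'C(a, p)%:R ^+ 2 * sq2 v ^+ (a - p) *
      (pi * p`!%:R / b ^+ p.+1))%:C.
  rewrite (funext FE) cI_sum => [|p]; last by apply: cintegrable_sum => q; exact: ipq.
  rewrite rmorph_sum; apply: eq_bigr => p _; rewrite cI_sum => [|q]; last exact: ipq.
  rewrite (bigD1 p)//= big1 ?addr0 => [|q qp]; last first.
    rewrite cI_Z; last exact: cintegrable_pmono.
    by rewrite cI_pmono// eq_sym (negbTE (qp : (q : nat) != p)) mulr0.
  rewrite cI_Z; last exact: cintegrable_pmono.
  rewrite cI_pmono// eqxx [RHS](rmorphM (real_complex R)); congr (_ * _).
  rewrite -mulrA -exprMn mulJ_normc normc_cplx -expr2.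
  by rewrite [RHS](rmorphM (real_complex R)) !rmorphXn rmorph_nat.
have [iFr _] := iF.
have -> : (\int[leb2]_x (F x)%:E = (\int[leb2]_x F x)%:E)%E.
  by rewrite /Rintegral fineK//; exact: integrable_fin_num.
by congr EFin; apply: (@complexI R); rewrite -cF cI_real.
Qed.

(** Completing the square moves the product of the two Gaussians to the
    midpoint of their centres. *)
Lemma integral_two_gauss (v : R * R) a :
  (\int[leb2]_x ((2 * sq2 x) ^+ a / a`!%:R *
     (expR (- sq2 (x.1 - v.1, x.2 - v.2)) * expR (- sq2 x)))%:E =
   (pi / 2 * (expR (- (sq2 v / 2)) * lagm 0 a (sq2 v / 2)))%:E)%E.
Proof.
pose F (x : X) : R := (2 * sq2 x) ^+ a / a`!%:R *
     (expR (- sq2 (x.1 - v.1, x.2 - v.2)) * expR (- sq2 x)).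
(* The midpoint of the centres 0 and v. *)
pose v2 : R * R := (v.1 / 2, v.2 / 2).
have msq (w : R * R) : measurable_fun [set: X] (fun x => sq2 (x.1 + w.1, x.2 + w.2)).
  apply: (@measurableT_comp _ _ _ _ _ _ (@sq2 R : X -> R)); first exact: measurable_sq2.
  by case: (mpres_translation2 w).
have mF : measurable_fun setT (fun x => (F x)%:E).
  apply/measurable_EFinP; apply: measurable_funM.
    apply: measurable_funM => //; apply: measurable_funX.
    by apply: measurable_funM => //; exact: measurable_sq2.
  apply: measurable_funM; apply: measurableT_comp => //; apply: measurable_funN.
    exact: (msq (- v.1, - v.2)).
  exact: measurable_sq2.
have F0 x : (0 <= (F x)%:E)%E.
  by rewrite lee_fin !mulr_ge0 ?expR_ge0 ?invr_ge0 ?exprn_ge0 ?mulr_ge0 ?sq2_ge0.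
rewrite -[LHS](ge0_integral_mpres (mpres_translation2 v2) mF F0).
pose c : R := 2 ^+ a / a`!%:R * expR (- (sq2 v / 2)).
have c0 : 0 <= c by rewrite mulr_ge0 ?expR_ge0// divr_ge0 ?exprn_ge0.
transitivity (\int[leb2]_x (c%:E *
    (sq2 (x.1 + v2.1, x.2 + v2.2) ^+ a * expR (- (2 * sq2 x)))%:E))%E.
  apply: eq_integral => x _; rewrite -EFinM; congr EFin; rewrite /F /= -expRD.
  have -> : - sq2 (x.1 + v.1 / 2 - v.1, x.2 + v.2 / 2 - v.2) -
      sq2 (x.1 + v.1 / 2, x.2 + v.2 / 2) = - (sq2 v / 2) + - (2 * sq2 x).
    by rewrite /sq2 /=; field.
  by rewrite expRD /c exprMn; ring.
rewrite ge0_integralZl//; last 2 first.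
- apply/measurable_EFinP; apply: measurable_funM.
    by apply: measurable_funX; exact: msq.
  apply: measurableT_comp => //; apply: measurable_funN; apply: measurable_funM => //.
  exact: measurable_sq2.
- by move=> x _; rewrite lee_fin mulr_ge0 ?expR_ge0// exprn_ge0// sq2_ge0.
rewrite integral_noncentral// -EFinM; congr EFin.
rewrite /c [RHS]mulrCA -[LHS]mulrA [LHS]mulrCA; congr (_ * _).
rewrite /lagm mulr_sumr mulr_sumr; rewrite -(big_mkord xpredT (fun p => 2 ^+ a / a`!%:R *
   ('C(a, p)%:R ^+ 2 * sq2 v2 ^+ (a - p) * (pi * p`!%:R / 2 ^+ p.+1)))).
rewrite big_nat_rev big_mkord; apply: eq_bigr => j _.
have ja : (j <= a)%N by rewrite -ltnS.
rewrite add0n subSS subKn// addn0 add0n bin_sub//.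
have -> : sq2 v2 = sq2 v / 2 / 2 by rewrite /sq2 /v2 /=; field.
have f0 k : k`!%:R != 0 :> R by rewrite pnatr_eq0 -lt0n fact_gt0.
have /(congr1 (fun k => k%:R : R)) := bin_fact ja; rewrite !natrM => E.
have -> : (2 ^+ a : R) = 2 ^+ j * 2 ^+ (a - j) by rewrite -exprD subnKC.
rewrite [(sq2 v / 2 / 2) ^+ j]exprMn exprVn [2 ^+ (a - j).+1]exprS -E.
have C0 : 'C(a, j)%:R != 0 :> R by rewrite pnatr_eq0 -lt0n bin_gt0.
have p0 k : (2 : R) ^+ k != 0 by rewrite expf_neq0.
move: (pi) ('C(a, j)%:R) C0 (j`!%:R) (f0 j) ((a - j)`!%:R) (f0 (a - j)%N).
move: (2 ^+ j) (p0 j) (2 ^+ (a - j)) (p0 (a - j)%N) ((sq2 v / 2) ^+ j).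
move=> A A0 B B0 y q C C0 f f0' g g0; field.
by rewrite A0 B0 C0 f0' g0.
Qed.

End plane_orthogonality.

(** * The heat kernel against Laguerre functions *)

Section gaussian_convolution.
Variables (R : realType) (n : nat).
Local Notation mR := (measurableTypeR R).
Local Notation X := (mR * mR)%type.
Local Notation leb := (@lebesgue_measure R).
Local Notation leb2 := (prod_measure leb leb).
Local Notation L := (@lebesgueC R n).
Local Notation normc := (@Normc.normc R).
Local Notation half p := (sqnorm (cvec p) / 2).
Implicit Types (p v w : n.-tuple X) (j : 'I_n).

Lemma sqnorm_ge0 p : 0 <= sqnorm (cvec p).
Proof. by rewrite sqnorm_cvec sumr_ge0// => j _; rewrite sqr_ge0. Qed.

Definition gap v w : R := sqnorm (cvec w - cvec v).

Lemma gapE v w : gap v w =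
  \sum_(j < n) sq2 ((tnth w j).1 - (tnth v j).1, (tnth w j).2 - (tnth v j).2).
Proof. by apply: eq_bigr => j _; rewrite normc_sqr !mxE. Qed.

(** The parallelogram law. It bounds the Gaussian centred at w by a multiple,
    depending on w, of the Gaussian of gd. *)
Lemma half_sqnorm_le_gap v w : half v <= gap v w + sqnorm (cvec w).
Proof.
rewrite gapE !sqnorm_cvec mulr_suml -big_split/=; apply: ler_sum => j _.
rewrite !normc_coord /sq2 /=.
have := sqr_ge0 ((tnth v j).1 - 2 * (tnth w j).1).
have := sqr_ge0 ((tnth v j).2 - 2 * (tnth w j).2); nra.
Qed.

Lemma measurable_gap :
  measurable_fun setT (fun x : n.-tuple X * n.-tuple X => gap x.1 x.2).
Proof.
under eq_fun do rewrite gapE.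
have mt j : measurable_fun setT (fun x : n.-tuple X * n.-tuple X => tnth x.1 j).
  exact: (measurableT_comp (measurable_tnth j) measurable_fst).
have mt' j : measurable_fun setT (fun x : n.-tuple X * n.-tuple X => tnth x.2 j).
  exact: (measurableT_comp (measurable_tnth j) measurable_snd).
apply: measurable_sum => j; rewrite /sq2 /=; apply: measurable_funD;
  apply: measurable_funX; apply: measurable_funB.
- exact: (measurableT_comp measurable_fst (mt' j)).
- exact: (measurableT_comp measurable_fst (mt j)).
- exact: (measurableT_comp measurable_snd (mt' j)).
- exact: (measurableT_comp measurable_snd (mt j)).
Qed.

Lemma measurable_gapr v : measurable_fun setT (gap v).
Proof.
have mv : measurable_fun setT (fun w => (v, w)) by exact: measurable_pair1.
exact: (measurableT_comp measurable_gap mv).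
Qed.

Lemma measurable_gapl w : measurable_fun setT (gap^~ w).
Proof.
have mv : measurable_fun setT (fun v => (v, w)) by exact: measurable_pair2.
exact: (measurableT_comp measurable_gap mv).
Qed.

Definition gap_moment i v w : R :=
  (2 * sqnorm (cvec w)) ^+ i / i`!%:R * (expR (- gap v w) * expR (- sqnorm (cvec w))).

Lemma gap_moment_ge0 i v w : 0 <= gap_moment i v w.
Proof.
apply: mulr_ge0; last by apply: mulr_ge0; exact: expR_ge0.
apply: divr_ge0 => //; apply: exprn_ge0; apply: mulr_ge0 => //; exact: sqnorm_ge0.
Qed.

Lemma measurable_gap_moment i v : measurable_fun setT (gap_moment i v).
Proof.
apply: measurable_funM.
  apply: measurable_funM => //; apply: measurable_funX.
  by apply: measurable_funM => //; exact: measurable_sqnorm_cvec.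
apply: measurable_funM; apply: measurableT_comp => //; apply: measurable_funN.
  exact: measurable_gapr.
exact: measurable_sqnorm_cvec.
Qed.

(** The multinomial theorem splits the power of the norm into products over
    the coordinates, integral_two_gauss evaluates the factors, and sum_lagm
    reassembles them. *)
Lemma integral_gap_moment i v : (0 < n)%N ->
  (\int[L]_w (gap_moment i v w)%:E =
   ((pi / 2) ^+ n * (expR (- half v) * lagm n.-1 i (half v)))%:E)%E.
Proof.
move=> n0.
pose f (a : nat) j (x : X) : R := (2 * sq2 x) ^+ a / a`!%:R *
  (expR (- sq2 (x.1 - (tnth v j).1, x.2 - (tnth v j).2)) * expR (- sq2 x)).
pose s := [seq alpha <- box n i.+1 | mdeg alpha == i].
have f0 a j x : 0 <= f a j x.
  apply: mulr_ge0; last by apply: mulr_ge0; exact: expR_ge0.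
  apply: divr_ge0 => //; apply: exprn_ge0; apply: mulr_ge0 => //; exact: sq2_ge0.
have mf a j : measurable_fun setT (f a j).
  apply: measurable_funM.
    apply: measurable_funM => //; apply: measurable_funX.
    by apply: measurable_funM => //; exact: measurable_sq2.
  apply: measurable_funM; apply: measurableT_comp => //; apply: measurable_funN.
    apply: (@measurableT_comp _ _ _ _ _ _ (@sq2 R : X -> R)); first exact: measurable_sq2.
    by case: (mpres_translation2 (- (tnth v j).1, - (tnth v j).2)).
  exact: measurable_sq2.
have E w : gap_moment i v w =
    \sum_(alpha <- s) \prod_(j < n) f (alpha j) j (tnth w j).
  rewrite /gap_moment big_filter sqnorm_cvec mulr_sumr -sum_multinomial mulr_suml.
  apply: eq_bigr => alpha _; rewrite gapE -!sumrN.
  rewrite !(big_morph expR (@expRD R) (@expR0 R)) -!big_split/=.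
  by apply: eq_bigr => j _; rewrite normc_coord.
under eq_integral do rewrite E -sumEFin.
rewrite ge0_integral_sum//; last 2 first.
- move=> alpha; apply/measurable_EFinP; apply: measurable_prod => j _.
  exact: (measurableT_comp (mf (alpha j) j) (measurable_tnth j)).
- by move=> alpha x _; rewrite lee_fin; apply: prodr_ge0 => j _; exact: f0.
transitivity (\sum_(alpha <- s) (\prod_(j < n) (pi / 2 *
    (expR (- (sq2 (tnth v j) / 2)) * lagm 0 (alpha j) (sq2 (tnth v j) / 2))))%:E)%E.
  apply: eq_bigr => alpha _.
  rewrite (ge0_integral_power_prod leb2 (f := fun j => f (alpha j) j))//.
  by rewrite -prodEFin; apply: eq_bigr => j _; exact: integral_two_gauss.
rewrite sumEFin; congr EFin; rewrite big_filter.
have -> : half v = \sum_(j < n) sq2 (tnth v j) / 2.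
  by rewrite sqnorm_cvec mulr_suml; apply: eq_bigr => j _; rewrite normc_coord.
rewrite -sum_lagm// -sumrN (big_morph expR (@expRD R) (@expR0 R)).
rewrite mulr_sumr mulr_sumr; apply: eq_bigr => alpha _.
by rewrite big_split prodr_const card_ord; congr (_ * _); rewrite big_split.
Qed.

Lemma integrable_gap_moment i v : (0 < n)%N ->
  L.-integrable setT (fun w => (gap_moment i v w)%:E).
Proof.
move=> n0; apply/integrableP; split.
  by apply/measurable_EFinP; exact: measurable_gap_moment.
under eq_integral do rewrite gee0_abs ?lee_fin ?gap_moment_ge0//.
by rewrite integral_gap_moment// ltry.
Qed.

Lemma laguerre_funE k w : laguerre_fun k (2 *: cvec w) =
  \sum_(i < k.+1) ((-1) ^+ i * 'C(k + n.-1, k - i)%:R) *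
    ((2 * sqnorm (cvec w)) ^+ i / i`!%:R * expR (- sqnorm (cvec w))).
Proof.
have E : sqnorm (2 *: cvec w) = 4 * sqnorm (cvec w).
  rewrite /sqnorm mulr_sumr; apply: eq_bigr => j _; rewrite mxE normcM exprMn.
  by rewrite (_ : normc 2 ^+ 2 = 4)// normc_sqr /=; ring.
rewrite /laguerre_fun E horner_poly mulr_suml subn1.
have -> : 4 * sqnorm (cvec w) / 4 = sqnorm (cvec w) by field.
have -> : 4 * sqnorm (cvec w) / 2 = 2 * sqnorm (cvec w) by field.
by apply: eq_bigr => i _; ring.
Qed.

Lemma measurable_laguerre_fun k :
  measurable_fun setT (fun w : n.-tuple X => laguerre_fun k (2 *: cvec w)).
Proof.
under eq_fun do rewrite laguerre_funE.
apply: measurable_sum => i; apply: measurable_funM => //; apply: measurable_funM.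
  apply: measurable_funM => //; apply: measurable_funX.
  by apply: measurable_funM => //; exact: measurable_sqnorm_cvec.
apply: measurableT_comp => //; apply: measurable_funN.
exact: measurable_sqnorm_cvec.
Qed.

Let lagc k i : R := (-1) ^+ i * 'C(k + n.-1, k - i)%:R.

Let gap_laguerreE k v w : (expR (- gap v w) * laguerre_fun k (2 *: cvec w))%:E =
  (\sum_(i < k.+1) (lagc k i)%:E * (gap_moment i v w)%:E)%E.
Proof.
rewrite laguerre_funE mulr_sumr -sumEFin.
by apply: eq_bigr => i _; rewrite -EFinM /gap_moment /lagc; congr EFin; ring.
Qed.

Lemma integrable_gap_laguerre k v : (0 < n)%N -> L.-integrable setT
  (fun w => (expR (- gap v w) * laguerre_fun k (2 *: cvec w))%:E).
Proof.
move=> n0; rewrite (funext (gap_laguerreE k v)).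
apply: integrable_sum => // i _; apply: integrableZl => //.
exact: integrable_gap_moment.
Qed.

(** The alternating combination of the moments in the Laguerre polynomial
    collapses to a single power of the squared norm, by lagm_inversion. *)
Lemma integral_gap_laguerre k v : (0 < n)%N ->
  (\int[L]_w (expR (- gap v w) * laguerre_fun k (2 *: cvec w))%:E =
   ((pi / 2) ^+ n * (expR (- half v) * ((- half v) ^+ k / k`!%:R)))%:E)%E.
Proof.
move=> n0; under eq_integral do rewrite gap_laguerreE.
rewrite integral_sum//; last first.
  by move=> i; apply: integrableZl => //; exact: integrable_gap_moment.
transitivity (\sum_(i < k.+1) (lagc k i * ((pi / 2) ^+ n *
   (expR (- half v) * lagm n.-1 i (half v))))%:E)%E.
  apply: eq_bigr => i _; rewrite integralZl//; last exact: integrable_gap_moment.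
  by rewrite integral_gap_moment.
rewrite sumEFin -(lagm_inversion n.-1); congr EFin.
by rewrite !mulr_sumr; apply: eq_bigr => i _; rewrite /lagc; ring.
Qed.

Section fubini.
Variable A : n.-tuple X -> R.
Hypothesis mA : measurable_fun setT A.
Hypothesis iA : forall k,
  L.-integrable setT (fun p => (A p * (half p ^+ k / k`!%:R) * gd p)%:E).

Let expR_half p : expR (- half p) = (2 * pi) ^+ n * gd p.
Proof.
rewrite gdE mulrA divff ?mul1r; first by rewrite [_ / 2]mulrC.
by rewrite expf_neq0// mulf_neq0// gt_eqF// pi_gt0.
Qed.

Let integrable_majorant k : L.-integrable setT (fun v => (A v *
  \sum_(i < k.+1) 'C(k + n.-1, k - i)%:R *
    ((pi / 2) ^+ n * (expR (- half v) * lagm n.-1 i (half v))))%:E).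
Proof.
pose b (i j : nat) : R := 'C(k + n.-1, k - i)%:R * ((pi / 2) ^+ n * (2 * pi) ^+ n) *
  'C(i + n.-1, n.-1 + j)%:R.
rewrite [X in _.-integrable _ X](_ : _ = fun v => \sum_(i < k.+1) \sum_(j < i.+1)
   ((b i j)%:E * (A v * (half v ^+ j / j`!%:R) * gd v)%:E))%E; last first.
  apply/funext => v; rewrite mulr_sumr -sumEFin; apply: eq_bigr => i _.
  rewrite /lagm !mulr_sumr -sumEFin; apply: eq_bigr => j _.
  by rewrite -EFinM expR_half /b; congr EFin; ring.
apply: integrable_sum => // i _; apply: integrable_sum => // j _.
by apply: integrableZl => //; exact: iA.
Qed.

Let normr_laguerre k v w : `|expR (- gap v w) * laguerre_fun k (2 *: cvec w)| <=
  \sum_(i < k.+1) 'C(k + n.-1, k - i)%:R * gap_moment i v w.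
Proof.
rewrite laguerre_funE mulr_sumr (le_trans (ler_norm_sum _ _ _))//.
apply: ler_sum => i _; rewrite /gap_moment.
have s0 := sqnorm_ge0 w.
have p0 : 0 <= (2 * sqnorm (cvec w)) ^+ i / i`!%:R.
  by rewrite divr_ge0// exprn_ge0// mulr_ge0.
move: (_ / i`!%:R) p0 => t t0.
rewrite !normrM normr_sign mul1r normr_nat !ger0_norm ?expR_ge0//.
by rewrite le_eqVlt; apply/orP; left; apply/eqP; ring.
Qed.

Let kernel_measurable k : measurable_fun setT (fun x : n.-tuple X * n.-tuple X =>
  (A x.1 * (expR (- gap x.1 x.2) * laguerre_fun k (2 *: cvec x.2)))%:E).
Proof.
apply/measurable_EFinP; apply: measurable_funM.
  exact: (measurableT_comp mA measurable_fst).
apply: measurable_funM.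
  apply: measurableT_comp => //; apply: measurable_funN; exact: measurable_gap.
exact: (measurableT_comp (measurable_laguerre_fun k) measurable_snd).
Qed.

Let kernel_integrable k : (0 < n)%N ->
  (L \x L)%E.-integrable setT (fun x : n.-tuple X * n.-tuple X =>
  (A x.1 * (expR (- gap x.1 x.2) * laguerre_fun k (2 *: cvec x.2)))%:E).
Proof.
move=> n0; apply/(integrable12ltyP L L (kernel_measurable k)).
have /integrableP[mM] := integrable_majorant k; apply: le_lt_trans.
apply: ge0_le_integral => //.
- by move=> v _; exact: integral_ge0.
- apply: (@measurable_fun_fubini_tonelli_F _ _ _ _ _ L (fun x => `|(A x.1 *
    (expR (- gap x.1 x.2) * laguerre_fun k (2 *: cvec x.2)))%:E|%E)) => //.
  by apply: measurableT_comp => //; exact: kernel_measurable.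
- exact: measurableT_comp.
move=> v _; pose b i : R := 'C(k + n.-1, k - i)%:R.
apply: (@le_trans _ _ (\int[L]_w (`|A v|%:E *
    \sum_(i < k.+1) (b i)%:E * (gap_moment i v w)%:E))%E).
  apply: ge0_le_integral => //.
  - apply: measurableT_comp => //.
    have mv : measurable_fun setT (fun w => (v, w)) by exact: measurable_pair1.
    exact: (measurableT_comp (kernel_measurable k) mv).
  - apply: emeasurable_funM => //; apply: emeasurable_sum => i.
    apply: emeasurable_funM => //.
    by apply/measurable_EFinP; exact: measurable_gap_moment.
  move=> w _; rewrite abse_EFin normrM EFinM lee_wpmul2l ?lee_fin//.
  by under eq_bigr do rewrite -EFinM; rewrite sumEFin lee_fin normr_laguerre.
rewrite integralZl//; last first.
  apply: integrable_sum => // i _; apply: integrableZl => //.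
  exact: integrable_gap_moment.
rewrite abse_EFin normrM EFinM lee_wpmul2l ?lee_fin//.
rewrite integral_sum//; last first.
  by move=> i; apply: integrableZl => //; exact: integrable_gap_moment.
apply: (@le_trans _ _ (\sum_(i < k.+1) b i *
    ((pi / 2) ^+ n * (expR (- half v) * lagm n.-1 i (half v))))%:E); last first.
  by rewrite lee_fin ler_norm.
rewrite -sumEFin le_eqVlt; apply/orP; left; apply/eqP.
apply: eq_bigr => i _; rewrite integralZl//; last exact: integrable_gap_moment.
by rewrite integral_gap_moment.
Qed.

Lemma integrable_mul_gap w : L.-integrable setT (fun v => (A v * expR (- gap v w))%:E).
Proof.
(* The power 0 of the hypothesis is the integrability of A for gd. *)
have := iA 0; pose c : R := (2 * pi) ^+ n * expR (sqnorm (cvec w)) => i0.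
apply: (@le_integrable _ _ _ L _ measurableT _
    (fun v => c%:E * (A v * (half v ^+ 0 / 0`!%:R) * gd v)%:E)%E).
- apply/measurable_EFinP; apply: measurable_funM => //.
  by apply: measurableT_comp => //; apply: measurable_funN; exact: measurable_gapl.
- move=> v _; rewrite -EFinM !abse_EFin lee_fin expr0 fact0 divr1 mulr1.
  have -> : c * (A v * gd v) = A v * (expR (- half v) * expR (sqnorm (cvec w))).
    by rewrite expR_half /c; ring.
  rewrite normrM [leRHS]normrM ler_wpM2l// -expRD !ger0_norm ?expR_ge0//.
  by rewrite ler_expR; have := half_sqnorm_le_gap v w; lra.
- exact: integrableZl.
Qed.

(** Fubini brings the integral of integral_gap_laguerre inside. The constants
    are pi ^ (- n) from the heat kernel, (pi / 2) ^ n from the moments and (2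
    pi) ^ n from gd. *)
Lemma Rintegral_heat_laguerre k : (0 < n)%N ->
  \int[L]_w ((\int[L]_v (A v * heat_kernel 4^-1 (cvec w - cvec v))) *
             laguerre_fun k (2 *: cvec w)) =
  (-1) ^+ k * pi ^+ n * \int[L]_v (A v * (half v ^+ k / k`!%:R) * gd v).
Proof.
move=> n0; pose c : R := (pi ^+ n)^-1.
have heatE v w : heat_kernel 4^-1 (cvec w - cvec v) = c * expR (- gap v w).
  rewrite /heat_kernel /c /gap.
  have -> : (4 * pi * 4^-1 : R) = pi by field.
  by rewrite divff// divr1.
pose f (x : n.-tuple X * n.-tuple X) : R :=
  A x.1 * (expR (- gap x.1 x.2) * laguerre_fun k (2 *: cvec x.2)).
have inner w : (\int[L]_v (A v * heat_kernel 4^-1 (cvec w - cvec v))) *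
      laguerre_fun k (2 *: cvec w) = c * \int[L]_v f (v, w).
  have ig := integrable_mul_gap w.
  rewrite /f /=; under [X in _ = _ * X]eq_Rintegral do rewrite mulrA.
  rewrite (RintegralZr _ measurableT ig) [RHS]mulrA; congr (_ * _); rewrite -RintegralZl//.
  by apply: eq_Rintegral => v _; rewrite heatE; ring.
have iw w : L.-integrable setT (fun v => (f (v, w))%:E).
  rewrite /f /=; under eq_fun do rewrite mulrA EFinM.
  by apply: integrableZr => //; exact: integrable_mul_gap.
have iK : (L \x L)%E.-integrable setT (fun x => c%:E * (f x)%:E)%E.
  by apply: integrableZl => //; exact: kernel_integrable.
have i0 := iA k.
rewrite {1}/Rintegral.
transitivity (fine (\int[L]_w \int[L]_v (c%:E * (f (v, w))%:E))%E).
  congr fine; apply: eq_integral => w _; rewrite inner integralZl// EFinM.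
  by rewrite /Rintegral fineK//; exact: integrable_fin_num.
rewrite -(Fubini iK); pose a : R := (-1) ^+ k * pi ^+ n.
transitivity (fine (\int[L]_v (a%:E * (A v * (half v ^+ k / k`!%:R) * gd v)%:E))%E).
  congr fine; apply: eq_integral => v _.
  under eq_integral do rewrite /f /= EFinM.
  have iv := integrable_gap_laguerre k v n0.
  rewrite integralZl//; last exact: integrableZl.
  rewrite integralZl// integral_gap_laguerre// -!EFinM; congr EFin.
  rewrite expR_half exprNn /a /c.
  have -> : (pi / 2) ^+ n = pi ^+ n / 2 ^+ n :> R by rewrite exprMn exprVn.
  rewrite exprMn; have p0 : pi ^+ n != 0 :> R by rewrite expf_neq0// gt_eqF// pi_gt0.
  have t0 : 2 ^+ n != 0 :> R by rewrite expf_neq0.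
  have f0 : k`!%:R != 0 :> R by rewrite pnatr_eq0 -lt0n fact_gt0.
  move: (pi ^+ n) p0 (2 ^+ n) t0 (k`!%:R) f0 => P P0 T T0 K K0.
  by field; rewrite P0 T0 K0.
rewrite integralZl// fineM//; exact: integrable_fin_num.
Qed.

End fubini.

End gaussian_convolution.

(** * The averages of a radial symbol *)

Section radial_convolution.
Variables (R : realType) (n : nat).
Local Notation mR := (measurableTypeR R).
Local Notation X := (mR * mR)%type.
Local Notation L := (@lebesgueC R n).
Local Notation normc := (@Normc.normc R).
Local Notation half p := (sqnorm (cvec p) / 2).
Implicit Types (p v w : n.-tuple X) (alpha : {ffun 'I_n -> nat}).

(** The multinomial theorem; it recognises the powers left by the Laguerre
    function as the diagonal of the reproducing kernel, degree by degree. *)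
Lemma sum_zeta_sqr k p :
  \sum_(alpha <- box n k.+1 | mdeg alpha == k)
    zeta alpha (cvec p) * (zeta alpha (cvec p))^* = (half p ^+ k / k`!%:R)%:C.
Proof.
have -> : half p = \sum_(j < n) sq2 (tnth p j) / 2.
  by rewrite sqnorm_cvec mulr_suml; apply: eq_bigr => j _; rewrite normc_coord.
rewrite -sum_multinomial rmorph_sum; apply: eq_bigr => alpha _.
rewrite mulJ_normc; congr (_%:C).
rewrite zetaE normcM exprMn normc_real real_normK ?num_real// zeta_coef_sqr.
rewrite /mono normc_prod -prodrXl -big_split/=; apply: eq_bigr => j _.
by rewrite normcX -exprM mulnC exprM normc_coord invfM exprMn exprVn mulrA.
Qed.

Variable h : n.-tuple X -> R[i].
Hypothesis hP : radial_symbol h.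

(** The eigenvalue of the Toeplitz operator on the monomials of degree k. *)
Definition eigen (i : 'I_n) k : R[i] := level h i k / 2 ^+ k.

Let mh : cmeas h. Proof. by case: hP. Qed.

Lemma sqint_radial_zeta alpha : sqint (fun p => h p * zeta alpha (cvec p)).
Proof.
have [_ _ /(_ alpha) /(sqintZ (zeta_coef R alpha)%:C)] := hP.
have -> : (fun p => (zeta_coef R alpha)%:C * (h p * mono alpha p)) =
    (fun p => h p * zeta alpha (cvec p)); last by [].
by apply/funext => p; rewrite zetaE; ring.
Qed.

Let term alpha p :=
  (h p * zeta alpha (cvec p)) * (zeta alpha (cvec p))^* * (gd p)%:C.

Let cintegrable_term alpha : cintegrable L (term alpha).
Proof.
apply: cintegrable_coef; last exact: sqint_radial_zeta.
by apply: cmeasM => //; exact: cmeas_zeta.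
Qed.

Let radial_powerE k p : h p * (half p ^+ k / k`!%:R)%:C * (gd p)%:C =
  \sum_(alpha <- [seq alpha <- box n k.+1 | mdeg alpha == k]) term alpha p.
Proof.
rewrite -sum_zeta_sqr big_filter mulr_sumr mulr_suml.
by apply: eq_bigr => alpha _; rewrite /term mulrA.
Qed.

Lemma cintegrable_radial_power k :
  cintegrable L (fun p => h p * (half p ^+ k / k`!%:R)%:C * (gd p)%:C).
Proof.
rewrite (funext (radial_powerE k)).
by apply: cintegrable_sum => alpha; exact: cintegrable_term.
Qed.

(** By sum_zeta_sqr the integral is the sum of the diagonal coefficients of
    degree k. They are all equal, and the binomial coefficient is their
    number. *)
Lemma cI_radial_power i k :
  cI L (fun p => h p * (half p ^+ k / k`!%:R)%:C * (gd p)%:C) =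
  'C(k + n.-1, n.-1)%:R * eigen i k.
Proof.
have n0 : (0 < n)%N by case: i => i; exact: leq_ltn_trans.
rewrite (funext (radial_powerE k)) cI_sum//.
rewrite -sum_mdeg1// mulr_suml big_filter.
apply: eq_bigr => alpha /eqP alphak; rewrite mul1r.
have := coef_radial i alpha alpha hP; rewrite eqxx /eigen -alphak.
by [].
Qed.

Lemma cI_heat_laguerre i k :
  cI L (fun w => cI L (fun v => h v * (heat_kernel 4^-1 (cvec w - cvec v))%:C) *
                 (laguerre_fun k (2 *: cvec w))%:C) =
  ((-1) ^+ k * pi ^+ n)%:C * ('C(k + n.-1, n.-1)%:R * eigen i k).
Proof.
have n0 : (0 < n)%N by case: i => i; exact: leq_ltn_trans.
rewrite -cI_radial_power.
have ReMr (z : R[i]) (x : R) : complex.Re (z * x%:C) = complex.Re z * x.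
  by rewrite ReM /= mulr0 subr0.
have ImMr (z : R[i]) (x : R) : complex.Im (z * x%:C) = complex.Im z * x.
  by rewrite ImM /= mulr0 add0r.
have [mre mim] := mh.
have ire k' : L.-integrable setT
    (fun p => (complex.Re (h p) * (half p ^+ k' / k'`!%:R) * gd p)%:E).
  have [+ _] := cintegrable_radial_power k'.
  by under eq_fun do rewrite !ReMr.
have iim k' : L.-integrable setT
    (fun p => (complex.Im (h p) * (half p ^+ k' / k'`!%:R) * gd p)%:E).
  have [_] := cintegrable_radial_power k'.
  by under eq_fun do rewrite !ImMr.
apply: complex_eqP; rewrite [in RHS]mulrC (ReMr, ImMr) [RHS]mulrC.
- transitivity (\int[L]_w ((\int[L]_v (complex.Re (h v) *
    heat_kernel 4^-1 (cvec w - cvec v))) * laguerre_fun k (2 *: cvec w))).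
    apply: eq_Rintegral => w _; rewrite ReMr; congr (_ * _).
    by apply: eq_Rintegral => v _; rewrite ReMr.
  rewrite Rintegral_heat_laguerre//; congr (_ * _).
  by apply: eq_Rintegral => v _; rewrite !ReMr.
- transitivity (\int[L]_w ((\int[L]_v (complex.Im (h v) *
    heat_kernel 4^-1 (cvec w - cvec v))) * laguerre_fun k (2 *: cvec w))).
    apply: eq_Rintegral => w _; rewrite ImMr; congr (_ * _).
    by apply: eq_Rintegral => v _; rewrite ImMr.
  rewrite Rintegral_heat_laguerre//; congr (_ * _).
  by apply: eq_Rintegral => v _; rewrite !ImMr.
Qed.

End radial_convolution.

(** * Diagonal operators on the Fock space *)

Section diagonal_operator.
Variables (R : realType) (n : nat).
Local Notation mR := (measurableTypeR R).
Local Notation X := (mR * mR)%type.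
Local Notation L := (@lebesgueC R n).
Local Notation normc := (@Normc.normc R).
Implicit Types (f : 'rV[R[i]]_n -> R[i]) (F : n.-tuple X -> R[i]).
Implicit Types (d : {ffun 'I_n -> nat} -> R[i]) (alpha : {ffun 'I_n -> nat}).

Lemma coef_ae F G alpha : cmeas G -> {ae L, forall p, F p = G p} ->
  coef F alpha = coef G alpha.
Proof.
move=> mG FG; apply: cI_ae.
  apply: cmeasM; last exact: cmeas_gd.
  by apply: cmeasM => //; apply: cmeasJ; exact: cmeas_zeta.
by apply: filterS FG => p ->.
Qed.

Lemma normc_coef_le F alpha : cmeas F -> sqint F ->
  normc (coef F alpha) <= Num.sqrt (nrm2 F).
Proof.
move=> mF sF; have := bessel (s := [:: alpha]) isT mF sF.
rewrite big_seq1 => le; rewrite -(ler_pXn2r (n := 2))// ?nnegrE ?sqrtr_ge0//.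
by rewrite [leRHS]sqr_sqrtr; [exact: le|exact: nrm2_ge0].
Qed.

Lemma cmeas_fser d (B : R) : 0 <= B -> (forall alpha, normc (d alpha) <= B) ->
  cmeas (fun p : n.-tuple X => fser d (cvec p)).
Proof.
move=> B0 dB; apply: (@cmeas_cvg _ _ _ (fun N p => zsum (box n N) d (cvec p))).
  by move=> N; exact: cmeas_zsum.
by move=> p; exact: fser_cvg B0 dB.
Qed.

(** Fatou's lemma along the boxes. *)
Lemma le_integral_fser d (B C : R) : 0 <= B ->
  (forall alpha, normc (d alpha) <= B) ->
  (forall N, \sum_(alpha <- box n N) normc (d alpha) ^+ 2 <= C) ->
  (\int[L]_p (normc (fser d (cvec p)) ^+ 2 * gd p)%:E <= C%:E)%E.
Proof.
move=> B0 dB dC.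
pose u N p : \bar R := (normc (zsum (box n N) d (cvec p)) ^+ 2 * gd p)%:E.
have mu N : measurable_fun setT (u N).
  by apply/measurable_EFinP; apply: measurable_sq; exact: cmeas_zsum.
have u0 N p : setT p -> (0 <= u N p)%E 
  by move=> _; rewrite lee_fin; exact: (sq_gd_ge0 (fun p => zsum _ d (cvec p))).
have uE p : limn_einf (u^~ p) = (normc (fser d (cvec p)) ^+ 2 * gd p)%:E.
  have cu : u^~ p @ \oo --> (normc (fser d (cvec p)) ^+ 2 * gd p)%:E.
    apply: cvg_EFin; first by near=> N.
    apply: cvgM; last exact: cvg_cst.
    rewrite expr2; under eq_fun do rewrite /= expr2.
    by apply: cvgM; apply: cvgC_norm; exact: fser_cvg B0 dB.
  rewrite is_cvg_limn_einfE; last by apply/cvg_ex; eexists; exact: cu.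
  exact/cvg_lim.
under eq_integral do rewrite -uE.
apply: (le_trans (fatou L measurableT mu u0)).
have uC N : (\int[L]_p u N p <= C%:E)%E.
  have := nrm2_zsum d (box_uniq n N); rewrite /nrm2 => E.
  have iu : L.-integrable setT (u N) by exact: sqint_zsum.
  rewrite -[leLHS]fineK; last exact: integrable_fin_num.
  by rewrite lee_fin [leLHS]E.
rewrite limn_einf_lim; apply: lime_le; first exact: is_cvg_einfs.
by apply: nearW => N; apply: le_trans (uC N); apply: ereal_inf_lbound; exists N => /=.
Unshelve. all: by end_near. Qed.

(** Members of L ^ 2 are only Lebesgue measurable; their norm and coefficients
    are computed on a Borel function that agrees with them almost everywhere.
    *)
Lemma in_L2_borel f : in_L2 f -> exists2 F : n.-tuple X -> R[i],
  [/\ cmeas F, sqint F & {ae L, forall p, f (cvec p) = F p}] &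
  L2norm f = Num.sqrt (nrm2 F).
Proof.
move=> [[h mh fh] foo].
have E : sq_L2norm f = (\int[L]_p (normc (h (cvec p)) ^+ 2 * gd p)%:E)%E.
  apply: ge0_integral_ae.
  - by move=> p; rewrite lee_fin; exact: (sq_gd_ge0 (fun p => f (cvec p))).
  - by move=> p; rewrite lee_fin; exact: (sq_gd_ge0 (fun p => h (cvec p))).
  - by apply/measurable_EFinP; exact: measurable_sq.
  - by apply: filterS fh => p ->.
exists (fun p => h (cvec p)); last by rewrite /L2norm E.
by split => //; apply: sqintP => //; rewrite -E.
Qed.

End diagonal_operator.

Section fock_series.
Variables (R : realType) (n : nat).
Local Notation mR := (measurableTypeR R).
Local Notation X := (mR * mR)%type.
Local Notation normc := (@Normc.normc R).
Implicit Types (f : 'rV[R[i]]_n -> R[i]) (F : n.-tuple X -> R[i]).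
Implicit Types (d : {ffun 'I_n -> nat} -> R[i]) (alpha : {ffun 'I_n -> nat}).

Lemma fserD d e (a : R[i]) (B C : R) z : 0 <= B -> 0 <= C ->
  (forall alpha, normc (d alpha) <= B) -> (forall alpha, normc (e alpha) <= C) ->
  fser (fun alpha => a * d alpha + e alpha) z = a * fser d z + fser e z.
Proof.
move=> B0 C0 dB eC; apply: climitE.
rewrite [X in cvgC X _](_ : _ =
    fun N => a * zsum (box n N) d z + zsum (box n N) e z); last first.
  apply/funext => N; rewrite /zsum mulr_sumr -big_split; apply: eq_bigr => alpha _.
  by rewrite mulrDl mulrA.
apply: cvgCD; last exact: fser_cvg C0 eC.
by apply: cvgCM; [exact: cvgC_cst|exact: fser_cvg B0 dB].
Qed.

(** The truncations are constant as soon as the box contains alpha. *)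
Lemma fser_delta (c : R[i]) alpha z :
  fser (fun beta => if alpha == beta then c else 0) z = c * zeta alpha z.
Proof.
apply: climitE; pose N0 := (mdeg alpha).+1.
have E N : (N0 <= N)%N -> zsum (box n N)
    (fun beta => if alpha == beta then c else 0) z = c * zeta alpha z.
  move=> N0N; rewrite /zsum (bigD1_seq alpha) ?box_uniq//=; last first.
    rewrite mem_box; apply/forallP => j; apply: leq_trans N0N; rewrite ltnS.
    by rewrite /mdeg (bigD1 j)//= leq_addr.
  rewrite eqxx big1 ?addr0// => beta; rewrite eq_sym => /negbTE ->.
  by rewrite mul0r.
split; apply: cvg_near_cst; near=> N; rewrite E//; near: N; exact: nbhs_infty_ge.
Unshelve. all: by end_near. Qed.

Lemma fock_fser d (B C : R) : 0 <= B -> (forall alpha, normc (d alpha) <= B) ->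
  (forall N, \sum_(alpha <- box n N) normc (d alpha) ^+ 2 <= C) -> fock (fser d).
Proof.
move=> B0 dB dC; split; first exact: fser_entire B0 dB.
split; first by exists (fser d); [exact: cmeas_fser B0 dB|exact: nearW].
by apply: le_lt_trans (le_integral_fser B0 dB dC) _; rewrite ltry.
Qed.

Lemma L2norm_fser d (B C : R) : 0 <= B -> (forall alpha, normc (d alpha) <= B) ->
  (forall N, \sum_(alpha <- box n N) normc (d alpha) ^+ 2 <= C) ->
  L2norm (fser d) <= Num.sqrt C.
Proof.
move=> B0 dB dC; have le := le_integral_fser B0 dB dC.
have C0 : 0 <= C by apply: le_trans (dC 0%N); apply: sumr_ge0 => alpha _; exact: sqr_ge0.
rewrite /L2norm ler_sqrt//.
have ge : (0 <= sq_L2norm (fser d))%E.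
  by apply: integral_ge0 => p _; rewrite lee_fin;
    exact: (sq_gd_ge0 (fun p => fser d (cvec p))).
rewrite -lee_fin fineK// ge0_fin_numE//.
exact: le_lt_trans le (ltry _).
Qed.

Lemma L2norm_zeta (c : R[i]) alpha : L2norm (fun z => c * zeta alpha z) = normc c.
Proof.
have := nrm2_zsum (fun=> c) (s := [:: alpha]) isT; rewrite big_seq1 => E.
rewrite -[RHS]ger0_norm// -sqrtr_sqr -E; congr (Num.sqrt (fine _)).
by apply: eq_integral => p _; rewrite /zsum big_seq1.
Qed.

Lemma fock_zeta alpha : fock (zeta (R := R) alpha).
Proof.
have -> : zeta (R := R) alpha = fser (fun beta => if alpha == beta then 1 else 0).
  by apply/funext => z; rewrite fser_delta mul1r.
have le1 beta : normc (if alpha == beta then 1 else 0 : R[i]) <= 1.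
  by case: ifP => _; rewrite normc_real ?normr1 ?normr0.
apply: (fock_fser (B := 1) (C := 1)) => // N.
have /le_trans : \sum_(beta <- box n N) normc (if alpha == beta then 1 else 0 : R[i]) ^+ 2
    <= \sum_(beta <- box n N | beta == alpha) 1.
  rewrite [leRHS]big_mkcond; apply: ler_sum => beta _.
  by rewrite eq_sym; case: ifP => _; rewrite normc_real ?normr1 ?normr0 ?expr1n ?expr0n.
apply; rewrite big_const_seq iter_addr_0 lern1.
by rewrite count_uniq_mem ?box_uniq// leq_b1.
Qed.

Definition diag (lambda : nat -> R[i]) f : 'rV[R[i]]_n -> R[i] :=
  fser (fun alpha => lambda (mdeg alpha) * coef (fun p => f (cvec p)) alpha).

(** Bounded coefficients make the series entire, and Bessel's inequality
    bounds its norm by B times the norm of f. *)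
Lemma diag_bounded (lambda : nat -> R[i]) (B : R) :
  (forall k, normc (lambda k) <= B) -> fock_bounded_operator (diag lambda).
Proof.
move=> lB; have B0 : 0 <= B := le_trans (normc_ge0 _) (lB 0%N).
pose d f alpha := lambda (mdeg alpha) * coef (fun p => f (cvec p)) alpha.
have key f : fock f -> [/\ L2norm f = Num.sqrt (L2norm f ^+ 2),
    forall alpha, normc (d f alpha) <= B * L2norm f &
    forall N, \sum_(alpha <- box n N) normc (d f alpha) ^+ 2 <= B ^+ 2 * L2norm f ^+ 2].
  move=> [_ /in_L2_borel[F [mF sF fF] ->]].
  have E alpha : d f alpha = lambda (mdeg alpha) * coef F alpha.
    by congr (_ * _); exact: coef_ae.
  split; first by rewrite sqrtr_sqr ger0_norm ?sqrtr_ge0.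
    move=> alpha; rewrite E normcM ler_pM//.
    exact: normc_coef_le.
  move=> N; rewrite sqr_sqrtr ?nrm2_ge0//.
  apply: (@le_trans _ _ (B ^+ 2 * \sum_(alpha <- box n N) normc (coef F alpha) ^+ 2)).
    rewrite mulr_sumr; apply: ler_sum => alpha _; rewrite E normcM exprMn.
    by rewrite ler_wpM2r ?sqr_ge0// ler_pXn2r// nnegrE.
  by rewrite ler_wpM2l ?sqr_ge0//; apply: bessel => //; exact: box_uniq.
have L0 f : 0 <= L2norm f by exact: sqrtr_ge0.
split.
- move=> f /key[_ dB dC].
  by apply: fock_fser dB dC; rewrite mulr_ge0.
- move=> a f h ff fh z.
  have [_ fB _] := key f ff; have [_ hB _] := key h fh.
  rewrite /diag -(fserD a z _ _ fB hB) ?mulr_ge0//; congr fser; apply/funext => alpha.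
  have [F [mF sF fF] _] := in_L2_borel (proj2 ff).
  have [H [mH sH hH] _] := in_L2_borel (proj2 fh).
  rewrite /d (coef_ae alpha mF fF) (coef_ae alpha mH hH).
  rewrite (@coef_ae _ _ _ (fun p => a * F p + H p)).
  + by rewrite coefD//; ring.
  + by apply: cmeasD => //; apply: cmeasM => //; exact: cmeas_cst.
  + by apply: filterS2 fF hH => p -> ->.
- exists B => f /key[E dB dC].
  apply: le_trans (L2norm_fser _ dB dC) _; first by rewrite mulr_ge0.
  by rewrite sqrtrM ?sqr_ge0// -E sqrtr_sqr ger0_norm.
Qed.

End fock_series.

(** * Toeplitz operators with radial symbol *)

Section toeplitz_radial.
Variables (R : realType) (n : nat).
Local Notation mR := (measurableTypeR R).
Local Notation X := (mR * mR)%type.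
Local Notation L := (@lebesgueC R n).
Local Notation normc := (@Normc.normc R).
Variables (g : 'rV[R[i]]_n -> R[i]) (h : n.-tuple X -> R[i]).
Implicit Types (f : 'rV[R[i]]_n -> R[i]) (F : n.-tuple X -> R[i]).
Implicit Types (alpha : {ffun 'I_n -> nat}).
Hypothesis gh : {ae L, forall p, g (cvec p) = h p}.

Lemma radial_symbol_ae : cmeas h -> radial g ->
  (forall alpha, in_L2 (fun z => g z * zeta alpha z)) -> radial_symbol h.
Proof.
move=> mh rg gz; split=> //.
  move=> f [fL fs]; have := ae_mpres fL gh; apply: filterS2 gh => p <- <-.
  by apply: rg; rewrite /cnorm fs.
move=> alpha; have [_ oo] := gz alpha.
pose c := zeta_coef R alpha.
have c0 : c != 0.
  apply/negP => /eqP c0; have := zeta_coef_sqr R alpha; rewrite -/c c0 expr0n /=.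
  move/esym/eqP; rewrite prodf_seq_eq0 => /hasP[j _] /=; rewrite invr_eq0.
  by rewrite mulf_eq0 expf_eq0/= !pnatr_eq0 andbF/= eqn0Ngt fact_gt0.
have sz : sqint (fun p => h p * zeta alpha (cvec p)).
  apply: sqintP; first by apply: cmeasM => //; exact: cmeas_zeta.
  suff <- : sq_L2norm (fun z => g z * zeta alpha z) =
    (\int[L]_p (normc (h p * zeta alpha (cvec p)) ^+ 2 * gd p)%:E)%E by [].
  apply: ge0_integral_ae.
  - by move=> p; rewrite lee_fin; exact: (sq_gd_ge0 (fun p => g (cvec p) * _)).
  - by move=> p; rewrite lee_fin; exact: (sq_gd_ge0 (fun p => h p * _)).
  - apply/measurable_EFinP; apply: measurable_sq.
    by apply: cmeasM => //; exact: cmeas_zeta.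
  - by apply: filterS gh => p ->.
have -> : (fun p => h p * mono alpha p) =
    (fun p => (c^-1)%:C * (h p * zeta alpha (cvec p))).
  apply/funext => p; rewrite zetaE -/c.
  transitivity (h p * mono alpha p * ((c^-1)%:C * c%:C)); last by ring.
  by rewrite -(rmorphM (real_complex R)) mulVf// mulr1.
exact: sqintZ.
Qed.

Variable i : 'I_n.
Hypothesis hP : radial_symbol h.
Let mh : cmeas h. Proof. by case: hP. Qed.

Lemma toeplitz_fser f : cmeas (fun p => f (cvec p)) ->
  sqint (fun p => h p * f (cvec p)) ->
  toeplitz g f = fser (coef (fun p => h p * f (cvec p))).
Proof.
move=> mf sf; apply/funext => z.
have mhf : cmeas (fun p => h p * f (cvec p)) by exact: cmeasM.
have := climitE (proj_expansion z mhf sf); rewrite /fser => ->.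
apply: cI_ae.
  apply: cmeasM; last exact: cmeas_gd.
  by apply: cmeasM => //; exact: cmeas_kernel.
by apply: filterS gh => p ->.
Qed.

Lemma toeplitz_zeta alpha : toeplitz g (zeta alpha) =
  (fun z => eigen h i (mdeg alpha) * zeta alpha z).
Proof.
rewrite toeplitz_fser; [|exact: cmeas_zeta|exact: sqint_radial_zeta].
apply/funext => z; rewrite -fser_delta; congr fser; apply/funext => beta.
rewrite (coef_radial i)// /eigen.
by case: eqVneq => // ->.
Qed.

Lemma toeplitz_diag f : zeta_span f -> diag (eigen h i) f = toeplitz g f.
Proof.
move=> [s fE]; rewrite (funext fE).
have mt alpha : cmeas (fun p => h p * zeta alpha (cvec p)).
  by apply: cmeasM => //; exact: cmeas_zeta.
have hfE : (fun p => h p * \sum_(t <- s) t.1 * zeta t.2 (cvec p)) =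
    (fun p => \sum_(t <- s) t.1 * (h p * zeta t.2 (cvec p))).
  apply/funext => p; rewrite mulr_sumr; apply: eq_bigr => t _.
  by rewrite mulrCA.
rewrite toeplitz_fser; last 2 first.
- apply: cmeas_sum => t; apply: cmeasM; [exact: cmeas_cst|exact: cmeas_zeta].
- rewrite hfE; apply: (@sqint_lincomb _ _ _ _ (fun t p => h p * zeta t.2 (cvec p))) => t //.
  exact: sqint_radial_zeta.
rewrite /diag hfE; congr fser; apply/funext => alpha.
rewrite (@coef_lincomb _ _ _ _ (fun t p => zeta t.2 (cvec p))); last 2 first.
- by move=> t; exact: cmeas_zeta.
- by move=> t; exact: sqint_zeta.
rewrite (@coef_lincomb _ _ _ _ (fun t p => h p * zeta t.2 (cvec p))) => [|t//|t]; last first.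
  exact: sqint_radial_zeta.
rewrite mulr_sumr; apply: eq_bigr => t _; rewrite coef_zeta (coef_radial i)// mulrCA.
by congr (_ * _); case: eqP => _; rewrite ?mulr1 ?mulr0.
Qed.

Lemma convolution_laguerre k :
  cint (fun w => convolution g (fun z => (heat_kernel 4^-1 z)%:C) w *
                 (laguerre_fun k (2 *: w))%:C) =
  ((-1) ^+ k * pi ^+ n)%:C * ('C(k + n.-1, n.-1)%:R * eigen h i k).
Proof.
rewrite -(cI_heat_laguerre hP i k); apply: (congr1 (@cI _ _ _ L)).
apply/funext => w; apply: (congr1 (fun x => x * _)).
apply: cI_ae; last by apply: filterS gh => p ->.
apply: cmeasM => //; apply: cmeas_real.
apply: measurable_funM => //; apply: measurableT_comp => //.
by apply: measurable_funN; apply: measurable_funM => //; exact: measurable_gapl.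
Qed.

(** The factorials are the inverse of the number of monomials of degree k,
    which cancels the multiplicity of the eigenvalue. *)
Lemma normc_convolution_laguerre k : (0 < n)%N ->
  normc (((k`!%:R * (n - 1)%N`!%:R) / (k + n - 1)%N`!%:R)%:C *
    cint (fun w => convolution g (fun z => (heat_kernel 4^-1 z)%:C) w *
                   (laguerre_fun k (2 *: w))%:C)) = pi ^+ n * normc (eigen h i k).
Proof.
move=> n0; rewrite convolution_laguerre; move: (eigen h i k) => lambda.
rewrite !normcM !normc_real subn1.
rewrite (_ : normc 'C(k + n.-1, n.-1)%:R = 'C(k + n.-1, n.-1)%:R); last first.
  by rewrite natr_complex normc_real normr_nat.
have /(congr1 (fun k => k%:R : R)) := bin_fact (leq_addl k n.-1).
rewrite addnK !natrM -addnBA// subn1 => E.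
have f0 m : m`!%:R != 0 :> R by rewrite pnatr_eq0 -lt0n fact_gt0.
rewrite [`|(-1) ^+ k * _|]normrM normr_sign mul1r !normrM normfV !normr_nat -E.
rewrite (ger0_norm (exprn_ge0 _ (pi_ge0 R))).
have C0 : 'C(k + n.-1, n.-1)%:R != 0 :> R by rewrite pnatr_eq0 -lt0n bin_gt0 leq_addl.
move: (f0 k) (f0 n.-1) C0; move: (k`!%:R) (n.-1`!%:R) ('C(_, _)%:R) => a b c a0 b0 c0.
by field; rewrite a0 b0 c0.
Qed.

End toeplitz_radial.

Theorem theorem2p1 (R : realType) (n : nat) (n_gt0 : (0 < n)%N)
    (g : 'rV[R[i]]_n -> R[i])
    (g_measurable : lebesgue_measurable_fun g)
    (g_radial : radial g)
    (g_zeta : forall alpha : {ffun 'I_n -> nat},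
      in_L2 (fun z => g z * zeta alpha z)) :
  toeplitz_bounded g <->
  exists M : R, forall k : nat,
    Normc.normc
      (((k`!%:R * (n - 1)%N`!%:R) / (k + n - 1)%N`!%:R)%:C *
       cint (fun w => convolution g (fun z => (heat_kernel 4^-1 z)%:C) w *
                      (laguerre_fun k (2 *: w))%:C)) <= M.
Proof.
have [h mh gh] := g_measurable.
have hP : radial_symbol (fun p => h (cvec p)) by exact: radial_symbol_ae gh _ _ _.
pose i := Ordinal n_gt0; pose lambda := eigen (fun p => h (cvec p)) i.
have aE k := normc_convolution_laguerre gh i hP k n_gt0.
have pi_n0 : 0 < pi ^+ n :> R by rewrite exprn_gt0// pi_gt0.
split=> [[S [[_ _ [M SM]] ST]]|[M aM]].
- exists (pi ^+ n * M) => k; rewrite aE; apply: ler_wpM2l; first exact: ltW.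
  pose alpha : {ffun 'I_n -> nat} := single i k.
  have alphak : mdeg alpha = k.
    rewrite /mdeg (bigD1 i)//= big1 ?addn0 ?ffunE ?eqxx// => j ji.
    by rewrite ffunE (negbTE ji).
  have := SM _ (fock_zeta R alpha).
  rewrite ST; last by exists [:: (1, alpha)] => z; rewrite big_seq1 mul1r.
  rewrite (toeplitz_zeta gh i hP) alphak L2norm_zeta.
  have -> : zeta (R := R) alpha = fun z => 1 * zeta alpha z.
    by apply/funext => z; rewrite mul1r.
  by rewrite L2norm_zeta normc_real normr1 mulr1.
- exists (diag lambda); split; last exact: (toeplitz_diag gh i hP).
  apply: (@diag_bounded _ _ _ (M / pi ^+ n)) => k.
  by rewrite ler_pdivlMr// mulrC -aE.
Qed.
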